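(* Every checkerboard colorable (CC) virtual link type $L$ is realized by an element of Thompson's group $V$; that is, for every CC virtual link type $L$ there exists $v\in V$ such that the virtual link diagram $\mathscr{L}_V(v)$ is a diagram of $L$.
   Context: **Thompson's group $V$.** All trees are finite planar rooted binary trees (each non-leaf vertex has a left child and a right child); leaves are numbered from left to right. A tree with $n$ leaves determines a partition of $[0,1)$ into $n$ half-open standard dyadic intervals by repeated halving. A triple $(T_+,T_-,\sigma)$, where $T_+,T_-$ are trees with the same number $n$ of leaves and $\sigma\in S_n$, represents the bijection of $[0,1)$ mapping, affinely and increasingly, the $i$-th interval of $T_+$ onto the $\sigma(i)$-th interval of $T_-$. Thompson's group $V$ is the group of all such bijections under composition. Adding a canceling caret to a triple means: for some $i$, attach a caret (two new leaf children) to the $i$-th leaf of $T_+$ and to the $\sigma(i)$-th leaf of $T_-$, and change $\sigma$ to the permutation matching the new left leaf with the new left leaf, the new right leaf with the new right leaf, and all other leaves as before. Two triples represent the same element iff they are related by adding/removing canceling carets; a triple is reduced if no canceling caret can be removed, and each element of $V$ has a unique reduced triple. **Virtual links.** A virtual link diagram is a link diagram in $\mathbb{R}^2$ each of whose crossings is marked as a classical over/under crossing or as a virtual crossing. Two are equivalent if related by a finite sequence of planar isotopies, classical Reidemeister moves, and detour moves (a portion of an arc containing only virtual crossings may be rerouted arbitrarily, with all new crossings virtual). A virtual link type is an equivalence class (unoriented here). A link diagram on a closed oriented surface $\Sigma$ represents a virtual link type (immerse a neighborhood of the diagram in the plane preserving orientation, marking the extra crossings as virtual), and every virtual link type arises this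 way. A virtual link type is checkerboard colorable (CC) if it can be represented by a diagram $D$ on some such surface $\Sigma$ with $[D]=0\in H_1(\Sigma;\mathbb{Z}_2)$. **The diagram $\mathscr{L}_V(T_+,T_-,\sigma)$.** Let $T$ be a tree with $n$ leaves drawn growing downward. At each non-leaf vertex add a middle edge between its two child edges, running down to the leaf level in the gap between the leaves of the left subtree and those of the right subtree; also attach an edge to the root going up and then around the left side of the tree down to the leaf level. Each non-leaf vertex of $T$ is now 4-valent (up, left, middle, right edges); replace it by a classical crossing in which the strand consisting of the left and right edges passes over the strand consisting of the up and middle edges. This gives a tangle with $2n$ endpoints at the leaf level. Checkerboard-shade it with the outside face unshaded; for each $i=1,\dots,n$ the shaded surface reaches the leaf level in one band, namely the one bounded by the $(2i-1)$-st and $2i$-th strands (the $i$-th leaf edge and the strand immediately to its left). Do this for $T_+$; do it for $T_-$ and reflect the result in a horizontal line of the plane (the left-right strand is still over at each crossing), placing it below. Join the $i$-th band of the top surface to the $\sigma(i)$-th band of the bottom surface by flat untwisted bands, for all $i$, with all intersections of distinct bands marked as virtual crossings. The boundary of the resulting (checkerboard) surface is the virtual link diagram $\mathscr{L}_V(T_+,T_-,\sigma)$; it is well-defined up to detour moves. For $v\in V$, $\mathscr{L}_V(v)$ denotes $\mathscr{L}_V(T_+,T_-,\sigma)$ for the reduced triple of $v$. *)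

(* Defs.v *)
From Stdlib Require Export Relations.Relation_Operators.
From mathcomp Require Export all_boot all_order all_fingroup all_algebra reals.

Set Implicit Arguments.
Unset Strict Implicit.
Unset Printing Implicit Defensive.

(******************************************************************************)
(* Plane diagrams are taken in Morse position: a diagram is read from top to  *)
(* bottom as a word of elementary pieces, each containing one local maximum,  *)
(* local minimum, classical crossing or virtual crossing, the other strands   *)
(* running vertically beside it.  Every plane diagram is planar isotopic to   *)
(* one in Morse position, and two such diagrams are planar isotopic exactly   *)
(* when they are related by the moves [planar_isotopy] below.                 *)
(******************************************************************************)

(* [Cross true] is a classical crossing whose over strand runs from the upper
   left to the lower right; in [Cross false] it is the other strand. *)
Inductive kind := Cup | Cap | Cross of bool | Virt.

(* [Cup] is a local maximum: it creates two strands; [Cap] is a local minimum: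
   it joins two strands. *)
Definition ain (k : kind) : nat := if k is Cup then 0 else 2.
Definition aout (k : kind) : nat := if k is Cap then 0 else 2.

(* [(k, i)] is a piece of kind [k] with exactly [i] strands on its left. *)
Definition piece : Type := kind * nat.
Definition word := seq piece.

(* Number of strands below [w] when there are [m] strands above it. *)
Definition width (m : nat) (w : word) : nat :=
  foldl (fun n (e : piece) => n - ain e.1 + aout e.1) m w.

Fixpoint composable (m : nat) (w : word) : bool :=
  if w is e :: w' then
    (e.2 + ain e.1 <= m) && composable (width m [:: e]) w'
  else true.

(* Links are nonempty: the empty diagram is not a link diagram. *)
Definition is_diagram (w : word) : bool :=
  [&& ~~ nilp w, composable 0 w & width 0 w == 0].

(* The point [(l, j)] is the [j]-th strand (counted from 0) at the height
   between the [l]-th piece and the one above it. *)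
Definition point : Type := nat * nat.

Definition point_of (m : nat) (w : word) (p : point) : Prop :=
  p.1 <= size w /\ p.2 < width m (take p.1 w).

(* Two points joined by a strand inside one piece.  Virtual crossings are
   traversed; strands are cut at classical crossings, so that the classes of
   [arc w] are the arcs between classical crossings, and the components
   without classical crossing. *)
Inductive strand (w : word) : point -> point -> Prop :=
| StrandLeft l k i j : onth w l = Some (k, i) -> j < i ->
    strand w (l, j) (l.+1, j)
| StrandRight l k i j : onth w l = Some (k, i) -> i + ain k <= j ->
    strand w (l, j) (l.+1, j - ain k + aout k)
| StrandCup l i : onth w l = Some (Cup, i) ->
    strand w (l.+1, i) (l.+1, i.+1)
| StrandCap l i : onth w l = Some (Cap, i) ->
    strand w (l, i) (l, i.+1)
| StrandVirt1 l i : onth w l = Some (Virt, i) ->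
    strand w (l, i) (l.+1, i.+1)
| StrandVirt2 l i : onth w l = Some (Virt, i) ->
    strand w (l, i.+1) (l.+1, i).

Definition arc (w : word) : point -> point -> Prop :=
  clos_refl_sym_trans point (strand w).

(* A bijection between the classes of [eX] on [X] and those of [eY] on [Y],
   sending the class of [x] to that of [y] whenever [bd x y]. *)
Definition class_bijection (TX TY : Type)
    (X : TX -> Prop) (eX : TX -> TX -> Prop)
    (Y : TY -> Prop) (eY : TY -> TY -> Prop) (bd : TX -> TY -> Prop) : Prop :=
  exists (f : TX -> TY) (g : TY -> TX),
    [/\ (forall x, X x -> Y (f x)) /\ (forall y, Y y -> X (g y)),
        forall x x', X x -> X x' -> eX x x' -> eY (f x) (f x'),
        forall y y', Y y -> Y y' -> eY y y' -> eX (g y) (g y'),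
        (forall x, X x -> eX (g (f x)) x) /\ (forall y, Y y -> eY (f (g y)) y)
      & forall x y, bd x y -> eY (f x) y].

Inductive planar_isotopy : word -> word -> Prop :=
(* two pieces lying side by side, the piece [k] on the left, exchange heights *)
| Interchange k i k' i' : i + ain k <= i' ->
    planar_isotopy [:: (k', i'); (k, i)]
                   [:: (k, i); (k', i' - ain k + aout k)]
| ZigzagL i : planar_isotopy [:: (Cup, i.+1); (Cap, i)] [::]
| ZigzagR i : planar_isotopy [:: (Cup, i); (Cap, i.+1)] [::]
(* a strand crossing one side of a maximum or minimum slides to the other side;
   the crossing is rotated by a quarter turn *)
| CrossCup b i : planar_isotopy [:: (Cup, i); (Cross b, i.+1)]
                                [:: (Cup, i.+1); (Cross (~~ b), i)]
| CrossCap b i : planar_isotopy [:: (Cross b, i.+1); (Cap, i)]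
                                [:: (Cross (~~ b), i); (Cap, i.+1)]
| VirtCup i : planar_isotopy [:: (Cup, i); (Virt, i.+1)]
                             [:: (Cup, i.+1); (Virt, i)]
| VirtCap i : planar_isotopy [:: (Virt, i.+1); (Cap, i)]
                             [:: (Virt, i); (Cap, i.+1)].

Inductive reidemeister : word -> word -> Prop :=
| R1Cup b i : reidemeister [:: (Cup, i); (Cross b, i)] [:: (Cup, i)]
| R1Cap b i : reidemeister [:: (Cross b, i); (Cap, i)] [:: (Cap, i)]
| R2 b i : reidemeister [:: (Cross b, i); (Cross (~~ b), i)] [::]
(* the hypothesis says that one of the three strands is above the two others *)
| R3 a b c i : (a == b) || (b == c) ->
    reidemeister [:: (Cross a, i); (Cross b, i.+1); (Cross c, i)]
                 [:: (Cross c, i.+1); (Cross b, i); (Cross a, i.+1)].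

Definition virtual_piece (e : piece) : bool := if e.1 is Cross _ then false else true.

(* [DetourStrip]: in a horizontal strip containing no classical crossing the
   arcs are rerouted arbitrarily, keeping their end points (closed curves in
   the strip correspond to closed curves).
   [DetourCross]: an arc meeting the two strands of a classical crossing
   virtually is moved across that crossing.
   Together with planar isotopy these generate all reroutings of an arc. *)
Inductive detour (m : nat) : word -> word -> Prop :=
| DetourStrip u u' :
    all virtual_piece u -> all virtual_piece u' ->
    composable m u -> composable m u' -> width m u = width m u' ->
    class_bijection (point_of m u) (arc u) (point_of m u') (arc u')
      (fun p q => exists j,
         [/\ p = (0, j), q = (0, j) & j < m] \/
         [/\ p = (size u, j), q = (size u', j) & j < width m u]) ->
    detour m u u'
| DetourCross b i :
    detour m [:: (Virt, i); (Virt, i.+1); (Cross b, i)]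
             [:: (Cross b, i.+1); (Virt, i); (Virt, i.+1)].

Definition local_move (m : nat) (u u' : word) : Prop :=
  [\/ planar_isotopy u u', reidemeister u u' | detour m u u'].

Inductive move : word -> word -> Prop :=
| Move p u u' s :
    is_diagram (p ++ u ++ s) -> is_diagram (p ++ u' ++ s) ->
    local_move (width 0 p) u u' -> move (p ++ u ++ s) (p ++ u' ++ s).

Definition vequiv : word -> word -> Prop := clos_refl_sym_trans word move.

Definition virtual_link_type (L : word -> Prop) : Prop :=
  exists2 w, is_diagram w & forall w', L w' <-> vequiv w w'.

(* A closed oriented surface with a cell decomposition is given by its set of
   darts (oriented edges), the permutation [node] turning a dart
   counterclockwise around its origin, and the permutation [edge] reversing
   darts.  The faces are the orbits of [node \o edge].  The diagram is a
   subcomplex of the 1-skeleton, made of the edges in [onD]; its crossings are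
   the vertices with four darts in [onD], and it is a curve passing straight
   through its other vertices.  The cell decomposition is arbitrary: it may
   have edges and vertices outside the diagram. *)

Definition diagram_degree (D : finType) (node : {perm D}) (onD : {set D})
    (d : D) : nat := #|porbit node d :&: onD|.

(* The next dart of the diagram counterclockwise around the same vertex. *)
Definition diagram_next (D : finType) (node : {perm D}) (onD : {set D})
    (d : D) : D := next [seq x <- fingraph.orbit node d | x \in onD] d.

Record surface_diagram := SurfaceDiagram {
  dart : finType;
  node : {perm dart};
  edge : {perm dart};
  onD : {set dart};
  over : {set dart};
  edgeK : forall d, edge (edge d) = d;
  edge_neq : forall d, edge d != d;
  onD_edge : forall d, (edge d \in onD) = (d \in onD);
  onD_degree : forall d, d \in onD ->
    (diagram_degree node onD d == 2) || (diagram_degree node onD d == 4);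
  (* at a crossing, the darts of the over strand alternate with the others *)
  over_next : forall d, d \in onD -> diagram_degree node onD d = 4 ->
    (diagram_next node onD d \in over) = (d \notin over) }.

Definition crossing_dart (S : surface_diagram) (d : dart S) : bool :=
  (d \in onD S) && (diagram_degree (node S) (onD S) d == 4).

Inductive surface_strand (S : surface_diagram) : dart S -> dart S -> Prop :=
| StrandEdge d : d \in onD S -> surface_strand d (edge S d)
| StrandNode d : d \in onD S -> diagram_degree (node S) (onD S) d = 2 ->
    surface_strand d (diagram_next (node S) (onD S) d).

Definition surface_arc (S : surface_diagram) : dart S -> dart S -> Prop :=
  clos_refl_sym_trans (dart S) (@surface_strand S).

(* Cellular homology with coefficients in Z/2: a 2-chain is a function
   constant on faces, and [[D] = 0] means that the 1-cycle [D] is a boundary. *)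
Definition two_chain (S : surface_diagram) (c : dart S -> 'F_2) : Prop :=
  forall d, c (node S (edge S d)) = c d.

Definition boundary (S : surface_diagram) (c : dart S -> 'F_2) (d : dart S) :=
  (c d + c (edge S d))%R.

Definition null_homologous (S : surface_diagram) : Prop :=
  exists c : dart S -> 'F_2,
    two_chain c /\ forall d, boundary c d = ((d \in onD S)%:R)%R.

(* The four half-strands at a classical crossing of a plane diagram, by their
   position: upper left, lower left, lower right, upper right. *)
Inductive corner := NW | SW | SE | NE.

Definition ccw (q : corner) : corner :=
  match q with NW => SW | SW => SE | SE => NE | NE => NW end.

Definition corner_point (l i : nat) (q : corner) : point :=
  match q with
  | NW => (l, i) | SW => (l.+1, i) | SE => (l.+1, i.+1) | NE => (l, i.+1)
  end.

Definition corner_over (b : bool) (q : corner) : bool :=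
  match q with NW | SE => b | SW | NE => ~~ b end.

Definition leg (w : word) (l : nat) : Prop :=
  exists b i, onth w l = Some (Cross b, i).

(* [w] is the image of the diagram under an orientation preserving immersion
   in the plane of a neighborhood of it: the classical crossings of [w]
   correspond to the crossings of the surface diagram (via [phi], which maps
   the four half-strands at each crossing to darts, respecting cyclic order
   and over/under information), and they are connected by corresponding arcs. *)
Definition plane_immersion (S : surface_diagram) (w : word) : Prop :=
  exists phi : nat -> corner -> dart S,
    [/\ forall l b i q, onth w l = Some (Cross b, i) ->
          [/\ crossing_dart (phi l q),
              phi l (ccw q) = diagram_next (node S) (onD S) (phi l q)
            & (phi l q \in over S) = corner_over b q],
        forall l l' q q', leg w l -> leg w l' ->
          phi l q = phi l' q' -> l = l' /\ q = q',
        forall d, crossing_dart d -> exists l q, leg w l /\ d = phi l q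
      & class_bijection (point_of 0 w) (arc w)
          (fun d => d \in onD S) (@surface_arc S)
          (fun p d => exists l b i q, [/\ onth w l = Some (Cross b, i),
             p = corner_point l i q & d = phi l q])].

Definition checkerboard_colorable (L : word -> Prop) : Prop :=
  exists S : surface_diagram, null_homologous S /\
  exists w, is_diagram w /\ L w /\ plane_immersion S w.

Inductive tree := Leaf | Node of tree & tree.

Fixpoint leaves (T : tree) : nat :=
  if T is Node T1 T2 then leaves T1 + leaves T2 else 1.

(* Leaves are counted from 0. *)
Fixpoint attach (T : tree) (i : nat) : tree :=
  if T is Node T1 T2 then
    if i < leaves T1 then Node (attach T1 i) T2
    else Node T1 (attach T2 (i - leaves T1))
  else Node Leaf Leaf.

Record triple := Triple {
  Tplus : tree;
  Tminus : tree;
  same_leaves : leaves Tminus = leaves Tplus;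
  sigma : {perm 'I_(leaves Tplus)} }.

(* New index of the [j]-th leaf, or of its left child if [j = i], after a
   caret has been attached to the [i]-th leaf. *)
Definition shift (i j : nat) : nat := if j <= i then j else j.+1.

(* [t'] is obtained from [t] by adding a canceling caret at the [i]-th leaf. *)
Definition add_caret (t : triple) (i : 'I_(leaves (Tplus t))) (t' : triple) :=
  [/\ Tplus t' = attach (Tplus t) i,
      Tminus t' = attach (Tminus t) (sigma t i),
      forall (j : 'I_(leaves (Tplus t))) (k : 'I_(leaves (Tplus t'))),
        nat_of_ord k = shift i j ->
        nat_of_ord (sigma t' k) = shift (sigma t i) (sigma t j)
    & forall k : 'I_(leaves (Tplus t')),
        nat_of_ord k = i.+1 -> nat_of_ord (sigma t' k) = (sigma t i).+1].

Definition reduced (t : triple) : Prop := ~ exists t0 i, @add_caret t0 i t.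

Section Action.
Local Open Scope ring_scope.

Definition unit_interval (R : realType) : Type := {x : R | 0 <= x < 1}.

(* The subdivision of [a, a + l[ given by a tree: a list of pairs
   (left end, length). *)
Fixpoint intervals (R : realType) (T : tree) (a l : R) : seq (R * R) :=
  if T is Node T1 T2 then
    intervals T1 a (l / 2) ++ intervals T2 (a + l / 2) (l / 2)
  else [:: (a, l)].

Definition represents (R : realType) (t : triple)
    (v : unit_interval R -> unit_interval R) : Prop :=
  forall (i : 'I_(leaves (Tplus t))) (x : unit_interval R),
    let I := nth (0, 1) (intervals (Tplus t) 0 1) i in
    let J := nth (0, 1) (intervals (Tminus t) 0 1) (sigma t i) in
    I.1 <= val x < I.1 + I.2 ->
    val (v x) = J.1 + (val x - I.1) * (J.2 / I.2).

(* Such a [v] is determined by [t], and is a bijection. *)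
Definition in_V (R : realType) (v : unit_interval R -> unit_interval R) : Prop :=
  exists t, represents t v.

End Action.

Definition reduced_triple_of (R : realType)
    (v : unit_interval R -> unit_interval R) (t : triple) : Prop :=
  represents t v /\ reduced t.

(* The tangle of [T] below the strand number [p], which enters the root from
   above.  At a vertex the left and right edges form a local maximum placed to
   the left of the incoming strand, which then passes under its right side to
   become the middle edge. *)
Fixpoint tree_tangle (T : tree) (p : nat) : word :=
  if T is Node T1 T2 then
    [:: (Cup, p); (Cross true, p.+1)] ++
    tree_tangle T1 p ++ tree_tangle T2 (p + (leaves T1).*2)
  else [::].

(* The first [Cup] joins the edge going up from the root (strand 1) to the
   strand descending on the left of the tree (strand 0). *)
Definition top_tangle (T : tree) : word := (Cup, 0) :: tree_tangle T 1.

Definition flip_kind (k : kind) : kind :=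
  match k with Cup => Cap | Cap => Cup | Cross b => Cross (~~ b) | Virt => Virt end.

(* Reflection in a horizontal line of the plane; the over strand stays over. *)
Definition flip_word (w : word) : word :=
  rev [seq (flip_kind e.1, e.2) | e <- w].

(* Band [k] consists of the strands [2k] and [2k+1]; the bands [k] and [k+1]
   cross virtually. *)
Definition band_swap (k : nat) : word :=
  [:: (Virt, k.*2.+1); (Virt, k.*2); (Virt, k.*2.+2); (Virt, k.*2.+1)].

(* Bring the bands number [k], [k+1], ..., whose final relative order is given
   by [s], to their final positions by insertion sort. *)
Fixpoint band_tangle (k : nat) (s : seq nat) : word :=
  if s is x :: s' then
    band_tangle k.+1 s' ++
    flatten [seq band_swap j | j <- iota k (count (fun y => y < x) s')]
  else [::].

(* The top surface reaches the leaf level in the bands [0, ..., n-1]; bands are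
   flat, so the left (right) strand of the band [i] is joined to the left
   (right) strand of the band [sigma i]. *)
Definition LV (t : triple) : word :=
  top_tangle (Tplus t) ++
  band_tangle 0 [seq nat_of_ord (sigma t i) | i <- enum 'I_(leaves (Tplus t))] ++
  flip_word (top_tangle (Tminus t)).

(* Main.v *)
(** A shaded null-homologous diagram has a source-sink orientation: the arcs can be
    oriented so that incoming and outgoing half-strands alternate at every classical
    crossing.  Up to detours a diagram is its planar diagram code, so it is given by
    its crossings, of two types (the incoming or the outgoing strand is over), and
    an arbitrary bijection from outgoing to incoming ends.  The crossings of T_+ are
    of the first type and those of T_- of the second.

    Take for T_+ a left comb and for T_- a left spine whose right subtrees are leaves
    and carets.  The carets at the ends of the bands of the leaves cancel by R2; what
    is left of a spine vertex with a caret is a hub, a pair of crossings of opposite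
    types traversed by three strands, and what is left of one with a leaf is a pair
    of arcs exchanged between the strand running along T_+ and that along T_-.
    Such exchanges are transpositions generating all permutations, so the ends of
    the hubs can be connected by any bijection; closing some strands of a hub up to
    kinks, removed by R1, leaves an arbitrary crossing or a free arc.  The triple is
    reduced because the only caret of T_+ with two leaves is at the leaves 0 and 1,
    and leaf 1 is not sent to leaf 1. *)

Require Import Defs.
From mathcomp Require Import boolp zify lra.
From mathcomp Require classical_sets.

Set Implicit Arguments.
Unset Strict Implicit.
Unset Printing Implicit Defensive.

(** * Tangles up to local moves *)

(** Since [sigma] permutes only whole bands, it cannot connect strands at will. Moreover the left
    edges of the two trees run through all carets in one closed circuit: up T_+, through the roots
    to T_-, down T_- and back through the band of the leaves 0. The label leaving a caret is always
    the one entering the next caret of this circuit, and the connectors serve to break this rigid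
    cyclic order. A connector reroutes one strand of T_+ and one of T_- together, so only
    transpositions mixing the two trees come directly; the others are conjugates of these, by a
    strand of some hub.

    The geometric obstacle is that moves act on words, where pieces cannot be permuted freely. Every
    maximum and every crossing is therefore pulled out into a block with all legs pointing down.
    Below the blocks only a virtual strip without maxima remains, and two strips pairing the legs
    alike differ by a single detour. Reidemeister moves thus become rewriting rules on codes with
    labelled legs, independent of any drawing, and both the given diagram and [LV t] are simplified
    to codes that agree up to renaming of labels. *)

Lemma width_cat m u v : width m (u ++ v) = width (width m u) v.
Proof. by rewrite /width foldl_cat. Qed.

Lemma width_cons m e u : width m (e :: u) = width (m - ain e.1 + aout e.1) u.
Proof. by []. Qed.

Lemma composable_cons m e u : composable m (e :: u) =
  (e.2 + ain e.1 <= m) && composable (m - ain e.1 + aout e.1) u.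
Proof. by []. Qed.

Lemma composable_cat m u v :
  composable m (u ++ v) = composable m u && composable (width m u) v.
Proof. by elim: u m => //= e u IH m; rewrite IH andbA. Qed.

Definition shiftw k (w : word) : word := [seq (e.1, k + e.2) | e <- w].

Lemma shiftw_cat k u v : shiftw k (u ++ v) = shiftw k u ++ shiftw k v.
Proof. exact: map_cat. Qed.

Lemma shiftw0 w : shiftw 0 w = w.
Proof. by elim: w => [|[k i] w IH] //=; rewrite IH. Qed.

Lemma composable_shiftw k m w : composable m w ->
  composable (k + m) (shiftw k w) /\ width (k + m) (shiftw k w) = k + width m w.
Proof.
elim: w m => [|[t i] w IH] m //= /andP[h1 h2].
have e : k + m - ain t + aout t = k + (m - ain t + aout t) by lia.
rewrite /width /= -!/(width _ _) in h2 *; rewrite e.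
have [-> ->] := IH _ h2; split=> //; rewrite andbT; lia.
Qed.

Lemma composable_le m k w : composable m w ->
  composable (m + k) w /\ width (m + k) w = width m w + k.
Proof.
elim: w m => [|[t i] w IH] m //= /andP[h1 h2].
have e : m + k - ain t + aout t = (m - ain t + aout t) + k by lia.
rewrite /width /= -!/(width _ _) in h2 *; rewrite e.
have [-> ->] := IH _ h2; split=> //; rewrite andbT; lia.
Qed.

(* The last hypothesis keeps the diagram nonempty. *)
Inductive tstep (m : nat) : word -> word -> Prop :=
| TStep a x x' b :
    composable m (a ++ x ++ b) -> composable m (a ++ x' ++ b) ->
    width m (a ++ x ++ b) = width m (a ++ x' ++ b) ->
    local_move (width m a) x x' ->
    (0 < width m a) || (~~ nilp x && ~~ nilp x') ->
    tstep m (a ++ x ++ b) (a ++ x' ++ b).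

Definition teq m := clos_refl_sym_trans word (tstep m).

Lemma teq_refl m u : teq m u u.
Proof. exact: rst_refl. Qed.

Lemma teq_sym m u v : teq m u v -> teq m v u.
Proof. exact: rst_sym. Qed.

Lemma teq_trans m v u w : teq m u v -> teq m v w -> teq m u w.
Proof. exact: rst_trans. Qed.

Lemma teq_wd m u v : teq m u v ->
  composable m u = composable m v /\ (composable m u -> width m u = width m v).
Proof.
elim=> {u v} [u v [a x x' b -> -> -> //]|//|u v _ [e h]|u v w _ [e1 h1] _ [e2 h2]].
- by split=> [|hv]; rewrite ?h ?e.
- by split=> [|hu]; rewrite ?e1 // h1 // h2 // -e1.
Qed.

Lemma teq_ctx m p u v s : composable m (p ++ u ++ s) -> teq (width m p) u v ->
  teq m (p ++ u ++ s) (p ++ v ++ s).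
Proof.
move=> hc h.
have {hc} : composable m p /\ composable (width (width m p) u) s /\ composable (width m p) u.
  by move: hc; rewrite !composable_cat => /and3P[-> -> ->].
elim: h => {u v} [u v [a x x' b h1 h2 h3 h4 h5]|u|u v h IH|u v w h1 IH1 h2 IH2] [hp [hs hu]].
- apply: rst_step; rewrite -!catA.
  rewrite !(catA p); apply: TStep.
  + move: h1 hs; rewrite !composable_cat hp !width_cat /= => /and3P[-> -> ->] //.
  + move: h2 hs; rewrite !composable_cat hp h3 !width_cat /= => /and3P[-> -> ->] //.
  + by move: h3; rewrite !width_cat => ->.
  + by rewrite width_cat.
  + by rewrite width_cat.
- exact: rst_refl.
- have [e1 e2] := teq_wd h.
  by apply/rst_sym/IH; rewrite e1 (e2 _) // e1.
- have [e1 e2] := teq_wd h1.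
  apply: (rst_trans _ _ _ (p ++ v ++ s)); first exact: IH1.
  by apply: IH2; rewrite -(e2 _) // -e1.
Qed.

Lemma teq_catr m u v s : composable m (u ++ s) -> teq m u v -> teq m (u ++ s) (v ++ s).
Proof. by move=> h1 h2; apply: (@teq_ctx m [::]). Qed.

Lemma teq_catl m p u v : composable m (p ++ u) -> teq (width m p) u v ->
  teq m (p ++ u) (p ++ v).
Proof.
by move=> h1 h2; have := @teq_ctx m p u v [::]; rewrite !cats0; apply.
Qed.

(** The last condition of [tstep] makes [is_diagram] propagate: in a closed diagram a strand above
    the move forces the prefix to be nonempty, and otherwise both sides of the move are nonempty. *)
Lemma teq_vequiv u v : is_diagram u -> teq 0 u v -> is_diagram v /\ vequiv u v.
Proof.
move=> hu h.
(* The closure is symmetric, so the induction must accept a diagram at either end. *)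
have {hu} hu2 : is_diagram u \/ is_diagram v by left.
suff : is_diagram u /\ is_diagram v /\ vequiv u v by case=> _ [].
elim: h hu2 => {u v} [u v [a x x' b h1 h2 h3 h4 h5]|u|u v h IH|u v w h1 IH1 h2 IH2].
- move=> H; have hd : is_diagram (a ++ x ++ b) /\ is_diagram (a ++ x' ++ b).
    have e : nilp (a ++ x ++ b) = nilp (a ++ x' ++ b).
      case: a h1 h2 h3 h4 h5 H => // h1 h2 h3 h4 /= /andP[].
      by case: x h1 h3 h4; case: x' h2.
    move: H; rewrite /is_diagram e h1 h2 h3 /=; by case=> ->.
  split; [by case: hd | split; first by case: hd].
  by apply: rst_step; case: hd => *; apply: Move.
- by case=> h; repeat split => //; apply: rst_refl.
- move=> H; have [|h1 [h2 h3]] := IH; first by case: H; [right|left].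
  by repeat split => //; apply: rst_sym.
- move=> H. 
  have [hv|hv] : is_diagram u \/ is_diagram w by [].
    have [|a1 [a2 a3]] := IH1; first by left.
    have [|b1 [b2 b3]] := IH2; first by left.
    by repeat split => //; apply: rst_trans a3 b3.
  have [|b1 [b2 b3]] := IH2; first by right.
  have [|a1 [a2 a3]] := IH1; first by right.
  by repeat split => //; apply: rst_trans a3 b3.
Qed.

(** * Labelled readings and virtual strips *)

(* Nodes of planar diagram codes, whose arcs carry labels: [XN b x y z t] is a
   crossing [Cross b] with the arcs [x], [y], [z], [t] at its NW, SW, SE and NE
   corners, and [CN x y] is a point joining the arcs [x] and [y]. *)
Definition pdnode (T : Type) : Type := ((bool * T * T * T * T) + (T * T))%type.

Notation XN b x y z t := (@inl (bool * _ * _ * _ * _) (_ * _) (b, x, y, z, t)).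
Notation CN x y := (@inr (bool * _ * _ * _ * _) (_ * _) (x, y)).

Definition legs1 T (n : pdnode T) : seq T :=
  match n with
  | inl (_, x, y, z, t) => [:: x; y; z; t]
  | inr (x, y) => [:: x; y]
  end.

Definition legs T (P : seq (pdnode T)) : seq T := flatten [seq legs1 n | n <- P].

(* [reads w s P s']: the strands of the tangle [w] can be labelled by [s] at the
   top and by [s'] at the bottom, so that its maxima and classical crossings give
   the nodes [P].  New labels are introduced below each maximum and crossing. *)
Inductive reads (T : Type) : word -> seq T -> seq (pdnode T) -> seq T -> Prop :=
| ReadNil s : reads [::] s [::] s
| ReadCup w s1 s2 x y P s' :
    reads w (s1 ++ [:: x; y] ++ s2) P s' ->
    reads ((Cup, size s1) :: w) (s1 ++ s2) (CN x y :: P) s'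
| ReadCap w s1 s2 x P s' :
    reads w (s1 ++ s2) P s' ->
    reads ((Cap, size s1) :: w) (s1 ++ [:: x; x] ++ s2) P s'
| ReadVirt w s1 s2 x y P s' :
    reads w (s1 ++ [:: y; x] ++ s2) P s' ->
    reads ((Virt, size s1) :: w) (s1 ++ [:: x; y] ++ s2) P s'
| ReadCross w b s1 s2 x z t y P s' :
    reads w (s1 ++ [:: z; t] ++ s2) P s' ->
    reads ((Cross b, size s1) :: w) (s1 ++ [:: x; y] ++ s2) (XN b x z t y :: P) s'.

Lemma reads_width T w (s : seq T) P s' : reads w s P s' ->
  composable (size s) w /\ width (size s) w = size s'.
Proof.
elim=> {w s P s'} [s|w s1 s2 x y P s' _|w s1 s2 x P s' _|w s1 s2 x y P s' _|w b s1 s2 x z t y P s' _] //=;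
  rewrite /= !size_cat /= => -[h1 h2]; rewrite /width /= -!/(width _ _).
- rewrite (_ : _ + _ - 0 + 2 = size s1 + (size s2).+2); last lia.
  by rewrite h1 h2 andbT; split => //; lia.
- rewrite (_ : _ + _ - 2 + 0 = size s1 + (size s2)); last lia.
  by rewrite h1 h2 andbT; split => //; lia.
- rewrite (_ : _ + _ - 2 + 2 = size s1 + (size s2).+2); last lia.
  by rewrite h1 h2 andbT; split => //; lia.
- rewrite (_ : _ + _ - 2 + 2 = size s1 + (size s2).+2); last lia.
  by rewrite h1 h2 andbT; split => //; lia.
Qed.

Lemma reads_cat T w1 w2 (s1 s2 s3 : seq T) P1 P2 :
  reads w1 s1 P1 s2 -> reads w2 s2 P2 s3 -> reads (w1 ++ w2) s1 (P1 ++ P2) s3.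
Proof. by move=> h; elim: h s3 P2 => //= *; constructor; auto. Qed.

Lemma reads_ctx T w (l s r : seq T) P s' : reads w s P s' ->
  reads (shiftw (size l) w) (l ++ s ++ r) P (l ++ s' ++ r).
Proof.
elim=> {w s P s'} [s|w s1 s2 x y P s' _|w s1 s2 x P s' _|w s1 s2 x y P s' _|w b s1 s2 x z t y P s' _] /=;
  first by constructor.
all: rewrite -!catA ?(catA l) -size_cat /=; by constructor.
Qed.

Definition map_pdnode T T' (f : T -> T') (n : pdnode T) : pdnode T' :=
  match n with
  | inl (b, x, y, z, t) => XN b (f x) (f y) (f z) (f t)
  | inr (x, y) => CN (f x) (f y)
  end.

Lemma reads_map T T' (f : T -> T') w s P s' : reads w s P s' ->
  reads w (map f s) (map (map_pdnode f) P) (map f s').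
Proof.
elim=> {w s P s'} [s|w s1 s2 x y P s' _|w s1 s2 x P s' _|w s1 s2 x y P s' _|w b s1 s2 x z t y P s' _] /=;
  first by constructor.
all: rewrite !map_cat -(size_map f s1) /=; by constructor.
Qed.

Lemma legs_map T T' (f : T -> T') P : legs (map (map_pdnode f) P) = map f (legs P).
Proof.
rewrite /legs map_flatten -!map_comp; congr flatten; apply: eq_map.
by case=> [[[[[b x] y] z] t]|[x y]].
Qed.

Lemma legs_cat T (P Q : seq (pdnode T)) : legs (P ++ Q) = legs P ++ legs Q.
Proof. by rewrite /legs map_cat flatten_cat. Qed.

Lemma reads_virtual T w (s s' : seq T) : reads w s [::] s' -> all virtual_piece w.
Proof.
move E: [::] => P h; elim: h E => //=.
Qed.

Lemma reads_nil T w (s s' : seq T) : reads w s [::] s' -> size s = 0 -> w = [::].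
Proof.
move E: [::] => P h; case: h E => //= [w0 s1 s2 x P0 s0' _|w0 s1 s2 x y P0 s0' _] _;
  rewrite !size_cat /=; lia.
Qed.

Lemma strand_behead e u l j l' j' : strand u (l, j) (l', j') ->
  strand (e :: u) (l.+1, j) (l'.+1, j').
Proof.
move E1 : (l, j) => p; move E2 : (l', j') => q h.
case: h E1 E2 => {p q} => [l1 k i j1 h1 h2|l1 k i j1 h1 h2|l1 i h1|l1 i h1|l1 i h1|l1 i h1] [-> ->] [-> ->].
- exact: (StrandLeft (k := k) (i := i)).
- exact: (StrandRight (k := k) (i := i)).
- exact: StrandCup.
- exact: StrandCap.
- exact: StrandVirt1.
- exact: StrandVirt2.
Qed.

Lemma arc_behead e u p q : arc u p q ->
  arc (e :: u) (p.1.+1, p.2) (q.1.+1, q.2).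
Proof.
elim=> {p q} [[l j] [l' j'] h|p|p q _ h|p q r _ h1 _ h2].
- exact/rst_step/strand_behead.
- exact: rst_refl.
- exact: rst_sym.
- exact: rst_trans h1 h2.
Qed.

(* If each label occurs at most twice, the labels are the arcs of the strip. *)
Definition labelling (T : eqType) u (s s' : seq T) (lab : point -> option T) : Prop :=
 [/\ (forall j, lab (0, j) = onth s j), (forall j, lab (size u, j) = onth s' j),
     (forall p q, strand u p q -> lab p = lab q),
     (forall p, point_of (size s) u p -> exists2 j, j < size s & arc u p (0, j))
   & (forall x, count_mem x s <= 2) -> uniq s' ->
     forall j j', j < size s -> j' < size s -> onth s j = onth s j' ->
     arc u (0, j) (0, j')].

Lemma onth_insert (T : Type) (s1 s2 : seq T) x y j :
  onth (s1 ++ [:: x, y & s2]) j = if j < size s1 then onth s1 j else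
    if j == size s1 then Some x else if j == (size s1).+1 then Some y else
    onth s2 (j - (size s1).+2).
Proof.
rewrite !onth_cat; case: ifP => // h.
case: eqP => [->|n1]; first by rewrite subnn.
case: eqP => [->|n2]; first by rewrite subSnn.
by rewrite (_ : j - size s1 = (j - (size s1).+2).+2) //; lia.
Qed.

(** A reading without nodes has no maximum, so every strand runs up to the top row and takes its
    label from there. Equal labels at the top are joined by a minimum, since [uniq s'] forbids both
    strands to reach the bottom. *)
Lemma labelling_exists (T : eqType) u (s s' : seq T) :
  reads u s [::] s' -> exists lab, labelling u s s' lab.
Proof.
move E: [::] => P h; elim: h E => {u s P s'} [s|//|w s1 s2 x P s' h IH|w s1 s2 x y P s' h IH|//] E.
- exists (fun p => if p.1 == 0 then onth s p.2 else None); split=> //.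
  + by move=> p q; case=> [l k i j|l k i j|l i|l i|l i|l i]; rewrite onth0n.
  + by case=> l j [] /=; rewrite leqn0 => /eqP ->; exists j => //; apply: rst_refl.
  + move=> _ us j j' h1 h2 e; suff -> : j = j' by apply: rst_refl.
    have := h1; rewrite -onthTE; case e1: onth => [a|//] _.
    apply/eqP; rewrite -(nth_uniq a h1 h2 us).
    by rewrite -!odflt_onth -e.
- have [lab [l0 l1 l2 l3 l4]] := IH E.
  exists (fun p => if p.1 is l.+1 then lab (l, p.2) else onth (s1 ++ [:: x; x] ++ s2) p.2).
  have sz : size (s1 ++ [:: x; x] ++ s2) = (size s1 + size s2).+2.
    by rewrite !size_cat /=; lia.
  have szz : size (s1 ++ s2) = size s1 + size s2 by rewrite !size_cat.
  have up j1 : j1 < size s1 + size s2 -> exists2 j, j < (size s1 + size s2).+2 &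
     strand ((Cap, size s1) :: w) (0, j) (1, j1).
    move=> hj; have [hj1|hj1] := ltnP j1 (size s1).
      by exists j1; [lia | apply: (StrandLeft (k := Cap) (i := size s1))].
    exists (j1.+2); first lia.
    have := @StrandRight ((Cap, size s1) :: w) 0 Cap (size s1) j1.+2 erefl.
    by rewrite /= subn2 /= addn0; apply; lia.
  split=> //=.
  + move=> p q; case=> [[|l] k i j /=|[|l] k i j /=|[|l] i /=|[|l] i /=|[|l] i /=|[|l] i /=] //.
    * case=> _ <- hj; rewrite l0 onth_insert onth_cat hj //.
    * by move=> *; apply: l2; apply: (StrandLeft (k := k) (i := i)).
    * case=> <- <- /= hj; rewrite l0 onth_insert onth_cat addn0.
      by rewrite !ifN; [congr onth|..]; lia.
    * by move=> *; apply: l2; apply: (StrandRight (k := k) (i := i)).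
    * by move=> *; apply: l2; apply: StrandCup.
    * case=> <-; rewrite -[RHS]/(onth (s1 ++ [:: x, x & s2]) (size s1).+1).
      by rewrite !onth_insert ltnn !eqxx !ifF //; lia.
    * by move=> *; apply: l2; apply: StrandCap.
    * by move=> *; apply: l2; apply: StrandVirt1.
    * by move=> *; apply: l2; apply: StrandVirt2.
  + case=> [[|l] j] [] /=; rewrite /= ?sz ?take0 => h1 h2.
      by exists j => //; apply: rst_refl.
    have [|j1 hj1 a1] := l3 (l, j).
      split=> //=; rewrite szz; move: h2; rewrite /width /= -!/(width _ _).
      by rewrite (_ : _ - 2 + 0 = size s1 + size s2) //; lia.
    rewrite szz in hj1; have [j2 hj2 a2] := up _ hj1.
    exists j2; rewrite ?sz //; apply: rst_trans (arc_behead _ a1) _.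
    exact/rst_sym/rst_step.
  + move=> hc us' j j'; rewrite sz => hj hj' e.
    have hc' y : count_mem y (s1 ++ s2) <= 2.
      by apply: leq_trans (hc y); rewrite !count_cat /=; lia.
    (* The minimum uses up both allowed occurrences of [x], so no third strand with this label
       continues below it. *)
    have cx : count_mem x (s1 ++ s2) = 0.
      by have := hc x; rewrite !count_cat /= eqxx; lia.
    have down k : k < (size s1 + size s2).+2 -> (size s1 <= k < (size s1).+2) \/ 
       exists2 k1, k1 < size s1 + size s2 & strand ((Cap, size s1) :: w) (0, k) (1, k1) /\ onth (s1 ++ [:: x; x] ++ s2) k = onth (s1 ++ s2) k1.
      move=> hk; have [h1|h1] := ltnP k (size s1).
        right; exists k; first lia; split; last by rewrite onth_insert onth_cat h1.
        exact: (StrandLeft (k := Cap) (i := size s1)).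
      have [h2|h2] := ltnP k (size s1).+2; first by left.
      right; exists (k - 2); first lia; split; last first.
        by rewrite onth_insert onth_cat !ifN; [congr onth|..]; lia.
      have := @StrandRight ((Cap, size s1) :: w) 0 Cap (size s1) k erefl.
      by rewrite /= addn0; apply; lia.
    have notx k1 : onth (s1 ++ s2) k1 != Some x.
      have : x \notin s1 ++ s2 by rewrite -has_pred1 has_count cx.
      by move/onthPn; apply.
    have isx k : size s1 <= k < (size s1).+2 -> onth (s1 ++ [:: x; x] ++ s2) k = Some x.
      move=> hk; rewrite onth_insert ifN; last lia.
      by case: eqP => // n1; rewrite ifT //; lia.
    have [c|[k1 hk1 [a1 b1]]] := down _ hj; have [c'|[k2 hk2 [a2 b2]]] := down _ hj'.
    * have hs : arc ((Cap, size s1) :: w) (0, size s1) (0, (size s1).+1).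
        by apply/rst_step/StrandCap.
      have [->|->] : j = size s1 \/ j = (size s1).+1 by lia.
        have [->|->] : j' = size s1 \/ j' = (size s1).+1 by lia.
          exact: rst_refl.
        exact: hs.
      have [->|->] : j' = size s1 \/ j' = (size s1).+1 by lia.
        exact: rst_sym.
      exact: rst_refl.
    * by have := notx k2; rewrite -b2 -e isx // eqxx.
    * by have := notx k1; rewrite -b1 e isx // eqxx.
    * apply: rst_trans (rst_step _ _ _ _ a1) _.
      apply: rst_trans (rst_sym _ _ _ _ (rst_step _ _ _ _ a2)).
      have := l4 hc' us' k1 k2; rewrite szz => H.
      by have := arc_behead (Cap, size s1) (H hk1 hk2 _); rewrite /= -b1 -b2; apply.
- have [lab [l0 l1 l2 l3 l4]] := IH E.
  exists (fun p => if p.1 is l.+1 then lab (l, p.2) else onth (s1 ++ [:: x; y] ++ s2) p.2).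
  have sz a b : size (s1 ++ [:: a; b] ++ s2) = (size s1 + size s2).+2.
    by move=> *; rewrite !size_cat /=; lia.
  pose sw j := if j == size s1 then (size s1).+1 else if j == (size s1).+1 then size s1 else j.
  have swK j : sw (sw j) = j.
    rewrite /sw; case: (eqVneq j (size s1)) => [->|n1]; first by rewrite eqxx ifN; lia.
    case: (eqVneq j (size s1).+1) => [->|n2]; first by rewrite eqxx.
    by rewrite !ifN.
  have swlt j : j < (size s1 + size s2).+2 -> sw j < (size s1 + size s2).+2.
    rewrite /sw; case: (eqVneq j (size s1)) => _; first lia.
    case: (eqVneq j (size s1).+1) => _; lia.
  have ssw j : strand ((Virt, size s1) :: w) (0, j) (1, sw j).
    rewrite /sw; case: eqP => [->|n1]; first exact: StrandVirt1.
    case: eqP => [->|n2]; first exact: StrandVirt2.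
    have [hj1|hj1] := ltnP j (size s1).
      by apply: (StrandLeft (k := Virt) (i := size s1)).
    have := @StrandRight ((Virt, size s1) :: w) 0 Virt (size s1) j erefl.
    by rewrite /= (_ : j - 2 + 2 = j); [apply|]; lia.
  have onsw a b j : onth (s1 ++ [:: a; b] ++ s2) j = onth (s1 ++ [:: b; a] ++ s2) (sw j).
    rewrite !onth_insert /sw; case: (eqVneq j (size s1)) => [->|n1].
      by rewrite ltnn !eqxx; do ?case: ifP => // *; lia.
    case: (eqVneq j (size s1).+1) => [->|n2].
      by rewrite ltnn eqxx; do ?case: ifP => // *; lia.
    by rewrite (negbTE n1) (negbTE n2).
  have up j1 : j1 < (size s1 + size s2).+2 -> exists2 j, j < (size s1 + size s2).+2 &
     strand ((Virt, size s1) :: w) (0, j) (1, j1).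
    by move=> hj; exists (sw j1); [exact: swlt | rewrite -{2}(swK j1)].
  split=> //=.
  + move=> p q; case=> [[|l] k i j /=|[|l] k i j /=|[|l] i /=|[|l] i /=|[|l] i /=|[|l] i /=] //.
    * case=> _ <- hj; rewrite l0 onsw /sw !ifN //; lia.
    * by move=> *; apply: l2; apply: (StrandLeft (k := k) (i := i)).
    * case=> <- <- /= hj; rewrite l0 onsw /sw !ifN; [congr onth|..]; lia.
    * by move=> *; apply: l2; apply: (StrandRight (k := k) (i := i)).
    * by move=> *; apply: l2; apply: StrandCup.
    * by move=> *; apply: l2; apply: StrandCap.
    * by case=> <-; rewrite l0 (onsw x y) /sw eqxx.
    * by move=> *; apply: l2; apply: StrandVirt1.
    * case=> <-; rewrite -[LHS]/(onth (s1 ++ [:: x, y & s2]) (size s1).+1).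
      by rewrite l0 (onsw x y) /sw ifN ?eqxx //; lia.
    * by move=> *; apply: l2; apply: StrandVirt2.
  + case=> [[|l] j] [] /=; rewrite /= ?sz ?take0 => h1 h2.
      by exists j => //; rewrite ?sz //; apply: rst_refl.
    have [|j1 hj1 a1] := l3 (l, j).
      split=> //=; rewrite !sz; move: h2; rewrite /width /= -!/(width _ _).
      by rewrite (_ : _ - 2 + 2 = (size s1 + size s2).+2) //; lia.
    rewrite sz in hj1; have [j2 hj2 a2] := up _ hj1.
    exists j2; rewrite ?sz //; apply: rst_trans (arc_behead _ a1) _.
    exact/rst_sym/rst_step.
  + move=> hc us' j j'; rewrite sz => hj hj' e.
    have hc' z : count_mem z (s1 ++ [:: y; x] ++ s2) <= 2.
      by apply: leq_trans (hc z); rewrite !count_cat /=; lia.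
    apply: rst_trans (rst_step _ _ _ _ (ssw j)) _.
    apply: rst_trans (rst_sym _ _ _ _ (rst_step _ _ _ _ (ssw j'))).
    have := l4 hc' us' (sw j) (sw j'); rewrite sz => H.
    by have := arc_behead (Virt, size s1) (H (swlt _ hj) (swlt _ hj') _); rewrite /= -!onsw; apply.
Qed.

Section Strip.
Variables (T : eqType) (s s' : seq T).

Lemma labelling_arc u lab p q :
  labelling u s s' lab -> arc u p q -> lab p = lab q.
Proof.
case=> _ _ h _ _; elim=> {p q} [p q|//|p q _ ->|p q r _ -> _ ->] //; exact: h.
Qed.

Lemma labelling_some u lab p : labelling u s s' lab -> point_of (size s) u p ->
  exists2 j, j < size s & lab p = onth s j /\ arc u p (0, j).
Proof.
move=> hl hp; case: (hl) => h0 _ _ h3 _; have [j hj a] := h3 _ hp.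
by exists j => //; rewrite -h0 (labelling_arc hl a).
Qed.

Hypotheses (hc : forall x, count_mem x s <= 2) (us : uniq s').

Lemma labelling_arcE u lab p q : labelling u s s' lab ->
  point_of (size s) u p -> point_of (size s) u q -> lab p = lab q -> arc u p q.
Proof.
move=> hl hp hq e; have [j hj [e1 a1]] := labelling_some hl hp.
have [k hk [e2 a2]] := labelling_some hl hq.
case: hl => _ _ _ _ h4; apply: rst_trans a1 _; apply: rst_trans (rst_sym _ _ _ _ a2).
by apply: h4 => //; rewrite -e1 -e2.
Qed.

(** A point is sent to the first top point carrying its label; the two strips share the top row. The
    bottom ends correspond because both labellings end with [s']. *)
Lemma labelling_bijection u u' lab lab' :
  labelling u s s' lab -> labelling u' s s' lab' ->
  width (size s) u = size s' -> width (size s) u' = size s' ->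
  class_bijection (point_of (size s) u) (arc u) (point_of (size s) u') (arc u')
    (fun p q => exists j,
       [/\ p = (0, j), q = (0, j) & j < size s] \/
       [/\ p = (size u, j), q = (size u', j) & j < width (size s) u]).
Proof.
move=> hl hl' hw hw'.
pose f (l : point -> option T) p : point := (0, find (fun y => Some y == l p) s).
have top v j : j < size s -> point_of (size s) v (0, j) by move=> h; split; rewrite /= ?take0.
have fP v v' l l' p : labelling v s s' l -> labelling v' s s' l' ->
    point_of (size s) v p -> point_of (size s) v' (f l p) /\ l' (f l p) = l p.
  move=> h h' hp; have [j hj [e _]] := labelling_some h hp.
  have hh : has (fun y => Some y == l p) s.
    rewrite e; have := hj; rewrite -onthTE; case e1: onth => [y|//] _.
    by apply/hasP; exists y => //; apply/onthP; exists j.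
  rewrite /f; split; first by apply: top; rewrite -has_find.
  case: h' => -> _ _ _ _; have := hj; case: (s) hh => // y0 s1 hh _.
  have := nth_find y0 hh; rewrite -odflt_onth.
  have := hh; rewrite has_find -onthTE; case: onth => //= y _ /eqP -> //.
exists (f lab), (f lab'); split.
- split=> p hp; first by have [] := fP u u' lab lab' p hl hl' hp.
  by have [] := fP u' u lab' lab p hl' hl hp.
- move=> p q hp hq a.
  have [h1 h2] := fP u u' lab lab' p hl hl' hp; have [h3 h4] := fP u u' lab lab' q hl hl' hq.
  by apply: (labelling_arcE hl') => //; rewrite h2 h4 (labelling_arc hl a).
- move=> p q hp hq a.
  have [h1 h2] := fP u' u lab' lab p hl' hl hp; have [h3 h4] := fP u' u lab' lab q hl' hl hq.
  by apply: (labelling_arcE hl) => //; rewrite h2 h4 (labelling_arc hl' a).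
- split=> p hp.
    have [h1 h2] := fP u u' lab lab' _ hl hl' hp; have [h3 h4] := fP u' u lab' lab _ hl' hl h1.
    by apply: (labelling_arcE hl) => //; rewrite h4.
  have [h1 h2] := fP u' u lab' lab _ hl' hl hp; have [h3 h4] := fP u u' lab lab' _ hl hl' h1.
  by apply: (labelling_arcE hl') => //; rewrite h4.
- move=> p q [j H].
  have [hp hq e] : [/\ point_of (size s) u p, point_of (size s) u' q & lab p = lab' q].
    case: H => -[-> -> hj].
      by split; try exact: top; case: hl => -> _ _ _ _; case: hl' => -> _ _ _ _.
    split; rewrite /point_of /= ?take_size ?hw' -?hw //.
    by case: hl => _ -> _ _ _; case: hl' => _ -> _ _ _.
  have [h1 h2] := fP u u' lab lab' _ hl hl' hp.
  by apply: (labelling_arcE hl') => //; rewrite h2.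
Qed.

(** A single [DetourStrip] suffices: the labels determine which ends are connected, and closed
    components cannot occur without maxima. *)
Lemma teq_strip u u' : reads u s [::] s' -> reads u' s [::] s' -> teq (size s) u u'.
Proof.
move=> h h'; have [c w] := reads_width h; have [c' w'] := reads_width h'.
have [lab hl] := labelling_exists h; have [lab' hl'] := labelling_exists h'.
(* With no strand at the top both strips are empty words, and no move is made; otherwise the
   nonemptiness condition of [tstep] holds. *)
have [s0|ms] := posnP (size s).
  by rewrite (reads_nil h s0) (reads_nil h' s0); apply: teq_refl.
apply: rst_step.
have := @TStep (size s) [::] u u' [::]; rewrite !cats0 /=; apply => //.
- by rewrite w w'.
- constructor 3; apply: DetourStrip => //.
  + exact: reads_virtual h.
  + exact: reads_virtual h'.
  + by rewrite w w'.
  + exact: labelling_bijection hl hl' w w'.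
- by rewrite ms.
Qed.

End Strip.

Ltac wsolve := rewrite /composable /width /=; lia.

Lemma teq_step m p u v s W : composable m (p ++ u ++ s) -> teq (width m p) u v ->
  teq m (p ++ v ++ s) W -> teq m (p ++ u ++ s) W.
Proof. by move=> h1 h2 h3; apply: teq_trans h3; apply: teq_ctx. Qed.

Lemma teq_local m x x' : composable m x -> composable m x' -> width m x = width m x' ->
  local_move m x x' -> (0 < m) || (~~ nilp x && ~~ nilp x') -> teq m x x'.
Proof.
move=> h1 h2 h3 h4 h5; apply: rst_step.
by have := @TStep m [::] x x' [::]; rewrite !cats0 /=; apply.
Qed.

Lemma teq_inter m k i k' i' : i + ain k <= i' -> i' + ain k' <= m ->
  teq m [:: (k', i'); (k, i)] [:: (k, i); (k', i' - ain k + aout k)].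
Proof.
move=> h1 h2; apply: teq_local => //; try wsolve.
by constructor 1; constructor.
Qed.

Lemma far_piece m1 m2 k i w : i + ain k <= m1 -> composable m2 w ->
  teq (m1 + m2) ((k, i) :: shiftw (m1 - ain k + aout k) w) (shiftw m1 w ++ [:: (k, i)]).
Proof.
elim: w m2 => [|[k' i'] w IH] m2 h1; first by move=> _; apply: teq_refl.
rewrite composable_cons /= => /andP[h2 h3].
set n1 := m1 - ain k + aout k.
have hc : composable (m1 + m2) ((k', m1 + i') :: (k, i) :: shiftw n1 w).
  rewrite !composable_cons /= (_ : m1 + i' + ain k' <= m1 + m2); last lia.
  rewrite (_ : i + ain k <= _) /=; last lia.
  rewrite (_ : _ + aout k = n1 + (m2 - ain k' + aout k')); last by rewrite /n1; lia.
  by have [] := composable_shiftw n1 h3.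
apply: (@teq_trans _ ((k', m1 + i') :: (k, i) :: shiftw n1 w)).
  apply: teq_sym; have := @teq_ctx (m1 + m2) [::] [:: (k', m1 + i'); (k, i)] [:: (k, i); (k', n1 + i')] (shiftw n1 w) hc.
  apply; rewrite (_ : n1 + i' = m1 + i' - ain k + aout k); last by rewrite /n1; lia.
  by apply: teq_inter; rewrite /width /=; lia.
have := @teq_catl (m1 + m2) [:: (k', m1 + i')]; apply => //.
have := IH _ h1 h3; rewrite (_ : _ + _ = width (m1 + m2) [:: (k', m1 + i')]) //.
rewrite /width /=; lia.
Qed.

(** By [Interchange], one piece of [u] at a time passes the whole of [v], whose positions are
    shifted by the number of strands of the left tangle at that height. *)
Lemma far_commute m1 m2 u v : composable m1 u -> composable m2 v ->
  teq (m1 + m2) (u ++ shiftw (width m1 u) v) (shiftw m1 v ++ u).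
Proof.
elim: u m1 => [|[k i] u IH] m1; first by rewrite cats0 => *; apply: teq_refl.
rewrite composable_cons => /andP[h1 h2] h3; rewrite width_cons [(k, i).1]/= [(k, i).2]/= in h1 h2 *.
set n1 := m1 - ain k + aout k in h2 *.
have hw : m1 + m2 - ain k + aout k = n1 + m2 by rewrite /n1; lia.
have hc : composable (m1 + m2) ((k, i) :: u ++ shiftw (width n1 u) v).
  rewrite composable_cons /= hw (_ : i + ain k <= m1 + m2) /=; last lia.
  rewrite composable_cat; have [-> ->] := composable_le m2 h2.
  by have [] := composable_shiftw (width n1 u) h3.
apply: (@teq_trans _ ((k, i) :: shiftw n1 v ++ u)).
  apply: (@teq_catl _ [:: (k, i)] (u ++ _)) => //; rewrite [width _ _]hw; exact: IH.
rewrite -cat1s -[_ :: u]cat1s !catA; apply: teq_catr.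
  rewrite composable_cons /= hw (_ : i + ain k <= m1 + m2) /=; last lia.
  rewrite composable_cat; have [-> ->] := composable_shiftw n1 h3.
  by have [] := composable_le (width m2 v) h2; rewrite addnC.
exact: far_piece.
Qed.

(** An executable form of [reads] for virtual words, so that concrete strips are checked by
    [reflexivity]. *)
Fixpoint vread (T : eqType) (w : word) (s : seq T) : option (seq T) :=
  if w is (k, i) :: w' then
    if drop i s is x :: y :: r then
      match k with
      | Virt => vread w' (take i s ++ [:: y; x] ++ r)
      | Cap => if x == y then vread w' (take i s ++ r) else None
      | _ => None
      end
    else None
  else Some s.

Lemma vreadP (T : eqType) w (s s' : seq T) : vread w s = Some s' -> reads w s [::] s'.
Proof.
elim: w s => [|[k i] w IH] s /=; first by case=> ->; constructor.
case e : (drop i s) => [|x [|y r]] //.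
have hs : s = take i s ++ [:: x, y & r] by rewrite -e cat_take_drop.
have hi : size (take i s) = i.
  rewrite size_take; case: ltnP => // h; move/(congr1 size): e; rewrite size_drop /=; lia.
case: k => // [|/IH h]; last first.
  by rewrite hs -{1}hi; constructor.
case: eqP => // exy /IH h; rewrite hs exy -{1}hi; by constructor.
Qed.

(** [teq_strip] concerns the full width. The strands on both sides of the strip receive labels
    [inl _], distinct from each other and from the inner labels [inr _]. *)
Lemma teq_vstrip (T : eqType) i m (l l' : seq T) u u' : i + size l <= m ->
  reads u l [::] l' -> reads u' l [::] l' ->
  (forall x, count_mem x l <= 2) -> uniq l' ->
  teq m (shiftw i u) (shiftw i u').
Proof.
move=> hm h h' hc hu.
pose s t : seq (nat + T) := map inl (iota 0 i) ++ map inr t ++ map inl (iota i (m - i - size l)).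
have R v : reads v l [::] l' -> reads (shiftw i v) (s l) [::] (s l').
  move=> /(reads_map (@inr nat T)) /(reads_ctx (map inl (iota 0 i))).
  by rewrite size_map size_iota => /(_ (map inl (iota i (m - i - size l)))).
have -> : m = size (s l) by rewrite !size_cat !size_map !size_iota; lia.
have ul : uniq (map (@inl nat T) (iota 0 i) ++ map inl (iota i (m - i - size l))).
  by rewrite -map_cat -iotaD map_inj_uniq ?iota_uniq // => ? ? [].
apply: (teq_strip _ _ (R _ h) (R _ h')) => [x|].
- case: x => x; rewrite /s count_cat count_cat !count_map.
    have -> : count (preim inr (pred1 (inl x))) l = 0.
      by rewrite -(count_pred0 l); apply: eq_count.
    have := count_uniq_mem (inl x) ul; rewrite count_cat !count_map.
    by set b := _ \in _; case: b => /=; lia.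
  have E n k : count (preim inl (pred1 (inr x))) (iota n k) = 0.
    by rewrite -(count_pred0 (iota n k)); apply: eq_count.
  by rewrite !E add0n addn0; apply: leq_trans (hc x); apply/eq_leq/eq_count.
- rewrite uniq_catCA cat_uniq map_inj_uniq ?hu; last by move=> ? ? [].
  rewrite ul andbT /=; apply/hasPn => x; rewrite mem_cat.
  by case/orP=> /mapP[y _ ->]; apply/mapP => -[].
Qed.

Lemma bring (T : Type) (l r : seq T) x :
  reads [seq (Virt, i) | i <- rev (iota 0 (size l))] (l ++ x :: r) [::] (x :: l ++ r).
Proof.
elim/last_ind: l r => [|l y IH] r /=; first by constructor.
rewrite size_rcons -addn1 iotaD rev_cat /= add0n !cat_rcons.
by apply: (@ReadVirt _ _ l r y x); apply: (IH (y :: r)).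
Qed.

(** The word is chosen before the labels and their type, so that one word can be read with several
    labellings. *)
Lemma block_swap (b c : nat) : exists v, forall (T : Type) (l r : seq T),
  size l = b -> size r = c -> reads v (l ++ r) [::] (r ++ l).
Proof.
elim: c => [|c [v hv]]; first by exists [::] => T l [] // _ _; rewrite cats0; constructor.
exists ([seq (Virt, i) | i <- rev (iota 0 b)] ++ shiftw 1 v) => T l [//|x r] hl [hr].
apply: (reads_cat (P1 := [::])); first by rewrite -hl; apply: bring.
by have := reads_ctx [:: x] [::] (hv T l r hl hr); rewrite !cats0.
Qed.

(** * Crossing blocks *)

Ltac step_at p u v s := apply: (@teq_step _ p u v s); [by wsolve | | cbn [cat]].

Ltac vstrip := apply: vreadP; reflexivity.

Lemma teq_virt2 m i : i.+1 < m -> teq m [:: (Virt, i); (Virt, i)] [::].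
Proof.
move=> h; have := @teq_vstrip nat i m [:: 0; 1] [:: 0; 1] [:: (Virt, 0); (Virt, 0)] [::].
rewrite /shiftw /= !addn0; apply=> //; [lia|vstrip|vstrip|move=> x; lia].
Qed.

Lemma teq_zigzagL m i : i < m -> teq m [:: (Cup, i.+1); (Cap, i)] [::].
Proof. by move=> h; apply: teq_local; [wsolve..|constructor 1; constructor|first [by rewrite orbT | lia]]. Qed.

Lemma teq_zigzagR m i : i < m -> teq m [:: (Cup, i); (Cap, i.+1)] [::].
Proof. by move=> h; apply: teq_local; [wsolve..|constructor 1; constructor|first [by rewrite orbT | lia]]. Qed.

Lemma teq_cross_cup m b i : i < m ->
  teq m [:: (Cup, i); (Cross b, i.+1)] [:: (Cup, i.+1); (Cross (~~ b), i)].
Proof. by move=> h; apply: teq_local; [wsolve..|constructor 1; constructor|first [by rewrite orbT | lia]]. Qed.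

Lemma teq_cross_cap m b i : i.+2 < m ->
  teq m [:: (Cross b, i.+1); (Cap, i)] [:: (Cross (~~ b), i); (Cap, i.+1)].
Proof. by move=> h; apply: teq_local; [wsolve..|constructor 1; constructor|first [by rewrite orbT | lia]]. Qed.

Lemma teq_virt_cup m i : i < m ->
  teq m [:: (Cup, i); (Virt, i.+1)] [:: (Cup, i.+1); (Virt, i)].
Proof. by move=> h; apply: teq_local; [wsolve..|constructor 1; constructor|first [by rewrite orbT | lia]]. Qed.

Lemma teq_R1_cup m b i : i <= m -> teq m [:: (Cup, i); (Cross b, i)] [:: (Cup, i)].
Proof. by move=> h; apply: teq_local; [wsolve..|constructor 2; constructor|first [by rewrite orbT | lia]]. Qed.

Lemma teq_R2 m b i : i.+1 < m -> teq m [:: (Cross b, i); (Cross (~~ b), i)] [::].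
Proof. by move=> h; apply: teq_local; [wsolve..|constructor 2; constructor|first [by rewrite orbT | lia]]. Qed.

Lemma teq_detour_cross m b i : i.+2 < m ->
  teq m [:: (Virt, i); (Virt, i.+1); (Cross b, i)] [:: (Cross b, i.+1); (Virt, i); (Virt, i.+1)].
Proof. by move=> h; apply: teq_local; [wsolve..|constructor 3; constructor|first [by rewrite orbT | lia]]. Qed.

(** The virtual first Reidemeister move. A maximum produces a node, so [teq_strip] does not apply
    and the bijection of arcs is given by hand: both rows below the maximum go to row 1, and row 1
    goes back to row 2, below the crossing. *)
Lemma teq_cup_virt m i : i <= m -> teq m [:: (Cup, i); (Virt, i)] [:: (Cup, i)].
Proof.
move=> h; apply: teq_local; [wsolve..| |by rewrite orbT].
constructor 3; apply: DetourStrip => //; [wsolve..|].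
set u := [:: (Cup, i); (Virt, i)]; set u' := [:: (Cup, i)].
have loop : arc u (1, i) (1, i.+1) by apply/rst_step/StrandCup.
(* The two strands below the maximum lie on one arc, so exchanging them stays within its class. *)
have low j : arc u (1, j) (2, j).
  have [->|n1] := eqVneq j i.
    by apply: rst_trans loop _; apply/rst_step/StrandVirt2.
  have [->|n2] := eqVneq j i.+1.
    by apply: rst_trans (rst_sym _ _ _ _ loop) _; apply/rst_step/StrandVirt1.
  have [hj|hj] := ltnP j i.
    by apply/rst_step; apply: (StrandLeft (k := Virt) (i := i)).
  have := @StrandRight u 1 Virt i j erefl.
  by rewrite /= (_ : j - 2 + 2 = j); [move=> H; apply/rst_step/H; lia | lia].
have arcf p q : arc u p q -> arc u' (minn p.1 1, p.2) (minn q.1 1, q.2).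
  elim=> {p q} [p q|p|p q _|p q r _ h1 _ h2].
  - case=> [[|[|l]] k i' j|[|[|l]] k i' j|[|[|l]] i'|[|[|l]] i'|[|[|l]] i'|[|[|l]] i'];
      rewrite /= ?onth0n //.
    + by case=> _ <- hj; apply/rst_step; apply: (StrandLeft (k := Cup) (i := i)).
    + by move=> *; apply: rst_refl.
    + by case=> <- <- hj; apply/rst_step; apply: (@StrandRight u' 0 Cup i j erefl).
    + by case=> <- <- /= hj; rewrite (_ : j - 2 + 2 = j); [apply: rst_refl | lia].
    + by case=> <-; apply/rst_step/StrandCup.
    + by case=> <-; apply/rst_step/StrandCup.
    + by case=> <-; apply/rst_sym/rst_step/StrandCup.
  - exact: rst_refl.
  - exact: rst_sym.
  - exact: rst_trans h1 h2.
have arcg p q : arc u' p q -> arc u (p.1.*2, p.2) (q.1.*2, q.2).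
  elim=> {p q} [p q|p|p q _|p q r _ h1 _ h2].
  - case=> [[|l] k i' j|[|l] k i' j|[|l] i'|[|l] i'|[|l] i'|[|l] i']; rewrite /= ?onth0n //.
    + case=> _ <- hj; apply: rst_trans (low _).
      by apply/rst_step; apply: (StrandLeft (k := Cup) (i := i)).
    + case=> <- <- hj; apply: rst_trans (low _).
      by apply/rst_step; apply: (@StrandRight u 0 Cup i j erefl).
    + by case=> <-; apply: rst_trans (low _); apply: rst_trans loop; apply/rst_sym/low.
  - exact: rst_refl.
  - exact: rst_sym.
  - exact: rst_trans h1 h2.
exists (fun p => (minn p.1 1, p.2)), (fun p => (p.1.*2, p.2)); split.
- split=> -[l j] [] /=.
    by case: l => [|[|[|l]]] //= _; rewrite /width /= => hj; split=> //=; rewrite /width /=; lia.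
  by case: l => [|[|l]] //= _; rewrite /width /= => hj; split=> //=; rewrite /width /=; lia.
- by move=> p q _ _; apply: arcf.
- by move=> p q _ _; apply: arcg.
- split=> -[l j] [] /=.
    case: l => [|[|[|l]]] //= _ _; try exact: rst_refl.
    exact/rst_sym/low.
  by case: l => [|[|l]] //= _ _; apply: rst_refl.
- by move=> p q [j [[-> -> _]|[-> -> _]]]; apply: rst_refl.
Qed.

(** From right to left: the first virtual crossing turns around the maximum and then cancels the
    second. *)
Lemma teq_cup_slide m i : i < m ->
  teq m [:: (Cup, i.+1)] [:: (Cup, i); (Virt, i.+1); (Virt, i)].
Proof.
move=> h; apply: teq_sym.
step_at (Nil piece) [:: (Cup, i); (Virt, i.+1)] [:: (Cup, i.+1); (Virt, i)] [:: (Virt, i)].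
  by apply: teq_virt_cup.
step_at [:: (Cup, i.+1)] [:: (Virt, i); (Virt, i)] (Nil piece) (Nil piece).
  by apply: teq_virt2; wsolve.
exact: teq_refl.
Qed.

(** The mirror image of [DetourCross], deduced from it: two cancelling pairs are inserted before the
    crossing, the detour is applied to the half next to it, and what remains cancels behind it. *)
Lemma teq_detour_cross_left m b i : i.+2 < m ->
  teq m [:: (Virt, i.+1); (Virt, i); (Cross b, i.+1)] [:: (Cross b, i); (Virt, i.+1); (Virt, i)].
Proof.
move=> h; apply: teq_sym.
apply: (@teq_trans _ [:: (Virt, i.+1); (Virt, i); (Virt, i); (Virt, i.+1); (Cross b, i); (Virt, i.+1); (Virt, i)]).
  apply: teq_sym.
  step_at [:: (Virt, i.+1)] [:: (Virt, i); (Virt, i)] (Nil piece) [:: (Virt, i.+1); (Cross b, i); (Virt, i.+1); (Virt, i)].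
    by apply: teq_virt2; wsolve.
  step_at (Nil piece) [:: (Virt, i.+1); (Virt, i.+1)] (Nil piece) [:: (Cross b, i); (Virt, i.+1); (Virt, i)].
    by apply: teq_virt2; wsolve.
  exact: teq_refl.
step_at [:: (Virt, i.+1); (Virt, i)] [:: (Virt, i); (Virt, i.+1); (Cross b, i)] [:: (Cross b, i.+1); (Virt, i); (Virt, i.+1)] [:: (Virt, i.+1); (Virt, i)].
  by apply: teq_detour_cross; wsolve.
step_at [:: (Virt, i.+1); (Virt, i); (Cross b, i.+1); (Virt, i)] [:: (Virt, i.+1); (Virt, i.+1)] (Nil piece) [:: (Virt, i)].
  by apply: teq_virt2; wsolve.
step_at [:: (Virt, i.+1); (Virt, i); (Cross b, i.+1)] [:: (Virt, i); (Virt, i)] (Nil piece) (Nil piece).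
  by apply: teq_virt2; wsolve.
exact: teq_refl.
Qed.

Lemma teq_interchange m k i k' i' j : i + ain k <= i' -> i' + ain k' <= m ->
  j = i' - ain k + aout k -> teq m [:: (k', i'); (k, i)] [:: (k, i); (k', j)].
Proof. by move=> h1 h2 ->; apply: teq_inter. Qed.

Ltac inter := apply: teq_interchange; wsolve.
Ltac interV := apply: teq_sym; apply: teq_interchange; wsolve.

(* A classical crossing whose four legs go down, in the order NW, SW, SE, NE. *)
Definition crossing_block b i : word := [:: (Cup, i); (Cup, i.+2); (Cross b, i.+1)].

(** The strand passed by the block ends up crossing its four legs virtually: the two maxima move by
    [teq_cup_slide], the crossing by the left detour. *)
Lemma teq_block_slide m b i : i < m ->
  teq m (crossing_block b i.+1)
        (crossing_block b i ++ [:: (Virt, i.+3); (Virt, i.+2); (Virt, i.+1); (Virt, i)]).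
Proof.
move=> h.
step_at (Nil piece) [:: (Cup, i.+1)] [:: (Cup, i); (Virt, i.+1); (Virt, i)] [:: (Cup, i.+3); (Cross b, i.+2)].
  by apply: teq_cup_slide.
step_at [:: (Cup, i); (Virt, i.+1)] [:: (Virt, i); (Cup, i.+3)] [:: (Cup, i.+3); (Virt, i)] [:: (Cross b, i.+2)].
  interV.
step_at [:: (Cup, i)] [:: (Virt, i.+1); (Cup, i.+3)] [:: (Cup, i.+3); (Virt, i.+1)] [:: (Virt, i); (Cross b, i.+2)].
  interV.
step_at [:: (Cup, i)] [:: (Cup, i.+3)] [:: (Cup, i.+2); (Virt, i.+3); (Virt, i.+2)] [:: (Virt, i.+1); (Virt, i); (Cross b, i.+2)].
  by apply: teq_cup_slide; wsolve.
step_at [:: (Cup, i); (Cup, i.+2); (Virt, i.+3); (Virt, i.+2); (Virt, i.+1)] [:: (Virt, i); (Cross b, i.+2)] [:: (Cross b, i.+2); (Virt, i)] (Nil piece).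
  interV.
step_at [:: (Cup, i); (Cup, i.+2); (Virt, i.+3)] [:: (Virt, i.+2); (Virt, i.+1); (Cross b, i.+2)]  [:: (Cross b, i.+1); (Virt, i.+2); (Virt, i.+1)] [:: (Virt, i)].
  by apply: teq_detour_cross_left; wsolve.
step_at [:: (Cup, i); (Cup, i.+2)] [:: (Virt, i.+3); (Cross b, i.+1)] [:: (Cross b, i.+1); (Virt, i.+3)] [:: (Virt, i.+2); (Virt, i.+1); (Virt, i)].
  inter.
exact: teq_refl.
Qed.

(** Moving the NW leg behind the others turns the crossing by a quarter turn, and this exchanges the
    two values of [Cross]. The virtual kink created at the left maximum is removed by
    [teq_cup_virt]. *)
Lemma teq_block_rot m b i : i <= m ->
  teq m (crossing_block b i ++ [:: (Virt, i); (Virt, i.+1); (Virt, i.+2)])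
        (crossing_block (~~ b) i).
Proof.
move=> h.
step_at [:: (Cup, i); (Cup, i.+2)] [:: (Cross b, i.+1); (Virt, i); (Virt, i.+1)] [:: (Virt, i); (Virt, i.+1); (Cross b, i)] [:: (Virt, i.+2)].
  by apply/teq_sym/teq_detour_cross; wsolve.
step_at [:: (Cup, i); (Cup, i.+2); (Virt, i); (Virt, i.+1)] [:: (Cross b, i); (Virt, i.+2)] [:: (Virt, i.+2); (Cross b, i)] (Nil piece).
  interV.
step_at [:: (Cup, i)] [:: (Cup, i.+2); (Virt, i)] [:: (Virt, i); (Cup, i.+2)] [:: (Virt, i.+1); (Virt, i.+2); (Cross b, i)].
  inter.
step_at (Nil piece) [:: (Cup, i); (Virt, i)] [:: (Cup, i)] [:: (Cup, i.+2); (Virt, i.+1); (Virt, i.+2); (Cross b, i)].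
  by apply: teq_cup_virt; wsolve.
step_at [:: (Cup, i)] [:: (Cup, i.+2); (Virt, i.+1)] [:: (Cup, i.+1); (Virt, i.+2)] [:: (Virt, i.+2); (Cross b, i)].
  by apply/teq_sym/teq_virt_cup; wsolve.
step_at [:: (Cup, i); (Cup, i.+1)] [:: (Virt, i.+2); (Virt, i.+2)] (Nil piece) [:: (Cross b, i)].
  by apply: teq_virt2; wsolve.
step_at [:: (Cup, i)] [:: (Cup, i.+1); (Cross b, i)] [:: (Cup, i); (Cross (~~ b), i.+1)] (Nil piece).
  by rewrite -{1}(negbK b); apply/teq_sym/teq_cross_cup; wsolve.
step_at (Nil piece) [:: (Cup, i); (Cup, i)] [:: (Cup, i); (Cup, i.+2)] [:: (Cross (~~ b), i.+1)].
  inter.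
exact: teq_refl.
Qed.

Lemma teq_cup_absorb m i : i <= m ->
  teq m [:: (Cup, i); (Cup, i.+2); (Cap, i.+1)] [:: (Cup, i)].
Proof.
move=> h; step_at [:: (Cup, i)] [:: (Cup, i.+2); (Cap, i.+1)] (Nil piece) (Nil piece).
  by apply: teq_zigzagL; wsolve.
exact: teq_refl.
Qed.

Lemma teq_block_absorb m b i : i <= m ->
  teq m ((Cup, i) :: crossing_block b i.+2 ++ [:: (Cap, i.+1)]) (crossing_block b i).
Proof.
move=> h.
step_at [:: (Cup, i); (Cup, i.+2); (Cup, i.+4)] [:: (Cross b, i.+3); (Cap, i.+1)] [:: (Cap, i.+1); (Cross b, i.+1)] (Nil piece).
  inter.
step_at [:: (Cup, i); (Cup, i.+2)] [:: (Cup, i.+4); (Cap, i.+1)] [:: (Cap, i.+1); (Cup, i.+2)] [:: (Cross b, i.+1)].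
  inter.
step_at (Nil piece) [:: (Cup, i); (Cup, i.+2); (Cap, i.+1)] [:: (Cup, i)] [:: (Cup, i.+2); (Cross b, i.+1)].
  by apply: teq_cup_absorb; wsolve.
exact: teq_refl.
Qed.

Lemma teq_block_R1 m b i : i <= m ->
  teq m (crossing_block b i ++ [:: (Cap, i)]) [:: (Cup, i)].
Proof.
move=> h.
step_at [:: (Cup, i); (Cup, i.+2)] [:: (Cross b, i.+1); (Cap, i)] [:: (Cross (~~ b), i); (Cap, i.+1)] (Nil piece).
  by apply: teq_cross_cap; wsolve.
step_at [:: (Cup, i)] [:: (Cup, i.+2); (Cross (~~ b), i)] [:: (Cross (~~ b), i); (Cup, i.+2)] [:: (Cap, i.+1)].
  inter.
step_at (Nil piece) [:: (Cup, i); (Cross (~~ b), i)] [:: (Cup, i)] [:: (Cup, i.+2); (Cap, i.+1)].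
  by apply: teq_R1_cup; wsolve.
exact: teq_cup_absorb.
Qed.

Lemma teq_block_R2 m b i : i <= m ->
  teq m (crossing_block b i ++ [:: (Cross (~~ b), i.+1)]) [:: (Cup, i); (Cup, i.+2)].
Proof.
move=> h.
step_at [:: (Cup, i); (Cup, i.+2)] [:: (Cross b, i.+1); (Cross (~~ b), i.+1)] (Nil piece) (Nil piece).
  by apply: teq_R2; wsolve.
exact: teq_refl.
Qed.

(** The block stands between the two incoming strands. Minima join these to its outer legs and
    straighten out by the two zigzags; the inner legs continue downwards. *)
Lemma teq_cross_block m b i : i.+1 < m ->
  teq m [:: (Cross b, i)] (crossing_block b i.+1 ++ [:: (Cap, i); (Cap, i.+2)]).
Proof.
move=> h; apply: teq_sym.
step_at [:: (Cup, i.+1); (Cup, i.+3)] [:: (Cross b, i.+2); (Cap, i)] [:: (Cap, i); (Cross b, i)] [:: (Cap, i.+2)].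
  inter.
step_at [:: (Cup, i.+1); (Cup, i.+3); (Cap, i)] [:: (Cross b, i); (Cap, i.+2)] [:: (Cap, i.+2); (Cross b, i)] (Nil piece).
  interV.
step_at [:: (Cup, i.+1)] [:: (Cup, i.+3); (Cap, i)] [:: (Cap, i); (Cup, i.+1)] [:: (Cap, i.+2); (Cross b, i)].
  inter.
step_at (Nil piece) [:: (Cup, i.+1); (Cap, i)] (Nil piece) [:: (Cup, i.+1); (Cap, i.+2); (Cross b, i)].
  by apply: teq_zigzagL; wsolve.
step_at (Nil piece) [:: (Cup, i.+1); (Cap, i.+2)] (Nil piece) [:: (Cross b, i)].
  by apply: teq_zigzagR; wsolve.
exact: teq_refl.
Qed.

Definition block T (n : pdnode T) i : word :=
  if n is inl (b, _, _, _, _) then crossing_block b i else [:: (Cup, i)].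

Fixpoint blocks T i (P : seq (pdnode T)) : word :=
  if P is n :: P' then block n i ++ blocks (i + size (legs1 n)) P' else [::].

Lemma block_wd T (n : pdnode T) i m : i <= m ->
  composable m (block n i) /\ width m (block n i) = m + size (legs1 n).
Proof. by case: n => [[[[[b x] y] z] t]|[x y]] h; rewrite /composable /width /=; lia. Qed.

Lemma blocks_wd T (P : seq (pdnode T)) i m : i <= m ->
  composable m (blocks i P) /\ width m (blocks i P) = m + size (legs P).
Proof.
elim: P i m => [|n P IH] i m h; first by rewrite addn0.
have [c w] := block_wd n h; rewrite /= composable_cat c width_cat w.
have [|-> ->] := IH (i + size (legs1 n)) (m + size (legs1 n)); first lia.
by rewrite /legs /= size_cat; lia.
Qed.

Lemma shiftw_block T (n : pdnode T) i k : shiftw k (block n i) = block n (k + i).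
Proof. by case: n => [[[[[b x] y] z] t]|[x y]] /=; rewrite ?addnS. Qed.

Lemma shiftw_blocks T (P : seq (pdnode T)) i k : shiftw k (blocks i P) = blocks (k + i) P.
Proof. by elim: P i => //= n P IH i; rewrite shiftw_cat shiftw_block IH addnA. Qed.

Lemma blocks_cat T (P Q : seq (pdnode T)) i :
  blocks i (P ++ Q) = blocks i P ++ blocks (i + size (legs P)) Q.
Proof.
elim: P i => [|n P IH] i /=; first by rewrite addn0.
by rewrite IH catA /legs /= size_cat addnA.
Qed.

Lemma blocks_past T (P : seq (pdnode T)) m v : composable m v ->
  teq m (v ++ blocks (width m v) P) (blocks m P ++ v).
Proof.
move=> h; have [c _] := blocks_wd P (leqnn 0).
by have := far_commute h c; rewrite !shiftw_blocks !addn0.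
Qed.

(** The word [v] merely permutes strands, so it is described by its readings in every label type; it
    is later read both with the labels of a code and with distinct numbers. *)
Lemma block_slide T (n : pdnode T) i k m : i + k <= m ->
  exists v, (forall T' (a l b c : seq T'), size a = i -> size l = size (legs1 n) ->
      size b = k -> reads v (a ++ l ++ b ++ c) [::] (a ++ b ++ l ++ c))
    /\ teq m (block n (i + k)) (block n i ++ v).
Proof.
elim: k => [|k IH] h.
  exists [::]; rewrite cats0 addn0; split; last exact: teq_refl.
  by move=> T' a l [|//] c _ _ _; constructor.
have [|v [hv ht]] := IH; first lia.
pose r := [seq (Virt, j) | j <- rev (iota 0 (size (legs1 n)))].
exists (v ++ shiftw (i + k) r); split.
  move=> T' a l b c ha hl; case/lastP: b => [//|b x]; rewrite size_rcons => -[hb].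
  rewrite !cat_rcons; apply: (reads_cat (P1 := [::])); first exact: hv.
  rewrite !(catA a); have -> : i + k = size (a ++ b) by rewrite size_cat ha hb.
  by have := reads_ctx (a ++ b) [::] (bring l c x); rewrite !cats0 /r hl.
have hs : teq m (block n (i + k).+1) (block n (i + k) ++ shiftw (i + k) r).
  rewrite /r; case: (n) => [[[[[b x] y] z] t]|[x y]] /=.
    by have := @teq_block_slide m b (i + k); rewrite /= !addn0 !addn1 !addn2 !addn3; apply; lia.
  by have := @teq_cup_slide m (i + k); rewrite /= !addn0 !addn1; apply; lia.
rewrite addnS catA; apply: (teq_trans hs); apply: (teq_catr _ ht).
have [e _] := teq_wd hs; rewrite -e.
by have [] := block_wd n h; rewrite addnS.
Qed.

(** The inverse of [block_slide]: its permutation is followed by a virtual swap, and since the two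
    together read distinct labels as the identity, [teq_strip] erases them. *)
Lemma block_slide_right T (n : pdnode T) i k m : i + k <= m ->
  exists v, (forall T' (a l b c : seq T'), size a = i -> size l = size (legs1 n) ->
      size b = k -> reads v (a ++ b ++ l ++ c) [::] (a ++ l ++ b ++ c))
    /\ teq m (block n i) (block n (i + k) ++ v).
Proof.
move=> h; have [v [hv ht]] := block_slide n h.
have [v' hv'] := block_swap k (size (legs1 n)).
have H T' (a l b c : seq T') : size a = i -> size l = size (legs1 n) ->
    size b = k -> reads (shiftw i v') (a ++ b ++ l ++ c) [::] (a ++ l ++ b ++ c).
  by move=> <- hl hb; have := reads_ctx a c (hv' T' b l hb hl); rewrite -!catA.
exists (shiftw i v'); split=> //; apply: teq_sym.
have hi : i <= m by lia.
have [c1 w1] := block_wd n hi.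
have [c2 w2] := block_wd n h.
have R : reads (v ++ shiftw i v') (iota 0 i ++ iota i (size (legs1 n)) ++ iota (i + size (legs1 n)) k ++
   iota (i + size (legs1 n) + k) (m - i - k)) [::] (iota 0 i ++ iota i (size (legs1 n)) ++
   iota (i + size (legs1 n)) k ++ iota (i + size (legs1 n) + k) (m - i - k)).
  by apply: (reads_cat (P1 := [::]) (hv _ _ _ _ _ _ _ _)); rewrite ?size_iota //; apply: H; rewrite size_iota.
move: R; rewrite !catA -!iotaD.
have -> : i + size (legs1 n) + k + (m - i - k) = m + size (legs1 n) by lia.
move=> R; have [cR _] := reads_width R; rewrite size_iota in cR.
apply: (@teq_trans _ ((block n i ++ v) ++ shiftw i v')).
  apply: teq_catr ht; rewrite composable_cat c2 w2 /=.
  have [] := reads_width (H nat (iota 0 i) (iota 0 (size (legs1 n))) (iota 0 k) (iota 0 (m - i - k)) _ _ _).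
  - by rewrite !size_iota. - by rewrite !size_iota. - by rewrite !size_iota.
  by rewrite !size_cat !size_iota (_ : _ + _ = m + size (legs1 n)) //; lia.
rewrite -catA -[X in teq _ _ X]cats0; apply: teq_catl; first by rewrite composable_cat c1 w1 cR.
rewrite w1; have := teq_strip _ _ R (ReadNil _); rewrite size_iota; apply; last exact: iota_uniq.
by move=> x; rewrite count_uniq_mem ?iota_uniq //; case: (x \in _).
Qed.

(** The inductive step towards the block form: blocks found below [v] lie to its right and are
    raised above it. *)
Lemma blocks_push T m v (P : seq (pdnode T)) w u : composable m v -> composable (width m v) w ->
  teq (width m v) w (blocks (width m v) P ++ u) -> teq m (v ++ w) (blocks m P ++ v ++ u).
Proof.
move=> hv hw ht; have [e _] := teq_wd ht; rewrite e in hw.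
apply: (@teq_trans _ (v ++ blocks (width m v) P ++ u)).
  by apply: teq_catl => //; rewrite composable_cat hv e.
rewrite !catA; apply: teq_catr (blocks_past P hv).
by rewrite -catA composable_cat hv.
Qed.

(* Zigzags turn each maximum and each crossing into a block, which detours bring
   to the top right corner of the tangle. *)
Lemma reads_blocks T w (s : seq T) P s' : reads w s P s' ->
  exists u, reads u (s ++ legs P) [::] s' /\ teq (size s) w (blocks (size s) P ++ u).
Proof.
elim=> {w s P s'} [s|w s1 s2 x y P s' h [u [hu ht]]|w s1 s2 x P s' h [u [hu ht]]|
    w s1 s2 x y P s' h [u [hu ht]]|w b s1 s2 x z t y P s' h [u [hu ht]]].
- by exists [::]; rewrite /legs /= !cats0; split; [constructor | apply: teq_refl].
- have [v [hv tv]] : exists v, (forall T' (a l b c : seq T'), size a = size s1 -> size l = 2 ->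
      size b = size s2 -> reads v (a ++ b ++ l ++ c) [::] (a ++ l ++ b ++ c))
    /\ teq (size (s1 ++ s2)) [:: (Cup, size s1)] ((Cup, size (s1 ++ s2)) :: v).
    by have := @block_slide_right T (CN x y) (size s1) (size s2) (size (s1 ++ s2)); rewrite size_cat; apply.
  exists (v ++ u); split.
    apply: (reads_cat (P1 := [::])) hu; rewrite /legs /= -!catA.
    exact: (hv _ s1 [:: x; y] s2).
  have [c w1] := reads_width h.
  have hsz : size (s1 ++ [:: x; y] ++ s2) = (size (s1 ++ s2)).+2 by rewrite !size_cat /=; lia.
  rewrite hsz in c w1 ht.
  have [cv wv] := reads_width (hv _ s1 [:: x; y] s2 [::] erefl erefl erefl).
  have e1 : size (s1 ++ s2 ++ [:: x; y] ++ [::]) = (size (s1 ++ s2)).+2 by rewrite !size_cat /=; lia.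
  have e2 : size (s1 ++ [:: x; y] ++ s2 ++ [::]) = (size (s1 ++ s2)).+2 by rewrite !size_cat /=; lia.
  rewrite e1 e2 in cv wv.
  have sm : size s1 <= size (s1 ++ s2) by rewrite size_cat; lia.
  set m := size (s1 ++ s2) in tv ht c w1 cv wv hsz sm *.
  have e3 : m - 0 + 2 = m.+2 by lia.
  apply: (@teq_trans _ (((Cup, m) :: v) ++ w)).
    rewrite -cat1s; apply: teq_catr tv.
    by rewrite composable_cons /= e3 c andbT; lia.
  apply: (@teq_catl _ [:: (Cup, m)] (v ++ w) (blocks (m + 2) P ++ v ++ u)).
    by rewrite composable_cons /= e3 composable_cat cv wv c andbT; lia.
  have -> : width m [:: (Cup, m)] = m.+2 by rewrite /width /=; lia.
  by rewrite addn2; apply: blocks_push; rewrite ?wv.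
- exists ((Cap, size s1) :: u); split; first by rewrite -!catA; constructor; rewrite catA.
  have hsz : size (s1 ++ [:: x; x] ++ s2) = (size (s1 ++ s2)).+2 by rewrite !size_cat /=; lia.
  have [c _] := reads_width h; rewrite hsz -cat1s -[_ :: u]cat1s.
  have e3 : width (size (s1 ++ s2)).+2 [:: (Cap, size s1)] = size (s1 ++ s2) by rewrite /width /=; lia.
  by apply: blocks_push; rewrite ?e3 //; rewrite composable_cons /= size_cat; lia.
- exists ((Virt, size s1) :: u); split.
    by move: hu; rewrite -!catA => hu; constructor.
  have hsz a b : size (s1 ++ [:: a; b] ++ s2) = (size (s1 ++ s2)).+2 by rewrite !size_cat /=; lia.
  have [c _] := reads_width h; rewrite !hsz -cat1s -[_ :: u]cat1s in c ht *.
  have e3 : width (size (s1 ++ s2)).+2 [:: (Virt, size s1)] = (size (s1 ++ s2)).+2 by rewrite /width /=; lia.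
  by apply: blocks_push; rewrite ?e3 //; rewrite composable_cons /= size_cat; lia.
- have hsz a d : size (s1 ++ [:: a; d] ++ s2) = (size (s1 ++ s2)).+2 by rewrite !size_cat /=; lia.
  (* The block replacing the crossing sits between its two incoming strands, hence one strand more
     on either side than in [s1] and [s2]. *)
  have [v [hv tv]] : exists v, (forall T' (a l d c : seq T'), size a = (size s1).+1 -> size l = 4 ->
      size d = (size s2).+1 -> reads v (a ++ d ++ l ++ c) [::] (a ++ l ++ d ++ c))
    /\ teq (size (s1 ++ s2)).+2 (crossing_block b (size s1).+1) (crossing_block b (size (s1 ++ s2)).+2 ++ v).
    have := @block_slide_right T (XN b x z t y) (size s1).+1 (size s2).+1 (size (s1 ++ s2)).+2.
    by rewrite size_cat /= addSn addnS; apply.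
  pose v' := v ++ [:: (Cap, size s1); (Cap, (size s1).+2)].
  have rv l : reads v' (s1 ++ [:: x, y & s2] ++ [:: x; z; t; y] ++ l) [::] (s1 ++ [:: z, t & s2] ++ l).
    apply: (reads_cat (P1 := [::])).
      by have := hv _ (rcons s1 x) [:: x; z; t; y] (y :: s2) l; rewrite size_rcons !cat_rcons; apply.
    apply: (@ReadCap _ _ s1 [:: z, t, y, y & s2 ++ l] x).
    have -> : (size s1).+2 = size (s1 ++ [:: z; t]) by rewrite size_cat addn2.
    have := @ReadCap T [::] (s1 ++ [:: z; t]) (s2 ++ l) y [::] _ (ReadNil _).
    by rewrite -!catA.
  exists (v' ++ u); split.
    apply: (reads_cat (P1 := [::])) hu; rewrite /legs /= -!catA; exact: rv.
  have [c _] := reads_width h; have [cv wv] := reads_width (rv [::]).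
  have e1 : size (s1 ++ [:: x, y & s2] ++ [:: x; z; t; y] ++ [::]) = (size (s1 ++ s2)).+2 + 4 by rewrite !size_cat /=; lia.
  have e2 : size (s1 ++ [:: z, t & s2] ++ [::]) = (size (s1 ++ s2)).+2 by rewrite !size_cat /=; lia.
  rewrite e1 e2 in cv wv; rewrite !hsz in c ht *.
  have sm : (size s1).+1 < (size (s1 ++ s2)).+2 by rewrite size_cat; lia.
  set m := (size (s1 ++ s2)).+2 in tv ht c cv wv sm *.
  have hb : teq m [:: (Cross b, size s1)] (crossing_block b m ++ v').
    apply: teq_trans (teq_cross_block b sm) _; rewrite catA; apply: teq_catr tv.
    by rewrite /crossing_block; wsolve.
  have [ch wh] := teq_wd hb.
  rewrite -cat1s; apply: (@teq_trans _ ((crossing_block b m ++ v') ++ w)).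
    apply: teq_catr hb; rewrite composable_cat.
    have -> : width m [:: (Cross b, size s1)] = m by rewrite /width /=; lia.
    by rewrite c composable_cons /=; lia.
  have [cb wb] := @block_wd T (XN b x z t y) m m (leqnn m).
  rewrite -catA /= -/(crossing_block b m) -[X in teq _ _ X]/(crossing_block b m ++ blocks (m + 4) P ++ v' ++ u).
  apply: (@teq_catl _ (crossing_block b m)).
    by rewrite composable_cat cb wb composable_cat cv wv c.
  by rewrite [width _ _]wb; apply: blocks_push; rewrite ?wv.
Qed.

(** * Reductions of planar diagram codes *)

Section PD.
Variable T : eqType.
Implicit Types (P Q R : seq (pdnode T)) (s : seq T).

(** A drawing of a code: its blocks hang side by side from the top, and any virtual strip without
    maxima joins the legs with equal labels. *)
Definition real P w : Prop := exists2 u, reads u (legs P) [::] [::] & w = blocks 0 P ++ u.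

(* Each arc has two ends. *)
Definition valid P : Prop := forall x, x \in legs P -> count_mem x (legs P) = 2.

Lemma validE P : valid P <-> forall x, count_mem x (legs P) = 0 \/ count_mem x (legs P) = 2.
Proof.
split=> h x; first by case: (boolP (x \in legs P)) => [/h|/count_memPn]; [right|left].
by case: (h x) => // /count_memPn /negP.
Qed.

Lemma reads_count u s s' x : reads u s [::] s' ->
  exists k, count_mem x s = count_mem x s' + k.*2.
Proof.
move E: [::] => P h.
elim: h E => {u s P s'} [s|//|w s1 s2 y P s' h IH|w s1 s2 y z P s' h IH|//] E.
- by exists 0; rewrite addn0.
- have [k hk] := IH E; exists (k + (y == x)).
  by move: hk; rewrite !count_cat /=; lia.
- have [k hk] := IH E; exists k.
  by move: hk; rewrite !count_cat /=; lia.
Qed.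

(** The first leg has a partner by parity; the partner is brought next to it by virtual crossings
    and both are capped off. *)
Lemma resolvable s : (forall x, ~~ odd (count_mem x s)) -> exists u, reads u s [::] [::].
Proof.
have [n] := ubnP (size s); elim: n s => // n IH [|x s] hs ho; first by exists [::]; constructor.
have hx : x \in s.
  by have := ho x; rewrite /= eqxx -has_pred1 has_count; case: (count_mem x s).
case/splitPr: hx hs ho => a b hs ho.
have [||u hu] := IH (a ++ b).
- by move: hs; rewrite /= !size_cat /=; lia.
- move=> y; have := ho y; rewrite /= !count_cat /=; lia.
exists (shiftw 1 [seq (Virt, i) | i <- rev (iota 0 (size a))] ++ (Cap, 0) :: u).
apply: (reads_cat (P1 := [::])).
  have h := reads_ctx [:: x] [::] (bring a b x); rewrite !cats0 in h; exact: h.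
exact: (@ReadCap _ _ [::] (a ++ b) x).
Qed.

Lemma real_ex P : valid P -> exists w, real P w.
Proof.
move=> /validE hP; have [x|u hu] := resolvable (s := legs P).
  by case: (hP x) => ->.
by exists (blocks 0 P ++ u), u.
Qed.

(** Each label has exactly two ends, so the two closing strips pair the same legs and [teq_strip]
    identifies them. *)
Lemma real_uniq P w w' : valid P -> real P w -> real P w' -> teq 0 w w'.
Proof.
move=> /validE hP [u hu ->] [u' hu' ->]; have [c wd] := blocks_wd P (leqnn 0).
apply: teq_catl; first by rewrite composable_cat c wd; have [] := reads_width hu.
rewrite wd; apply: teq_strip hu hu' => // x; by case: (hP x) => ->.
Qed.

Definition refines P Q : Prop :=
  valid P -> valid Q /\ forall w w', real P w -> real Q w' -> teq 0 w w'.

Lemma refines_refl P : refines P P.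
Proof. by move=> h; split=> // w w'; apply: real_uniq. Qed.

Lemma refines_trans Q P R : refines P Q -> refines Q R -> refines P R.
Proof.
move=> h1 h2 /h1 [/[dup] vQ /h2 [vR tR] tQ]; split=> // w w' hw hw'.
have [w1 hw1] := real_ex vQ; exact: teq_trans (tQ _ _ hw hw1) (tR _ _ hw1 hw').
Qed.

(** The change is made on the blocks of [Q] alone, directly above [v]; the closing strip is chosen
    to begin with [v], and the blocks of [R] are moved below or above it by far commutation. *)
Lemma refines_local Q Q' R v : reads v (legs Q) [::] (legs Q') ->
  teq 0 (blocks 0 Q ++ v) (blocks 0 Q') -> refines (Q ++ R) (Q' ++ R).
Proof.
move=> hv ht vQ; have vQ' : valid (Q' ++ R).
  apply/validE => x; have [k hk] := reads_count x hv.
  by move/validE: vQ => /(_ x); rewrite !legs_cat !count_cat hk; lia.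
split=> // w w' hw hw'.
have [u hu] : exists u, reads u (legs (Q' ++ R)) [::] [::].
  by apply: resolvable => x; move/validE: vQ' => /(_ x) [] ->.
have [cQ wQ] := blocks_wd Q (leqnn 0); have [cR wR] := blocks_wd R (leqnn (size (legs Q))).
have [cv wv] := reads_width hv; have [cu wu] := reads_width hu; rewrite legs_cat size_cat in cu.
have [cvR wvR] := composable_le (size (legs R)) cv.
have r1 : real (Q ++ R) (blocks 0 (Q ++ R) ++ v ++ u).
  exists (v ++ u) => //; apply: (reads_cat (P1 := [::])) hu.
  by rewrite !legs_cat; have := reads_ctx [::] (legs R) hv; rewrite shiftw0.
have r2 : real (Q' ++ R) (blocks 0 (Q' ++ R) ++ u) by exists u.
apply: teq_trans (real_uniq vQ hw r1) _; apply: teq_trans (real_uniq vQ' r2 hw').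
rewrite !blocks_cat !add0n -!catA.
have [cR' wR'] := blocks_wd R (leqnn (size (legs Q'))).
apply: (@teq_trans _ (blocks 0 Q ++ v ++ blocks (size (legs Q')) R ++ u)).
  apply: teq_sym; apply: teq_catl.
    by rewrite !composable_cat cQ wQ add0n cv wv cR' wR' cu.
  rewrite wQ add0n !catA; apply: teq_catr; last by rewrite -wv; apply: blocks_past.
  by rewrite -catA !composable_cat cv wv cR' wR' cu.
rewrite !catA -catA -[X in teq _ _ X]catA; apply: teq_catr ht.
by rewrite -!catA !composable_cat cQ wQ add0n cv wv cR' wR' cu.
Qed.

(** [RuleTurn] flips the boolean because [Cross] records the direction of the over strand on the
    page. In [RuleR1] the loop joins two neighbouring legs; in [RuleR2] the lower legs of the first
    crossing are the upper legs of the second. *)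
Inductive rule : seq (pdnode T) -> seq (pdnode T) -> Prop :=
| RuleTurn b x y z t : rule [:: XN b x y z t] [:: XN (~~ b) y z t x]
| RuleSwap x y : rule [:: CN x y] [:: CN y x]
| RuleJoinX b a x y z t : rule [:: CN a x; XN b x y z t] [:: XN b a y z t]
| RuleJoinC a x y : rule [:: CN a x; CN x y] [:: CN a y]
| RuleR1 b x y z : rule [:: XN b x x y z] [:: CN y z]
| RuleR2 b x y z t p q :
    rule [:: XN b x z t y; XN (~~ b) z p q t] [:: CN x p; CN q y].

Lemma rule_sound Q Q' : rule Q Q' -> exists v,
  reads v (legs Q) [::] (legs Q') /\ teq 0 (blocks 0 Q ++ v) (blocks 0 Q').
Proof.
case=> [b x y z t|x y|b a x y z t|a x y|b x y z|b x y z t p q].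
- exists [:: (Virt, 0); (Virt, 1); (Virt, 2)]; split; last exact: teq_block_rot.
  apply: (@ReadVirt _ _ [::] [:: z; t] x y); apply: (@ReadVirt _ _ [:: y] [:: t] x z).
  by apply: (@ReadVirt _ _ [:: y; z] [::] x t); constructor.
- exists [:: (Virt, 0)]; split; last exact: teq_cup_virt.
  by apply: (@ReadVirt _ _ [::] [::] x y); constructor.
- exists [:: (Cap, 1)]; split; last exact: teq_block_absorb.
  by apply: (@ReadCap _ _ [:: a] [:: y; z; t] x); constructor.
- exists [:: (Cap, 1)]; split; last exact: teq_cup_absorb.
  by apply: (@ReadCap _ _ [:: a] [:: y] x); constructor.
- exists [:: (Cap, 0)]; split; last exact: teq_block_R1.
  by apply: (@ReadCap _ _ [::] [:: y; z] x); constructor.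
(* The second crossing is drawn inline under the first block, where R2 applies literally;
   [reads_blocks] compares this drawing with the two blocks. *)
- have h : reads [:: (Cross (~~ b), 1)] [:: x; z; t; y] [:: XN (~~ b) z p q t] [:: x; p; q; y].
    by apply: (@ReadCross _ _ _ [:: x] [:: y] z p q t); constructor.
  have [u [hu tu]] := reads_blocks h; exists u; split=> //.
  have {}tu : teq (width 0 (crossing_block b 0)) [:: (Cross (~~ b), 1)] (crossing_block (~~ b) 4 ++ u).
    exact: tu.
  have := teq_block_R2 b (leqnn 0) => t2.
  apply: teq_trans t2; apply: teq_sym.
  by apply: (@teq_catl 0 (crossing_block b 0) [:: (Cross (~~ b), 1)] (crossing_block (~~ b) 4 ++ u)).
Qed.

(** The block of [n] slides left past all legs of [P1], leaving a permutation [v] that is absorbed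
    in the closing strip. *)
Lemma refines_front n P1 P2 : refines (P1 ++ n :: P2) (n :: P1 ++ P2).
Proof.
move=> vQ.
have pl : perm_eq (legs (P1 ++ n :: P2)) (legs (n :: P1 ++ P2)).
  rewrite /legs -cat1s -(cat1s n (P1 ++ P2)) !map_cat !flatten_cat perm_catCA //.
have vQ' : valid (n :: P1 ++ P2).
  by move=> x; rewrite -(perm_mem pl) -(seq.permP pl); apply: vQ.
split=> // w w' hw hw'; have [k hk] : exists k, size (legs P1) = k by exists (size (legs P1)).
have [v [hv tv]] := block_slide n (leqnn (0 + k)).
have [u hu] : exists u, reads u (legs (P1 ++ n :: P2)) [::] [::].
  by apply: resolvable => x; move/validE: vQ => /(_ x) [] ->.
have e1 : legs (P1 ++ n :: P2) = legs P1 ++ legs1 n ++ legs P2 by rewrite legs_cat.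
have e2 : legs (n :: P1 ++ P2) = legs1 n ++ legs P1 ++ legs P2.
  by rewrite -cat1s !legs_cat /legs /= cats0.
have rv : reads v (legs (n :: P1 ++ P2)) [::] (legs (P1 ++ n :: P2)).
  by rewrite e1 e2; apply: (hv _ [::]).
have r1 : real (P1 ++ n :: P2) (blocks 0 (P1 ++ n :: P2) ++ u) by exists u.
have r2 : real (n :: P1 ++ P2) (blocks 0 (n :: P1 ++ P2) ++ v ++ u).
  by exists (v ++ u) => //; apply: (reads_cat (P1 := [::])) hu.
apply: teq_trans (real_uniq vQ hw r1) _; apply: teq_trans (real_uniq vQ' r2 hw').
have [cv wv] := reads_width (hv _ [::] (legs1 n) (legs P1) [::] erefl erefl hk).
rewrite /= !cats0 !size_cat in cv wv.
have [cu wu] := reads_width hu; rewrite e1 !size_cat in cu.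
have [c1 w1] := blocks_wd P1 (leqnn 0); rewrite add0n in w1.
have [cn wn] := block_wd n (leqnn 0); rewrite add0n in wn.
have [c1' w1'] := blocks_wd P1 (leqnn (size (legs1 n))).
have [ck wk] := block_wd n (leqnn k).
have [c2 w2] := blocks_wd P2 (leqnn (k + size (legs1 n))).
have [c0 w0] := block_wd n (leq0n k).
rewrite ?hk in cv wv cu w1 w1'; rewrite addnA in cu.
rewrite (addnC (size (legs1 n)) k) in cv wv w1'.
rewrite blocks_cat /= blocks_cat !add0n hk -!catA.
apply: (@teq_trans _ (blocks 0 P1 ++ (block n 0 ++ v) ++ blocks (k + size (legs1 n)) P2 ++ u)).
  apply: teq_ctx; first by rewrite !composable_cat c1 w1 ck wk c2 w2 cu.
  by rewrite w1.
apply: (@teq_trans _ (block n 0 ++ blocks (size (legs1 n)) P1 ++ v ++ blocks (k + size (legs1 n)) P2 ++ u)).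
  rewrite -!catA !(catA _ (block n 0)) !(catA (block n 0)); apply: teq_catr.
    rewrite !composable_cat c1 w1 c0 !width_cat w1 w0 cv wv c2 w2.
    by rewrite cu.
  have := far_commute cn c1; by rewrite shiftw0 wn shiftw_blocks !addn0; apply: teq_sym.
apply: teq_catl; first by rewrite !composable_cat cn wn c1' w1' cv wv c2 w2; rewrite cu.
apply: teq_catl; first by rewrite wn !composable_cat c1' w1' cv wv c2 w2; rewrite cu.
rewrite wn w1' !catA; apply: teq_catr; first by rewrite -catA !composable_cat cv wv c2 w2; rewrite cu.
by have := blocks_past P2 cv; rewrite wv (addnC (size (legs1 n))).
Qed.

Lemma refines_perm P P' : perm_eq P P' -> refines P P'.
Proof.
move=> hp; suff [R hR hP] : exists2 R, perm_eq R [::] & refines P (P' ++ R).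
  by move: hP; rewrite (perm_nilP hR) cats0.
(* Generalized for induction on [P'], whose nodes are brought to the front from the last to the
   first; [A] stands for the nodes still behind. *)
have : exists A, perm_eq P (A ++ P') /\ A = [::] by exists [::].
case=> A [hA <-]; elim: P' A hA {hp} => [|n B IH] A hA.
  by exists P; [rewrite -(cats0 A) | apply: refines_refl].
have [|R hR h] := IH (rcons A n); first by rewrite cat_rcons.
have hn : n \in R by rewrite (perm_mem hR) mem_rcons mem_head.
case/splitPr: hn hR h => R1 R2 hR h; exists (R1 ++ R2).
  by move: hR; rewrite -[n :: R2]cat1s perm_catCA perm_sym perm_rcons perm_cons perm_sym.
apply: refines_trans h _; rewrite catA cat_cons catA; exact: refines_front.
Qed.

(* Every step preserves validity, so only the first code of a reduction has to be
   shown valid. *)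
Inductive red : seq (pdnode T) -> seq (pdnode T) -> Prop :=
| RedPerm P P' : perm_eq P P' -> red P P'
| RedRule Q Q' R : rule Q Q' -> red (Q ++ R) (Q' ++ R)
| RedTrans Q P R : red P Q -> red Q R -> red P R.

Lemma red_sound P P' : red P P' -> refines P P'.
Proof.
elim=> {P P'} [P P'|Q Q' R /rule_sound [v [h1 h2]]|Q P R _ h1 _ h2].
- exact: refines_perm.
- exact: refines_local h1 h2.
- exact: refines_trans h1 h2.
Qed.

Lemma red_refl P : red P P.
Proof. exact: RedPerm. Qed.

Lemma red_catr P P' R : red P P' -> red (P ++ R) (P' ++ R).
Proof.
elim=> {P P'} [P P' h|Q Q' S h|Q P S _ h1 _ h2].
- by apply: RedPerm; rewrite perm_cat2r.
- by rewrite -!catA; apply: RedRule.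
- exact: RedTrans h1 h2.
Qed.

Lemma red_catl P P' R : red P P' -> red (R ++ P) (R ++ P').
Proof.
move=> /(red_catr R) h; apply: (RedTrans (Q := P ++ R)); first by apply: RedPerm; rewrite perm_catC.
by apply: RedTrans h _; apply: RedPerm; rewrite perm_catC.
Qed.

Lemma red_cat P P' Q Q' : red P P' -> red Q Q' -> red (P ++ Q) (P' ++ Q').
Proof. by move=> h1 h2; apply: RedTrans (red_catr _ h1) (red_catl _ h2). Qed.

Lemma red_flatten (I : Type) (l : seq I) (F G : I -> seq (pdnode T)) :
  (forall i, red (F i) (G i)) -> red (flatten (map F l)) (flatten (map G l)).
Proof. by move=> h; elim: l => [|i l IH] /=; [apply: red_refl | apply: red_cat]. Qed.

End PD.

(** * Source-sink orientations *)

Section Travel.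
Variables (X : choiceType) (x0 : X) (nxt : X -> option X) (rev : X -> X).
Hypotheses (revK : involutive rev) (rev_neq : forall x, rev x <> x).
Hypothesis nxt_rev : forall x y, nxt x = Some y -> nxt (rev y) = Some (rev x).
Hypothesis nxt_neq : forall x, nxt x <> Some (rev x).

Definition travel : X -> X -> Prop := clos_refl_sym_trans X (fun x y => nxt x = Some y).

Lemma nxt_inj x y z : nxt x = Some z -> nxt y = Some z -> x = y.
Proof. by move=> /nxt_rev h /nxt_rev; rewrite h => -[] /(can_inj revK). Qed.

Lemma travel_rev x y : travel x y -> travel (rev x) (rev y).
Proof.
elim=> {x y} [x y h|x|x y _|x y z _ h1 _ h2].
- exact/rst_sym/rst_step/nxt_rev.
- exact: rst_refl.
- exact: rst_sym.
- exact: rst_trans h1 h2.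
Qed.

Definition nxtn n x := iter n (obind nxt) (Some x).

Lemma nxtnS n x : nxtn n.+1 x = obind (nxtn n) (nxt x).
Proof.
rewrite /nxtn iterSr /=; case: (nxt x) => [y|] //=.
by elim: n => //= n ->.
Qed.

Lemma nxtn_add n k x : nxtn (n + k) x = obind (nxtn k) (nxtn n x).
Proof.
elim: n x => [|n IH] x; first by rewrite add0n.
by rewrite addSn !nxtnS; case: (nxt x) => [y|] //=.
Qed.

Lemma nxtn_inj n x y z : nxtn n x = Some z -> nxtn n y = Some z -> x = y.
Proof.
elim: n z => [|n IH] z; first by case=> -> [->].
rewrite /nxtn !iterS -!/(nxtn n _).
case e1: (nxtn n x) => [x1|] //= h1; case e2: (nxtn n y) => [y1|] //= h2.
by apply: IH e1 _; rewrite e2 (nxt_inj h1 h2).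
Qed.

(** [nxt] is a partial injection, so a zigzag of forward and backward steps straightens out and one
    of the two states comes after the other. *)
Lemma travel_nxtn x y : travel x y -> exists n, nxtn n x = Some y \/ nxtn n y = Some x.
Proof.
elim=> {x y} [x y h|x|x y _ [n [h|h]]|x y z _ [n h1] _ [k h2]].
- by exists 1; left.
- by exists 0; left.
- by exists n; right.
- by exists n; left.
case: h1 h2 => h1 [] h2.
- by exists (n + k); left; rewrite nxtn_add h1.
- have [l|/ltnW l] := leqP n k.
    exists (k - n); right; move: h2; rewrite -{1}(subnK l) nxtn_add.
    by case e: (nxtn _ z) => [z1|] //= /(nxtn_inj h1) ->.
  exists (n - k); left; move: h1; rewrite -{1}(subnK l) nxtn_add.
  by case e: (nxtn _ x) => [z1|] //= /(nxtn_inj h2) ->.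
- have [l|/ltnW l] := leqP n k.
    by exists (k - n); left; move: h2; rewrite -{1}(subnKC l) nxtn_add h1.
  by exists (n - k); right; move: h1; rewrite -{1}(subnKC l) nxtn_add h2.
- by exists (k + n); right; rewrite nxtn_add h2.
Qed.

Lemma travel_terminal x y : nxt x = None -> nxt y = None -> travel x y -> x = y.
Proof.
move=> hx hy /travel_nxtn [[|n] []]; rewrite ?nxtnS ?hx ?hy //; first by case.
by case.
Qed.

(* A closed orbit of a strand reversing its own direction would have a middle point. *)
Lemma travel_norev x : ~ travel x (rev x).
Proof.
have H n y : nxtn n y <> Some (rev y).
  have [k] := ubnP n; elim: k n y => // k IH [|[|n]] y hn.
  - by case=> /esym /rev_neq.
  - exact: nxt_neq.
  - rewrite nxtnS; case e: (nxt y) => [z|//]; change (nxtn n.+1 z <> Some (rev y)).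
    rewrite -[n.+1]addn1 nxtn_add.
    case e1: (nxtn n z) => [t|//]; change (nxt t = Some (rev y) -> False) => /nxt_rev.
    rewrite revK e => -[ez]; apply: (IH n z); first lia.
    by rewrite e1 -(revK t) -ez.
move=> /travel_nxtn [n [/H //|h]].
by apply: (H n (rev x)); rewrite revK.
Qed.

Variable good : X -> Prop.
Hypothesis good_rev : forall x y, good x -> good y -> ~ travel x (rev y).

(** By [travel_norev] an orbit is disjoint from its reverse, so choosing one state of each pair
    orients everything. A [good] state is preferred as representative, and [good_rev] forces the
    other good states of the pair to agree with it. *)
Lemma orientation : exists O : X -> bool,
  [/\ forall x y, travel x y -> O x = O y, forall x, O (rev x) = ~~ O x
    & forall x, good x -> O x].
Proof.
pose around x : classical_sets.set X := fun z => travel z x \/ travel z (rev x).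
pose rep x := if `[< exists z, around x z /\ good z >] then classical_sets.xget x0 (fun z => around x z /\ good z)
  else classical_sets.xget x0 (around x).
have repP x : around x (rep x) /\ (forall z, around x z -> good z -> good (rep x)).
  rewrite /rep; case: asboolP => [[z hz]|h].
    by have [h1 h2] := @classical_sets.xgetI _ x0 (fun z => around x z /\ good z) z hz.
  split; last by move=> z h1 h2; case: h; exists z.
  by apply: (@classical_sets.xgetI _ x0 (around x) x); left; apply: rst_refl.
have rep_rev x : rep (rev x) = rep x.
  have e : around (rev x) = around x.
    by apply/funext => z; apply/propext; rewrite /around revK; split=> -[]; by [left|right].
  by rewrite /rep e.
have rep_travel x y : travel x y -> rep x = rep y.
  move=> h; have e : around x = around y.
    apply/funext => z; apply/propext; rewrite /around; have h' := travel_rev h.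
    split=> -[a|a]; [left|right|left|right]; apply: rst_trans a _ => //; exact: rst_sym.
  by rewrite /rep e.
exists (fun x => `[< travel (rep x) x >]); split.
- move=> x y h; rewrite (rep_travel _ _ h); apply/asbool_equiv_eq; split=> a; apply: rst_trans a _ => //.
  exact: rst_sym.
- move=> x; rewrite rep_rev -asbool_neg; apply/asbool_equiv_eq.
  have [[a|a] _] := repP x; split=> //.
  + move=> b; case: (@travel_norev x); apply: rst_trans b; exact: rst_sym.
  + move=> _ b; case: (@travel_norev x); apply: rst_trans a; exact: rst_sym.
- move=> x hx; apply/asboolP; have [[a|a] H] := repP x => //.
  have gr : good (rep x) by apply: (H x) => //; left; apply: rst_refl.
  by case: (good_rev gr hx).
Qed.

End Travel.

Lemma filter_traject (X : Type) (f : X -> X) (A : pred X) m x y r :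
  [seq z <- traject f (f x) m | A z] = y :: r ->
  exists2 n, y = iter n.+1 f x & forall k, k < n -> ~~ A (iter k.+1 f x).
Proof.
elim: m x => [|m IH] x //=; case: ifP => [_ [<- _]|hA /IH [n hn h]]; first by exists 0.
exists n.+1; first by rewrite iterSr.
by case=> [|k] hk; [rewrite /= hA | rewrite iterSr; apply: h].
Qed.

(** * Checkerboard colours around the darts of the surface diagram *)

Section SurfaceColouring.
Variable S : surface_diagram.
Notation nx := (diagram_next (node S) (onD S)).
Notation deg := (diagram_degree (node S) (onD S)).

Lemma diagram_nextE d : d \in onD S -> 1 < deg d ->
  exists2 n, nx d = iter n.+1 (node S) d &
    [/\ nx d != d, nx d \in onD S & forall k, k < n -> iter k.+1 (node S) d \notin onD S].
Proof.
move=> hd hdeg; rewrite /diagram_next /fingraph.orbit -orderSpred /= hd.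
set l := traject _ _ _.
have hl : fingraph.orbit (node S) d = d :: l by rewrite /fingraph.orbit -orderSpred.
have ul : d \notin l by have := orbit_uniq (node S) d; rewrite hl /= => /andP[].
case e : [seq x <- l | x \in onD S] => [|y r].
  move: hdeg; rewrite /diagram_degree (_ : _ :&: _ = [set d]) ?cards1 //.
  apply/setP => y; rewrite !inE; apply/andP/eqP => [[]|->]; last by rewrite porbit_id.
  case/porbitP => k; rewrite permX => hy hon.
  have : y \in fingraph.orbit (node S) d by rewrite -fconnect_orbit hy fconnect_iter.
  rewrite hl inE => /orP[/eqP //|hyl].
  by have : y \in [seq x <- l | x \in onD S] by [rewrite mem_filter hon]; rewrite e.
rewrite /= eqxx.
have hy : y \in [seq x <- l | x \in onD S] by rewrite e mem_head.
move: (hy); rewrite mem_filter => /andP[yon yl].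
have [n hn1 hn2] := filter_traject e.
by exists n => //; split=> //; apply: contraNneq ul => <-.
Qed.

Lemma deg_porbit d d' : d' \in porbit (node S) d -> deg d' = deg d.
Proof. by rewrite -eq_porbit_mem /diagram_degree => /eqP ->. Qed.

Lemma diagram_next_porbit d : d \in onD S -> 1 < deg d -> nx d \in porbit (node S) d.
Proof.
move=> h1 h2; have [n -> _] := diagram_nextE h1 h2.
by apply/porbitP; exists n.+1; rewrite permX.
Qed.

Lemma diagram_nextK d : d \in onD S -> deg d = 2 -> nx (nx d) = d.
Proof.
move=> h1 h2; have g1 : 1 < deg d by rewrite h2.
have [_ _ [n1 h3 _]] := diagram_nextE h1 g1; have p1 := diagram_next_porbit h1 g1.
have h4 : 1 < deg (nx d) by rewrite (deg_porbit p1).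
have [_ _ [n2 h5 _]] := diagram_nextE h3 h4; have p2 := diagram_next_porbit h3 h4.
apply/eqP; apply: contraT => n3.
have : #|[set d; nx d; nx (nx d)]| <= deg d.
  apply/subset_leq_card/subsetP => x; rewrite !inE => /orP[/orP[]|] /eqP ->; rewrite ?h1 ?h3 ?h5 ?andbT //.
  + exact: porbit_id.
  + by move: p2; rewrite -(eqP (_ : porbit (node S) (nx d) == porbit (node S) d)) ?eq_porbit_mem.
by rewrite h2 -setUA cardsU1 !inE negb_or (eq_sym d) n1 (eq_sym d) n3 cards2 (eq_sym (nx d)) n2.
Qed.

Variable c : dart S -> 'F_2.
Hypotheses (c2 : two_chain c) (cb : forall d, boundary c d = ((d \in onD S)%:R)%R).

Definition colour d := c d == 0%R.

Lemma F2_sum (x y : 'F_2) : ((x + y)%R = 1%R) -> (y == 0%R) = (x != 0%R).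
Proof. by case: x y => [[|[|[]]] ?] // [[|[|[]]] ?]. Qed.

Lemma F2_sum0 (x y : 'F_2) : ((x + y)%R = 0%R) -> (y == 0%R) = (x == 0%R).
Proof. by case: x y => [[|[|[]]] ?] // [[|[|[]]] ?]. Qed.

Lemma colour_edge d : colour (edge S d) = (colour d (+) (d \in onD S)).
Proof.
rewrite /colour; have := cb d; rewrite /boundary; case: (d \in onD S).
  by move/F2_sum ->; rewrite addbT.
by move/F2_sum0 ->; rewrite addbF.
Qed.

(** The chain condition gives [node S d] the face of [edge S d], across the dart [d]: turning around
    a vertex changes the colour exactly when a dart of the diagram is swept over. *)
Lemma colour_node d : colour (node S d) = (colour d (+) (d \in onD S)).
Proof. by rewrite -colour_edge /colour -(c2 (edge S d)) edgeK. Qed.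

Lemma colour_next d : d \in onD S -> 1 < deg d -> colour (nx d) = ~~ colour d.
Proof.
move=> h1 h2; have [n -> [_ _ h]] := diagram_nextE h1 h2.
elim: n h => [|n IH] h; first by rewrite /= colour_node h1 addbT.
rewrite iterS colour_node IH; last by move=> k /ltnW; apply: h.
by rewrite (negbTE (h n _)) ?addbF.
Qed.

(** A state [(d, true)] is about to run along the edge of [d]; [(d, false)] has just arrived at the
    origin of [d], and has no successor if this is a crossing. *)
Definition dart_next (x : dart S * bool) : option (dart S * bool) :=
  let: (d, b) := x in
  if b then (if d \in onD S then Some (edge S d, false) else None)
  else if (d \in onD S) && (deg d == 2) then Some (nx d, true) else None.

Definition dart_rev (x : dart S * bool) := (x.1, ~~ x.2).

Lemma dart_revK : involutive dart_rev.
Proof. by case=> d b; rewrite /dart_rev /= negbK. Qed.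

Lemma dart_next_rev x y : dart_next x = Some y -> dart_next (dart_rev y) = Some (dart_rev x).
Proof.
case: x => d [] /=; first by case: ifP => // h [<-] /=; rewrite onD_edge h edgeK.
case: ifP => // /andP[h1 /eqP h2] [<-] /=; have g1 : 1 < deg d by rewrite h2.
have [_ _ [_ h3 _]] := diagram_nextE h1 g1; have p1 := diagram_next_porbit h1 g1.
by rewrite h3 (deg_porbit p1) h2 diagram_nextK.
Qed.

Lemma surface_arc_travel x y : surface_arc x y ->
  exists b, forall b', travel dart_next (x, b') (y, b' (+) b).
Proof.
elim=> {x y} [x y h|x|x y _ [b h]|x y z _ [b1 h1] _ [b2 h2]].
- suff H : exists b', dart_next (x, b') = Some (y, ~~ b').
    exists true => b; have [b' hb] := H; rewrite addbT.
    case: (eqVneq b b') => [->|]; first exact: rst_step.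
    move=> n; have -> : b = ~~ b' by case: b b' n {hb} => [] [].
    have := travel_rev dart_next_rev (rst_step _ _ _ _ hb); exact.
  case: h => {x y} d h1; first by exists true; rewrite /= h1.
  by move=> h2; exists false; rewrite /= h1 h2.
- by exists false => b; rewrite addbF; apply: rst_refl.
- exists b => b'; have H := h (b' (+) b); rewrite -addbA addbb addbF in H; exact: (rst_sym _ _ _ _ H).
- by exists (b1 (+) b2) => b'; apply: rst_trans (h1 _) _; rewrite addbA; apply: h2.
Qed.

(** Every step of [dart_next] changes both the colour and the flag, so [colour x.1 (+) x.2] is
    constant along a strand. The opposite colours at the two ends of an arc are what will orient
    it. *)
Lemma surface_arc_colour d d' : crossing_dart d -> crossing_dart d' ->
  surface_arc d d' -> d = d' \/ colour d = ~~ colour d'.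
Proof.
move=> h1 h2 /surface_arc_travel [b /(_ false)]; rewrite addFb.
have hn x : crossing_dart x -> dart_next (x, false) = None.
  by rewrite /= /crossing_dart => /andP[-> /eqP ->].
(* With equal flags the two arrivals are terminal states of one orbit, hence the same dart. *)
case: b => h; last first.
  by have [] := travel_terminal dart_revK dart_next_rev (hn _ h1) (hn _ h2) h; left.
right; suff : forall x y, travel dart_next x y -> colour x.1 (+) x.2 = colour y.1 (+) y.2.
  by move/(_ _ _ h) => /=; rewrite addbT addbF.
move=> x y; elim=> {x y h} [[x b] [y b']|//|x y _ ->|x y z _ -> _ ->] //.
rewrite /=; case: b; first by case: ifP => // hx [<- <-]; rewrite colour_edge hx addbT addbF.
by case: ifP => // /andP[hx /eqP hd] [<- <-]; rewrite colour_next ?hd // addbT addbF negbK.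
Qed.

End SurfaceColouring.

(* The direction of a strand is [true] when it is traversed downwards. *)
Definition word_next (w : word) (x : point * bool) : option (point * bool) :=
  let: ((l, j), d) := x in
  if d then
    if onth w l is Some (k, i) then
      if j < i then Some ((l.+1, j), true)
      else if i + ain k <= j then Some ((l.+1, j - ain k + aout k), true)
      else match k with
        | Cap => Some ((l, if j == i then i.+1 else i), false)
        | Virt => Some ((l.+1, if j == i then i.+1 else i), true)
        | _ => None
        end
    else None
  else if l is l'.+1 then
    if onth w l' is Some (k, i) then
      if j < i then Some ((l', j), false)
      else if i + aout k <= j then Some ((l', j - aout k + ain k), false)
      else match k with
        | Cup => Some ((l, if j == i then i.+1 else i), true)
        | Virt => Some ((l', if j == i then i.+1 else i), false)
        | _ => None
        end
    else None
  else None.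

Definition point_rev (x : point * bool) := (x.1, ~~ x.2).

Lemma point_revK : involutive point_rev.
Proof. by case=> d b; rewrite /point_rev /= negbK. Qed.

Lemma point_rev_neq x : point_rev x <> x.
Proof. by case: x => p []. Qed.

Lemma word_next_neq w x : word_next w x <> Some (point_rev x).
Proof.
case: x => [[l j] []] /=.
  case: (onth w l) => // -[k i]; case: ifP => // h1; case: ifP => // h2.
  case: k h2 => //= h2 [] //; case: eqVneq => [->|n]; [|move=> e]; lia.
case: l => // l; case: (onth w l) => // -[k i]; case: ifP => // h1; case: ifP => // h2.
case: k h2 => //= h2 [] //; case: eqVneq => [->|n]; [|move=> e]; lia.
Qed.

Lemma word_next_rev w x y : word_next w x = Some y ->
  word_next w (point_rev y) = Some (point_rev x).
Proof.
case: x => [[l j] []] /=.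
  case e : (onth w l) => [[k i]|//]; case: ifP => [h1 [<-]|h1]; first by rewrite /= e h1.
  case: ifP => [h2 [<-]|h2].
    rewrite /= e ifN; last lia.
    rewrite ifT; last lia.
    by rewrite (_ : j - ain k + aout k - aout k + ain k = j) //; lia.
  case: k h2 e => //= h2 e [<-] /=; rewrite e.
    have [->|n] := eqVneq j i; first by rewrite ltnNge leqnSn /= ifN ?ifN //; lia.
    have -> : j = i.+1 by lia.
    by rewrite ltnn addn2 ifN ?eqxx //; lia.
  have [->|n] := eqVneq j i; first by rewrite ltnNge leqnSn /= ifN ?ifN //; lia.
  have -> : j = i.+1 by lia.
  by rewrite ltnn addn2 ifN ?eqxx //; lia.
case: l => // l.
case e : (onth w l) => [[k i]|//]; case: ifP => [h1 [<-]|h1]; first by rewrite /= e h1.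
case: ifP => [h2 [<-]|h2].
  rewrite /= e ifN; last lia.
  rewrite ifT; last lia.
  by rewrite (_ : j - aout k + ain k - ain k + aout k = j) //; lia.
case: k h2 e => //= h2 e [<-] /=; rewrite e.
  have [->|n] := eqVneq j i; first by rewrite ltnNge leqnSn /= ifN ?ifN //; lia.
  have -> : j = i.+1 by lia.
  by rewrite ltnn addn2 ifN ?eqxx //; lia.
have [->|n] := eqVneq j i; first by rewrite ltnNge leqnSn /= ifN ?ifN //; lia.
have -> : j = i.+1 by lia.
by rewrite ltnn addn2 ifN ?eqxx //; lia.
Qed.

Lemma word_next_arc w x y : word_next w x = Some y -> arc w x.1 y.1.
Proof.
case: x => [[l j] []] /=.
  case e : (onth w l) => [[k i]|//]; case: ifP => [h1 [<-]|h1].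
    by apply/rst_step; apply: StrandLeft e h1.
  case: ifP => [h2 [<-]|h2]; first by apply/rst_step; apply: StrandRight e h2.
  case: k h2 e => //= h2 e [<-] /=.
    have [->|n] := eqVneq j i; first exact/rst_step/StrandCap.
    have -> : j = i.+1 by lia.
    exact/rst_sym/rst_step/StrandCap.
  have [->|n] := eqVneq j i; first exact/rst_step/StrandVirt1.
  have -> : j = i.+1 by lia.
  exact/rst_step/StrandVirt2.
case: l => // l.
case e : (onth w l) => [[k i]|//]; case: ifP => [h1 [<-]|h1].
  by apply/rst_sym/rst_step; apply: StrandLeft e h1.
case: ifP => [h2 [<-]|h2].
  apply/rst_sym/rst_step; have := @StrandRight w l k i (j - aout k + ain k) e.
  by rewrite addnK subnK; [apply|]; lia.
case: k h2 e => //= h2 e [<-] /=.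
  have [->|n] := eqVneq j i; first exact/rst_step/StrandCup.
  have -> : j = i.+1 by lia.
  exact/rst_sym/rst_step/StrandCup.
have [->|n] := eqVneq j i; first exact/rst_sym/rst_step/StrandVirt2.
have -> : j = i.+1 by lia.
exact/rst_sym/rst_step/StrandVirt1.
Qed.

Lemma travel_arc w x y : travel (word_next w) x y -> arc w x.1 y.1.
Proof.
elim=> {x y} [x y|x|x y _ h|x y z _ h1 _ h2].
- exact: word_next_arc.
- exact: rst_refl.
- exact: rst_sym.
- exact: rst_trans h1 h2.
Qed.

Definition inward (q : corner) : bool := match q with NW | NE => true | _ => false end.

Lemma corner_terminal w l b i q : onth w l = Some (Cross b, i) ->
  word_next w (corner_point l i q, inward q) = None.
Proof.
by case: q => /= ->; rewrite ?ltnn ?addn2 !ifN //; lia.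
Qed.

Lemma corner_inj w l b i q l' b' i' q' :
  onth w l = Some (Cross b, i) -> onth w l' = Some (Cross b', i') ->
  corner_point l i q = corner_point l' i' q' -> inward q = inward q' -> l = l' /\ q = q'.
Proof.
move=> e e'; have H : l = l' -> i = i'.
  by move=> h; move: e; rewrite h e' => -[].
by case: q; case: q' => //= -[h1 h2] _; move: (h1) => // /H; split=> //; lia.
Qed.

(* The orientations of the strands at the top of a word oriented as a source-sink
   diagram: around each classical crossing the two directions alternate. *)
Inductive alternating : word -> seq bool -> Prop :=
| AltNil : alternating [::] [::]
| AltCup w d1 d2 b : alternating w (d1 ++ [:: b; ~~ b] ++ d2) -> alternating ((Cup, size d1) :: w) (d1 ++ d2)
| AltCap w d1 d2 b : alternating w (d1 ++ d2) -> alternating ((Cap, size d1) :: w) (d1 ++ [:: b; ~~ b] ++ d2)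
| AltVirt w d1 d2 b c : alternating w (d1 ++ [:: c; b] ++ d2) ->
    alternating ((Virt, size d1) :: w) (d1 ++ [:: b; c] ++ d2)
| AltCross w k d1 d2 b : alternating w (d1 ++ [:: b; ~~ b] ++ d2) ->
    alternating ((Cross k, size d1) :: w) (d1 ++ [:: b; ~~ b] ++ d2).

(** Here [o p] means that the strand at [p] is directed downwards. *)
Definition alternating_local (w : word) (o : point -> bool) : Prop :=
  forall l k i, onth w l = Some (k, i) ->
  [/\ forall j, j < i -> o (l.+1, j) = o (l, j),
      forall j, i + ain k <= j -> o (l.+1, j - ain k + aout k) = o (l, j)
    & match k with
      | Cup => o (l.+1, i.+1) = ~~ o (l.+1, i)
      | Cap => o (l, i.+1) = ~~ o (l, i)
      | Virt => o (l.+1, i.+1) = o (l, i) /\ o (l.+1, i) = o (l, i.+1)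
      | Cross _ => [/\ o (l, i.+1) = ~~ o (l, i), o (l.+1, i) = o (l, i)
                     & o (l.+1, i.+1) = ~~ o (l, i)]
      end].

Lemma mkseq_split (f : nat -> bool) m i k : i + k <= m ->
  mkseq f m = mkseq f i ++ mkseq (fun j => f (i + j)) k ++ mkseq (fun j => f (i + k + j)) (m - i - k).
Proof.
move=> h; rewrite /mkseq -{1}(subnKC h) iotaD iotaD !map_cat -catA !add0n.
rewrite subnDA; congr (_ ++ (_ ++ _)).
  by rewrite -{1}(addn0 i) iotaDl -map_comp.
by rewrite -{1}(addn0 (i + k)) iotaDl -map_comp.
Qed.

Lemma alternating_localP w m (o : point -> bool) : alternating_local w o ->
  composable m w -> width m w = 0 -> alternating w (mkseq (fun j => o (0, j)) m).
Proof.
elim: w m o => [|[k i] w IH] m o ho.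
  by move=> _; rewrite /width /= => ->; constructor.
rewrite composable_cons width_cons => /andP[h1 h2] h3.
have {}IH := IH _ (fun p => o (p.1.+1, p.2)) _ h2 h3.
have ho' : alternating_local w (fun p => o (p.1.+1, p.2)) by move=> l; apply: (ho l.+1).
have {ho'}{}IH := IH ho'; rewrite /= in h1 IH.
have [oL oR oK] := ho 0 k i erefl.
have eL : mkseq (fun j => o (0, j)) i = mkseq (fun j => o (1, j)) i.
  by apply/eq_in_map => j; rewrite mem_iota add0n => /oL ->.
have eR : mkseq (fun j => o (0, i + ain k + j)) (m - i - ain k) =
          mkseq (fun j => o (1, i + aout k + j)) (m - ain k + aout k - i - aout k).
  rewrite (_ : _ - i - aout k = m - i - ain k); last lia.
  apply/eq_in_map => j _; rewrite -oR; first by congr (o (_, _)); lia.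
  lia.
have hs : i = size (mkseq (fun j => o (0, j)) i) by rewrite size_mkseq.
rewrite (@mkseq_split (fun j => o (0, j)) m i (ain k)) // eR.
rewrite (@mkseq_split _ _ i (aout k)) -?eL in IH; last lia.
rewrite /= -/(mkseq _ i).
case: k {oL oR eR h1 h2 h3 ho} oK IH => [||b|] oK IH;
  rewrite /mkseq /= ?addn0 ?addn1 -?/(mkseq _ _) in IH *; rewrite {1}hs.
- by move: IH; rewrite oK; apply: AltCup.
- by rewrite oK; apply: AltCap.
- by case: oK => o1 o2 o3; move: IH; rewrite o1 o2 o3; apply: AltCross.
- by case: oK => o1 o2; move: IH; rewrite o1 o2; apply: AltVirt.
Qed.

Section WordColouring.
Variables (w : word) (c : nat -> corner -> bool).
Hypothesis c_ccw : forall l b i q, onth w l = Some (Cross b, i) -> c l (ccw q) = ~~ c l q.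
Hypothesis c_arc : forall l b i q l' b' i' q',
  onth w l = Some (Cross b, i) -> onth w l' = Some (Cross b', i') ->
  arc w (corner_point l i q) (corner_point l' i' q') ->
  l = l' /\ q = q' \/ c l q = ~~ c l' q'.

(** [inward q] is the direction that enters the crossing at the corner [q]. The colour decides
    whether the half-strand is to enter or to leave; these states are the ones that must be
    positively oriented. *)
Definition inflow (x : point * bool) : Prop := exists l b i q,
  onth w l = Some (Cross b, i) /\
  x = (corner_point l i q, if c l q then inward q else ~~ inward q).

(** At distinct ends of an arc the colours differ, so one end enters its crossing and the other
    leaves its own. A clash of directions would connect two terminal states, which then coincide,
    against the difference of colours. *)
Lemma inflow_rev x y : inflow x -> inflow y -> ~ travel (word_next w) x (point_rev y).
Proof.
move=> [l [b [i [q [e ->]]]]] [l' [b' [i' [q' [e' ->]]]]] h.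
have t := corner_terminal q e; have t' := corner_terminal q' e'.
have norev := @travel_norev _ _ _ point_revK point_rev_neq (@word_next_rev w) (@word_next_neq w).
have ha := travel_arc h; rewrite /= in ha.
have [[el eq]|ec] := c_arc e e' ha.
  subst l' q'; move: e'; rewrite e => -[_ ei]; subst i'.
  exact: norev h.
move: h; rewrite ec; case: (c l' q') => /=; rewrite /point_rev /= ?negbK => h.
- have h' := travel_rev (@word_next_rev w) h; rewrite /point_rev /= !negbK in h'.
  have [ep ei] := travel_terminal point_revK (@word_next_rev w) t t' h'.
  have [el eq] := corner_inj e e' ep ei; subst l' q'.
  by case: (c l q) ec.
- have [ep ei] := travel_terminal point_revK (@word_next_rev w) t t' h.
  have [el eq] := corner_inj e e' ep ei; subst l' q'.
  by case: (c l q) ec.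
Qed.

Lemma alternating_exists : exists o, alternating_local w o.
Proof.
have [O [hO hrev hin]] := orientation ((0, 0), true) point_revK point_rev_neq
  (@word_next_rev w) (@word_next_neq w) inflow_rev.
have step x y : word_next w x = Some y -> O x = O y by move=> h; apply/hO/rst_step.
have hcor l b i q : onth w l = Some (Cross b, i) -> O (corner_point l i q, inward q) = c l q.
  move=> e; have : O (corner_point l i q, if c l q then inward q else ~~ inward q).
    by apply: hin; exists l, b, i, q.
  by case: (c l q) => //; rewrite -[(_, ~~ _)]/(point_rev (_, inward q)) hrev => /negbTE.
exists (fun p => O (p, true)) => l k i e; split.
- by move=> j hj; apply/esym/step; rewrite /= e hj.
- by move=> j hj; apply/esym/step; rewrite /= e hj ifN //; lia.
have down p : O (p, false) = ~~ O (p, true) by rewrite -hrev.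
case: k e => [||b|] e.
- rewrite -down; apply/esym/step.
  by rewrite /= e ltnn addn2 ifN ?eqxx //; lia.
- suff -> : O ((l, i), true) = ~~ O ((l, i.+1), true) by rewrite negbK.
  by rewrite -down; apply/step; rewrite /= e ltnn addn2 ifN ?eqxx //; lia.
- have hc q := c_ccw q e.
  have := hcor _ _ _ NW e; have := hcor _ _ _ NE e; have := hcor _ _ _ SW e; have := hcor _ _ _ SE e.
  rewrite /= !down => e1 e2 -> ->; rewrite -[O ((l.+1, i), true)]negbK e2.
  rewrite -[O ((l.+1, i.+1), true)]negbK e1.
  by rewrite -[NW]/(ccw NE) -[NE]/(ccw SE) -[SE]/(ccw SW) -[SW]/(ccw NW) !hc !negbK.
- split; apply/esym/step.
  + by rewrite /= e ltnn addn2 ifN ?eqxx //; lia.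
  + rewrite /= e addn2 ifN ?ifN ?ifN //; lia.
Qed.

End WordColouring.

Lemma corner_pointP w l b i q m : composable m w -> onth w l = Some (Cross b, i) ->
  point_of m w (corner_point l i q).
Proof.
elim: w m l => [|[k j] w IH] m [|l] //; rewrite composable_cons => /andP[h1 h2].
  case=> ek ej; subst k j; rewrite /= in h1; case: q {IH}; split; rewrite //= /width /= ?take0 /=; lia.
move=> e; have [] := IH _ l h2 e.
by case: q {IH} => /=; split.
Qed.

(** [phi] transports the colours of the darts to the corners: [diagram_next] corresponds to [ccw],
    and plane arcs between corners come from surface arcs. *)
Lemma immersion_alternating S w : null_homologous S -> is_diagram w -> plane_immersion S w ->
  alternating w [::].
Proof.
move=> [c [c2 cb]] /and3P[_ hcw /eqP hw] [phi [p1 p2 p3 [f [g [hfg hf _ _ hbd]]]]].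
pose col l q := colour c (phi l q).
have [o ho] : exists o, alternating_local w o.
  apply: (@alternating_exists w col) => [l b i q e|l b i q l' b' i' q' e e' ha].
    have [/andP[h1 /eqP h2] h3 _] := p1 _ _ _ q e; rewrite /col h3.
    by apply: colour_next; rewrite ?h2.
  have [h1 _ _] := p1 _ _ _ q e; have [h2 _ _] := p1 _ _ _ q' e'.
  have hp := corner_pointP q hcw e; have hp' := corner_pointP q' hcw e'.
  have a1 : surface_arc (f (corner_point l i q)) (phi l q) by apply: hbd; exists l, b, i, q.
  have a2 : surface_arc (f (corner_point l' i' q')) (phi l' q') by apply: hbd; exists l', b', i', q'.
  have a3 : surface_arc (phi l q) (phi l' q').
    apply: rst_trans (rst_sym _ _ _ _ a1) _; apply: rst_trans a2; exact: hf.
  have [hh|] := surface_arc_colour c2 cb h1 h2 a3; last by right.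
  by left; apply: p2 hh; [exists b, i|exists b', i'].
exact: alternating_localP ho hcw hw.
Qed.

(** * Oriented codes and their extraction from an alternating word *)

Section Oriented.
Variable T : eqType.

(* The legs of an oriented node [X b i1 o1 i2 o2] or [C i o] alternate between
   incoming and outgoing. *)
Definition ins1 (n : pdnode T) : seq T :=
  match n with inl (_, x, _, z, _) => [:: x; z] | inr (x, _) => [:: x] end.

Definition outs1 (n : pdnode T) : seq T :=
  match n with inl (_, _, y, _, t) => [:: y; t] | inr (_, y) => [:: y] end.

Definition ins (P : seq (pdnode T)) := flatten (map ins1 P).
Definition outs (P : seq (pdnode T)) := flatten (map outs1 P).

Lemma ins_cons n P : ins (n :: P) = ins1 n ++ ins P. Proof. by []. Qed.

Lemma outs_cons n P : outs (n :: P) = outs1 n ++ outs P. Proof. by []. Qed.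

Lemma perm_legs P : perm_eq (legs P) (ins P ++ outs P).
Proof.
apply/seq.permP => p; elim: P => //= n P; rewrite /legs /ins /outs /= !count_cat => ->.
by case: n => [[[[[b x] y] z] t]|[x y]] /=; lia.
Qed.

Lemma oriented_valid P : uniq (outs P) -> perm_eq (ins P) (outs P) -> valid P.
Proof.
move=> u hp x; rewrite (perm_mem (perm_legs P)) mem_cat (perm_mem hp) orbb => hx.
by rewrite (seq.permP (perm_legs P)) count_cat (seq.permP hp) count_uniq_mem // hx.
Qed.

End Oriented.

Lemma fresh_pair (s : seq nat) : exists x y, [/\ x \notin s, y \notin s & x != y].
Proof.
have h n : \max_(i <- s) i < n -> n \notin s.
  move=> hn; apply: contraL hn => hs; rewrite -leqNgt; exact: leq_bigmax_seq.
exists (\max_(i <- s) i).+1, (\max_(i <- s) i).+2; split; try apply: h; lia.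
Qed.

Lemma count_mask2 (p : pred nat) d1 d2 s1 s2 a b x y : size d1 = size s1 ->
  count p (mask (d1 ++ [:: a, b & d2]) (s1 ++ [:: x, y & s2])) =
  count p (mask (d1 ++ d2) (s1 ++ s2)) + (a * p x + b * p y).
Proof.
move=> h; rewrite !mask_cat // !count_cat /=.
by case: a; case: b => /=; lia.
Qed.

Lemma split2 (s : seq nat) k (d2 : seq bool) : size s = k + (size d2).+2 ->
  exists s1 x y s2, [/\ s = s1 ++ [:: x, y & s2], size s1 = k & size s2 = size d2].
Proof.
move=> h; exists (take k s).
have e : size (drop k s) = (size d2).+2 by rewrite size_drop h; lia.
case e1 : (drop k s) e => [|x [|y s2]] //= [e2]; exists x, y, s2; split=> //.
  by rewrite -e1 cat_take_drop.
rewrite size_take h ifT //; lia.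
Qed.

(* A downward strand at the top leaves a node above it, and an upward one enters it. *)
Lemma alternating_reads w ds : alternating w ds -> exists (s : seq nat) (P P' : seq (pdnode nat)),
  [/\ size s = size ds, reads w s P [::], red P P' /\ perm_eq (legs P) (legs P'),
      perm_eq (mask ds s ++ outs P') (mask (map negb ds) s ++ ins P')
    & uniq (mask ds s ++ outs P')].
Proof.
elim=> {w ds} [|w d1 d2 b _|w d1 d2 b _|w d1 d2 b c _|w k d1 d2 b _].
- exists [::], [::], [::]; split=> //; [by constructor | by split=> //; exact: red_refl].
- move=> [s [P [P' [hs hr [hd hl] hp hu]]]]; rewrite size_cat /= in hs.
  have [s1 [x [y [s2 [es e1 e2]]]]] := split2 hs; subst s.
  (* The incoming end is written first; for [b] true the left strand leaves the maximum
     downwards. *)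
  pose n : pdnode nat := if b then CN y x else CN x y.
  have cl p : count p (legs [:: CN x y : pdnode nat]) = count p (legs [:: n]).
    by rewrite /n; case: b {n hp hu hs}; rewrite /legs /=; lia.
  exists (s1 ++ s2), (CN x y :: P), (n :: P'); split.
  + by rewrite !size_cat e1 e2.
  + by rewrite -e1; constructor.
  + split; last by rewrite -cat1s -(cat1s n) !legs_cat; apply: perm_cat => //; apply/seq.permP.
    apply: (red_cat (P := [:: CN x y]) (P' := [:: n])) => //.
    rewrite /n; case: (b); last exact: red_refl.
    by apply: (@RedRule _ [:: _] [:: _] [::]); constructor.
  + apply/seq.permP => p; move/seq.permP: hp => /(_ p).
    rewrite outs_cons ins_cons !map_cat !count_cat /= !count_mask2 ?size_map // /n.
    by case: b {n cl hu} => /=; lia.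
  + suff e : perm_eq (mask (d1 ++ d2) (s1 ++ s2) ++ outs (n :: P'))
      (mask (d1 ++ [:: b; ~~ b] ++ d2) (s1 ++ [:: x, y & s2]) ++ outs P') by rewrite (perm_uniq e).
    apply/seq.permP => p.
    rewrite outs_cons !count_cat /= count_mask2 // /n.
    by case: b {n cl hu hp} => /=; lia.
- move=> [s [P [P' [hs hr [hd hl] hp hu]]]].
  (* The two ends above a minimum belong to an arc not met below it, which needs a label of its
     own. *)
  have [x [_ [hx _ _]]] := fresh_pair (mask (d1 ++ d2) s ++ outs P').
  pose s1 := take (size d1) s; pose s2 := drop (size d1) s.
  have e1 : size s1 = size d1 by rewrite size_take hs size_cat; case: ltnP; lia.
  have es : s1 ++ s2 = s by rewrite cat_take_drop.
  rewrite -es in hr hp hu hx hs; clearbody s1 s2.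
  exists (s1 ++ [:: x; x] ++ s2), P, P'; split=> //.
  + by rewrite !size_cat /= in hs *; lia.
  + by rewrite -e1; constructor.
  + apply/seq.permP => p; move/seq.permP: hp => /(_ p).
    rewrite !map_cat /= !count_cat !count_mask2 ?size_map //.
    by case: b => /=; lia.
  + suff e : perm_eq (mask (d1 ++ [:: b; ~~ b] ++ d2) (s1 ++ [:: x; x] ++ s2) ++ outs P')
      (x :: mask (d1 ++ d2) (s1 ++ s2) ++ outs P') by rewrite (perm_uniq e) /= hx.
    apply/seq.permP => p; rewrite /= !count_cat count_mask2 //.
    by case: b {hp hu} => /=; lia.
- move=> [s [P [P' [hs hr [hd hl] hp hu]]]]; rewrite size_cat /= in hs.
  have [s1 [x [y [s2 [es e1 e2]]]]] := split2 hs; subst s.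
  exists (s1 ++ [:: y; x] ++ s2), P, P'; split=> //.
  + by rewrite !size_cat /= in hs *; lia.
  + by rewrite -e1; constructor.
  + apply/seq.permP => p; move/seq.permP: hp => /(_ p).
    by rewrite !map_cat /= !count_cat !count_mask2 ?size_map //; lia.
  + suff e : perm_eq (mask (d1 ++ [:: b; c] ++ d2) (s1 ++ [:: y; x] ++ s2) ++ outs P')
      (mask (d1 ++ [:: c; b] ++ d2) (s1 ++ [:: x, y & s2]) ++ outs P') by rewrite (perm_uniq e).
    by apply/seq.permP => p; rewrite !count_cat !count_mask2 //; lia.
- move=> [s [P [P' [hs hr [hd hl] hp hu]]]]; rewrite size_cat /= in hs.
  have [s1 [z [t [s2 [es e1 e2]]]]] := split2 hs; subst s.
  have [x [y [hx hy nxy]]] := fresh_pair (mask (d1 ++ [:: b; ~~ b] ++ d2) (s1 ++ [:: z, t & s2]) ++ outs P').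
  (* If the left strand comes down into the crossing, the NW leg is incoming; otherwise a quarter
     turn puts an incoming leg first. *)
  pose n : pdnode nat := if b then XN k x z t y else XN (~~ k) z t y x.
  have cl p : count p (legs [:: XN k x z t y : pdnode nat]) = count p (legs [:: n]).
    by rewrite /n; case: b {n hp hu hs hx hy}; rewrite /legs /=; lia.
  exists (s1 ++ [:: x; y] ++ s2), (XN k x z t y :: P), (n :: P'); split.
  + by rewrite !size_cat /= e1 e2.
  + by rewrite -e1; constructor.
  + split; last by rewrite -cat1s -(cat1s n) !legs_cat; apply: perm_cat => //; apply/seq.permP.
    apply: (red_cat (P := [:: XN k x z t y]) (P' := [:: n])) => //.
    rewrite /n; case: (b); first exact: red_refl.
    by apply: (@RedRule _ [:: _] [:: _] [::]); constructor.
  + apply/seq.permP => p; move/seq.permP: hp => /(_ p).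
    rewrite outs_cons ins_cons !map_cat !count_cat /= !count_mask2 ?size_map // /n.
    by case: b {n cl hu hx hy} => /=; lia.
  + suff e : perm_eq (mask (d1 ++ [:: b; ~~ b] ++ d2) (s1 ++ [:: x; y] ++ s2) ++ outs (n :: P'))
      [:: x, y & mask (d1 ++ [:: b; ~~ b] ++ d2) (s1 ++ [:: z, t & s2]) ++ outs P'].
      by rewrite (perm_uniq e) /= inE negb_or nxy hx hy.
    apply/seq.permP => p; rewrite outs_cons /= !count_cat /= !count_mask2 // /n.
    by case: b {n cl hu hp hx hy} => /=; lia.
Qed.

Lemma alternating_oriented w : alternating w [::] -> exists P P' : seq (pdnode nat),
  [/\ reads w [::] P [::], red P P', valid P, perm_eq (ins P') (outs P') & uniq (outs P')].
Proof.
move=> /alternating_reads [[|? ?] [P [P' [//]]]] _ hr [hd hl]; rewrite /= perm_sym => hp hu.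
exists P, P'; split=> // x; rewrite (perm_mem hl) (seq.permP hl).
exact: oriented_valid.
Qed.

(** * The codes of the diagrams [LV t] *)

Section BandTangle.
Variable T : eqType.

Definition strands (bl : seq (T * T)) : seq T := flatten [seq [:: p.1; p.2] | p <- bl].

Lemma strands_cat bl1 bl2 : strands (bl1 ++ bl2) = strands bl1 ++ strands bl2.
Proof. by rewrite /strands map_cat flatten_cat. Qed.

Lemma size_strands bl : size (strands bl) = (size bl).*2.
Proof. by elim: bl => //= p bl IH; rewrite /strands /= -/(strands bl) IH. Qed.

Lemma reads_band_swap k (l r : seq T) x x' y y' : size l = k.*2 ->
  reads (band_swap k) (l ++ [:: x; x'; y; y'] ++ r) [::] (l ++ [:: y; y'; x; x'] ++ r).
Proof.
move=> hl; have -> : band_swap k = shiftw (size l) [:: (Virt, 1); (Virt, 0); (Virt, 2); (Virt, 1)].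
  by rewrite hl /band_swap /shiftw /= addn0 addn1 addn2.
apply: reads_ctx; apply: (@ReadVirt _ _ [:: x] [:: y'] x' y).
apply: (@ReadVirt _ _ [::] [:: x'; y'] x y); apply: (@ReadVirt _ _ [:: y; x] [::] x' y').
by apply: (@ReadVirt _ _ [:: y] [:: x'] x y'); constructor.
Qed.

Lemma reads_band_insert k (l : seq T) p bl1 bl2 : size l = k.*2 ->
  reads (flatten [seq band_swap j | j <- iota k (size bl1)])
    (l ++ strands (p :: bl1 ++ bl2)) [::] (l ++ strands (bl1 ++ p :: bl2)).
Proof.
elim: bl1 k l => [|q bl1 IH] k l hl; first by constructor.
change (reads (band_swap k ++ flatten [seq band_swap j | j <- iota k.+1 (size bl1)])
  (l ++ [:: p.1; p.2; q.1; q.2] ++ strands (bl1 ++ bl2)) [::]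
  (l ++ [:: q.1; q.2] ++ strands (bl1 ++ p :: bl2))).
apply: (reads_cat (P1 := [::])); first exact: (reads_band_swap (strands (bl1 ++ bl2)) _ _ _ _ hl).
have := IH k.+1 (l ++ [:: q.1; q.2]); rewrite -!catA; apply.
by rewrite size_cat hl /= doubleS addn2.
Qed.

Lemma sorted_split (s : seq nat) x : sorted ltn s ->
  take (count (fun y => y < x) s) s = [seq y <- s | y < x] /\
  drop (count (fun y => y < x) s) s = [seq y <- s | x <= y].
Proof.
elim: s => //= y s IH hs; have /IH [h1 h2] : sorted ltn s by case: s hs {IH} => //= z s /andP[].
case: ltnP => hy; first by rewrite add1n /= h1 h2.
have hall : all (fun z => x <= z) s.
  by apply/allP => z hz; apply: leq_trans hy (ltnW _); move: hs; rewrite (path_sortedE ltn_trans) => /andP[/allP /(_ _ hz)].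
rewrite add0n; have -> : count (fun y0 => y0 < x) s = 0.
  by apply/eqP; rewrite -leqn0 leqNgt -has_count; apply/hasPn => z /(allP hall); rewrite leqNgt.
rewrite take0 drop0; split.
  by apply/esym/eqP; rewrite -size_eq0 size_filter -leqn0 leqNgt -has_count; apply/hasPn => z /(allP hall); rewrite leqNgt.
by rewrite (all_filterP hall).
Qed.

(** Once the tail is sorted, the head band crosses as many bands as have smaller keys, and by
    [sorted_split] these are the leftmost ones. *)
Lemma reads_band_tangle (key : T * T -> nat) k (l : seq T) bl : size l = k.*2 ->
  uniq (map key bl) -> exists bl',
  [/\ reads (band_tangle k (map key bl)) (l ++ strands bl) [::] (l ++ strands bl'),
      perm_eq bl' bl & sorted ltn (map key bl')].
Proof.
elim: bl k l => [|p bl IH] k l hl /=; first by move=> _; exists [::]; split=> //; constructor.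
case/andP=> hp hu; have [|bl1 [h1 h2 h3]] := IH k.+1 (l ++ [:: p.1; p.2]) _ hu.
  by rewrite size_cat hl /= doubleS addn2.
set c := count _ _.
have hc : c = count (fun y => y < key p) (map key bl1).
  by apply/esym/seq.permP/perm_map.
have hcs : c <= size bl1 by rewrite hc -(size_map key bl1) count_size.
exists (take c bl1 ++ p :: drop c bl1); split.
- apply: (reads_cat (P1 := [::])).
    by move: h1; rewrite -!catA; apply.
  have := @reads_band_insert k l p (take c bl1) (drop c bl1) hl.
  by rewrite cat_take_drop size_takel.
- by rewrite -cat1s perm_catCA cat_take_drop /= perm_cons.
- have [e1 e2] := sorted_split (key p) h3.
  rewrite map_cat /= map_take map_drop hc e1 e2.
  have hn : key p \notin map key bl1 by rewrite (perm_mem (perm_map key h2)).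
  rewrite (sorted_pairwise ltn_trans) pairwise_cat /=.
  rewrite -!(sorted_pairwise ltn_trans) !sorted_filter ?h3 ?andbT //; try exact: ltn_trans.
  rewrite allrel_consr /= -andbA; apply/and3P; split.
  + by apply/allP => y; rewrite mem_filter => /andP[].
  + apply/allrelP => x y; rewrite !mem_filter => /andP[hx _] /andP[hy _].
    exact: leq_trans hx hy.
  + apply/allP => y; rewrite mem_filter => /andP[hy hy1]; rewrite ltn_neqAle hy andbT.
    by apply: contraNneq hn => ->.
Qed.

(** Bands sorted by their position in [bl'] come out in the order of [bl'] itself. *)
Lemma reads_bands bl bl' (l := [seq index p bl' | p <- bl]) :
  uniq bl' -> perm_eq bl bl' ->
  reads (band_tangle 0 l) (strands bl) [::] (strands bl').
Proof.
move=> hu hp; have hub : uniq bl by rewrite (perm_uniq hp).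
have [||b [h1 h2 h3]] := @reads_band_tangle (fun p => index p bl') 0 [::] bl => //.
  rewrite map_inj_in_uniq // => x y hx hy e.
  by rewrite -[x](nth_index x (s := bl')) -?(perm_mem hp) // e nth_index // -(perm_mem hp).
suff e : b = bl' by move: h1; rewrite e.
have hp' : perm_eq b bl' := perm_trans h2 hp.
have hs : sorted ltn [seq index p bl' | p <- bl'].
  suff -> : [seq index p bl' | p <- bl'] = iota 0 (size bl') by apply: iota_ltn_sorted.
  case: bl' hu {h1 h3 l hp hp'} => // x0 s hu.
  apply: (@eq_from_nth _ 0); rewrite ?size_map ?size_iota // => i hi.
  by rewrite (nth_map x0) // nth_iota // index_uniq.
have e : [seq index p bl' | p <- b] = [seq index p bl' | p <- bl'].
  apply: (irr_sorted_eq ltn_trans ltnn h3 hs) => x.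
  exact: (perm_mem (perm_map _ hp')).
case: bl' hu {h1 h2 h3 hs l hp} hp' e => [|x0 s] hu hp' e; first by move/perm_nilP: hp'.
have := congr1 (map (nth x0 (x0 :: s))) e; rewrite -!map_comp !map_id_in //.
- by move=> x hx /=; rewrite nth_index.
- by move=> x; rewrite (perm_mem hp') => hx /=; rewrite nth_index.
Qed.

End BandTangle.

Lemma perm_of_seq m (l : seq nat) : perm_eq l (iota 0 m) ->
  exists s : {perm 'I_m}, [seq nat_of_ord (s i) | i <- enum 'I_m] = l.
Proof.
move=> hp; have hs : size l = m by rewrite (perm_size hp) size_iota.
have hu : uniq l by rewrite (perm_uniq hp) iota_uniq.
have hlt (i : 'I_m) : nth 0 l i < m.
  have : nth 0 l i \in l by rewrite mem_nth // hs.
  by rewrite (perm_mem hp) mem_iota.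
pose f (i : 'I_m) := Ordinal (hlt i).
have inj : injective f.
  move=> i j /(congr1 (fun x : 'I_m => nat_of_ord x)) /= /eqP.
  by rewrite nth_uniq ?hs // => /eqP /val_inj.
exists (perm inj).
rewrite (eq_map (g := fun i : 'I_m => nth 0 l i)); last by move=> i; rewrite permE.
rewrite (map_comp (nth 0 l) (@nat_of_ord m)) val_enum_ord -hs.
exact: mkseq_nth.
Qed.

(** * The two trees and the labels of their arcs *)

Fixpoint comb (n : nat) : tree := if n is n'.+1 then Node (comb n') Leaf else Leaf.

Fixpoint spine (l : seq bool) : tree :=
  if l is h :: l' then Node (spine l') (if h then Node Leaf Leaf else Leaf) else Leaf.

Lemma leaves_comb n : leaves (comb n) = n.+1.
Proof. by elim: n => //= n ->; rewrite addn1. Qed.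

Lemma flip_word_cat u v : flip_word (u ++ v) = flip_word v ++ flip_word u.
Proof. by rewrite /flip_word map_cat rev_cat. Qed.

Section Family.
Variable E : eqType.

(** The labels [inl] belong to the edges of the two left spines. A pair [(e, k)] is an arc at the
    caret [e]: its middle edge, its leaf edge, the arc between its maximum and its crossing in T_+,
    or the edge above a caret hanging from the spine of T_-. [None] is the edge above the root of
    T_+. *)
Definition label : eqType := option (nat + E * nat).
Definition chain_label (x : nat) : label := Some (inl x).
Definition band_label (k : nat) (e : E) : label := Some (inr (e, k)).
Notation ch := chain_label.
Notation gap := (band_label 0).
Notation leaf := (band_label 1).
Notation cup := (band_label 2).
Notation mid := (band_label 3).
Definition root : label := None.

Variables (inn out : E -> nat).

(* The carets of the left comb from the root down; [u] is the label of the edge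
   above the first one. *)
Fixpoint comb_nodes (u : label) (l : seq E) : seq (pdnode label) :=
  if l is e :: l' then
    CN (ch (inn e)) (cup e) :: XN true (cup e) (gap e) (leaf e) u ::
    comb_nodes (ch (inn e)) l'
  else [::].

Definition bands (l : seq E) : seq label := strands [seq (gap e, leaf e) | e <- l].

Lemma bands_cat l1 l2 : bands (l1 ++ l2) = bands l1 ++ bands l2.
Proof. by rewrite /bands map_cat strands_cat. Qed.

Lemma reads_comb u l (pre post : seq label) :
  reads (tree_tangle (comb (size l)) (size pre)) (pre ++ u :: post) (comb_nodes u l)
    (pre ++ last u [seq ch (inn e) | e <- l] :: bands (rev l) ++ post).
Proof.
elim: l u post => [|e l IH] u post /=; first by constructor.
rewrite cats0; apply: (ReadCup (s1 := pre) (s2 := u :: post)).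
have -> : (size pre).+1 = size (rcons pre (ch (inn e))) by rewrite size_rcons.
rewrite -[pre ++ _]cat_rcons.
apply: (@ReadCross _ _ true (rcons pre (ch (inn e))) post (cup e) (gap e) (leaf e) u).
rewrite cat_rcons; have := IH (ch (inn e)) [:: gap e, leaf e & post].
by rewrite rev_cons -cats1 bands_cat -catA.
Qed.

(* A vertex on the left spine of T_- is a connector [inr r], whose right child is
   a leaf with the band [r], or a hub [inl (a, k)], whose right child is a caret
   with the bands [a] and [k]. *)
Variable kind_of : E -> E * E + E.

Definition is_hub e : bool := if kind_of e is inl _ then true else false.
Definition bands_of e : seq E :=
  match kind_of e with inl (a, k) => [:: a; k] | inr r => [:: r] end.

Definition spine_bands (l : seq E) : seq E := flatten [seq bands_of e | e <- rev l].

Definition spine_top (z : label) (l : seq E) := if l is e :: _ then ch (inn e) else z.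

Definition spine_node (e : E) (z : label) : seq (pdnode label) :=
  match kind_of e with
  | inl (a, k) => [:: XN false (gap k) (leaf a) (mid a) (leaf k);
                      XN false (gap a) z (ch (inn e)) (mid a)]
  | inr r => [:: XN false (gap r) z (ch (inn e)) (leaf r)]
  end.

(** The nodes appear in the order of the reflected tangle: the right subtree of a vertex, then its
    left subtree, and the vertex itself last. *)
Fixpoint spine_nodes (z : label) (l : seq E) : seq (pdnode label) :=
  if l is e :: l' then
    match kind_of e with
    | inl (a, k) => XN false (gap k) (leaf a) (mid a) (leaf k) :: spine_nodes z l' ++
        [:: XN false (gap a) (spine_top z l') (ch (inn e)) (mid a)]
    | inr r => spine_nodes z l' ++ [:: XN false (gap r) (spine_top z l') (ch (inn e)) (leaf r)]
    end
  else [::].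

Lemma leaves_spine l : leaves (spine (map is_hub l)) = (size (spine_bands l)).+1.
Proof.
elim: l => //= e l ->; rewrite /spine_bands rev_cons map_rcons -cats1 flatten_cat size_cat /=.
by rewrite cats0 /is_hub /bands_of; case: (kind_of e) => [[a k]|r] /=; lia.
Qed.

Lemma reads_spine z l (pre post : seq label) :
  reads (flip_word (tree_tangle (spine (map is_hub l)) (size pre)))
    (pre ++ z :: bands (spine_bands l) ++ post) (spine_nodes z l)
    (pre ++ spine_top z l :: post).
Proof.
elim: l post => [|e l IH] post; first by constructor.
have -> : spine_bands (e :: l) = spine_bands l ++ bands_of e.
  by rewrite /spine_bands rev_cons map_rcons -cats1 flatten_cat /= cats0.
rewrite bands_cat -catA.
have -> : tree_tangle (spine (map is_hub (e :: l))) (size pre) =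
  [:: (Cup, size pre); (Cross true, (size pre).+1)] ++
  tree_tangle (spine (map is_hub l)) (size pre) ++
  tree_tangle (if is_hub e then Node Leaf Leaf else Leaf) (size pre + (leaves (spine (map is_hub l))).*2).
  by [].
rewrite !flip_word_cat -catA leaves_spine.
have close m t : reads (flip_word [:: (Cup, size pre); (Cross true, (size pre).+1)])
    (pre ++ [:: spine_top z l; m; t] ++ post) [:: XN false m (spine_top z l) (ch (inn e)) t]
    (pre ++ ch (inn e) :: post).
  rewrite /flip_word /= /rev /=.
  have -> : (size pre).+1 = size (rcons pre (spine_top z l)) by rewrite size_rcons.
  rewrite -cat_rcons.
  apply: (@ReadCross _ _ false (rcons pre (spine_top z l)) post m _ _ t).
  rewrite cat_rcons; apply: (@ReadCap _ _ pre (ch (inn e) :: post)); by constructor.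
rewrite /is_hub /bands_of; cbn [spine_nodes]; case: (kind_of e) => [[a k]|r]; cbv iota beta match.
- apply: (reads_cat (P1 := [:: _])); last first.
    apply: (reads_cat (s2 := pre ++ [:: spine_top z l; gap a; mid a] ++ post)); last exact: close.
    exact: (IH [:: gap a, mid a & post]).
  rewrite /flip_word /= /rev /=.
  set q := rcons (pre ++ z :: bands (spine_bands l)) (gap a).
  have -> : size pre + (size (spine_bands l)).*2.+2 = size q.
    by rewrite size_rcons size_cat /= size_strands size_map; lia.
  have -> : pre ++ z :: bands (spine_bands l) ++ [:: gap a, leaf a, gap k, leaf k & post] =
     rcons q (leaf a) ++ [:: gap k; leaf k] ++ post.
    by rewrite cat_rcons /q cat_rcons -catA.
  have -> : (size q).+1 = size (rcons q (leaf a)) by rewrite size_rcons.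
  (* The SW leg is given the label [leaf a], so that the minimum that follows can join it to the
     left leaf of the caret. *)
  apply: (@ReadCross _ _ false _ post (gap k) (leaf a) (mid a) (leaf k)).
  rewrite cat_rcons.
  have -> : pre ++ z :: bands (spine_bands l) ++ [:: gap a, mid a & post] = q ++ mid a :: post.
    by rewrite /q cat_rcons -catA.
  by apply: (@ReadCap _ _ q (mid a :: post)); constructor.
- rewrite (_ : flip_word (tree_tangle Leaf _) = [::]) // cat0s.
  apply: (reads_cat (s2 := pre ++ [:: spine_top z l; gap r; leaf r] ++ post)); last exact: close.
  exact: (IH [:: gap r, leaf r & post]).
Qed.

(** The leading node is the maximum above the root of T_+. Its left end is the strand that runs
    around both trees to the root of T_-, hence the label of the top of that spine. *)
Definition family_nodes (al be : seq E) : seq (pdnode label) :=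
  CN (spine_top root be) root :: comb_nodes root (rev al) ++
  spine_nodes (last root [seq ch (inn e) | e <- rev al]) be.

(** Bands are named after the carets of T_+, except the band at the leaves 0, bounded by the strand
    around the trees and the lowest left edge of the comb; [sigma] sends it to its counterpart. *)
Lemma reads_family (al be : seq E) (t : triple) : al != [::] -> be != [::] ->
  uniq al -> perm_eq al (spine_bands be) ->
  Tplus t = comb (size al) -> Tminus t = spine (map is_hub be) ->
  [seq nat_of_ord (sigma t i) | i <- enum 'I_(leaves (Tplus t))] =
    0 :: [seq (index e (spine_bands be)).+1 | e <- al] ->
  reads (LV t) [::] (family_nodes al be) [::].
Proof.
move=> na nb ual hp h1 h2 h3; rewrite /LV h3 h2 h1 /family_nodes.
set g := spine_top root be; set z := last _ _.
pose bl (l : seq E) : seq (label * label) := (g, z) :: [seq (gap e, leaf e) | e <- l].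
have inj : injective (fun e : E => (gap e, leaf e)) by move=> x y [].
have gz l : (g, z) \notin [seq (gap e, leaf e) | e <- l].
  apply/mapP => -[e _ []]; rewrite /g; by case: (be) nb.
rewrite -[CN g root :: _]cat1s [X in reads _ _ X _]catA.
apply: (reads_cat (s2 := strands (bl al))).
  rewrite /top_tangle -[_ :: tree_tangle _ _]cat1s.
  apply: (reads_cat (s2 := [:: g; root])).
    by apply: (@ReadCup _ _ [::] [::]); constructor.
  have := reads_comb root (rev al) [:: g] [::]; rewrite size_rev revK cats0 => H; exact: H.
rewrite -[spine_nodes z be]/([::] ++ spine_nodes z be).
apply: (reads_cat (s2 := strands (bl (spine_bands be)))).
  have -> : 0 :: [seq (index e (spine_bands be)).+1 | e <- al] =
      [seq index p (bl (spine_bands be)) | p <- bl al].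
    rewrite /= eqxx; congr cons; rewrite -map_comp; apply/eq_in_map => e he /=.
    rewrite ifN; first by rewrite index_map.
    by apply: contraNneq (gz [:: e]) => ->; rewrite mem_head.
  apply: reads_bands; rewrite /bl /=.
    by rewrite gz map_inj_uniq // -(perm_uniq hp).
  by rewrite perm_cons perm_map.
rewrite /top_tangle -cat1s flip_word_cat -[spine_nodes z be]cats0.
have := reads_spine z be [:: g] [::]; rewrite cats0 => H.
apply: (reads_cat H).
suff -> : spine_top z be = g by apply: (@ReadCap _ _ [::] [::]); constructor.
by rewrite /g; case: (be) nb.
Qed.

End Family.

(** * Derived reductions, and the reduced code of the family *)

Section Turns.
Variable T : eqType.
Implicit Types (b : bool) (a x y z t : T).

Lemma red_turn b x y z t : red [:: XN b x y z t] [:: XN (~~ b) y z t x].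
Proof. by apply: (@RedRule _ [:: _] [:: _] [::]); constructor. Qed.

Lemma red_turn2 b x y z t : red [:: XN b x y z t] [:: XN b z t x y].
Proof. by apply: RedTrans (red_turn _ _ _ _ _) _; have := red_turn (~~ b) y z t x; rewrite negbK. Qed.

Lemma red_swap x y : red [:: CN x y] [:: CN y x].
Proof. by apply: (@RedRule _ [:: _] [:: _] [::]); constructor. Qed.

Lemma red_join1 b a x y z t : red [:: CN a x; XN b x y z t] [:: XN b a y z t].
Proof. by apply: (@RedRule _ [:: _; _] [:: _] [::]); constructor. Qed.

Lemma red_join2 b a x y z t : red [:: CN a y; XN b x y z t] [:: XN b x a z t].
Proof.
apply: RedTrans (red_catl [:: CN a y] (red_turn _ _ _ _ _)) _.
apply: RedTrans (red_join1 _ _ _ _ _ _) _; apply: RedTrans (red_turn _ _ _ _ _) _.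
by rewrite negbK; apply: red_turn2.
Qed.

Lemma red_join3 b a x y z t : red [:: CN a z; XN b x y z t] [:: XN b x y a t].
Proof.
apply: RedTrans (red_catl [:: CN a z] (red_turn2 _ _ _ _ _)) _.
by apply: RedTrans (red_join1 _ _ _ _ _ _) _; apply: red_turn2.
Qed.

Lemma red_join4 b a x y z t : red [:: CN a t; XN b x y z t] [:: XN b x y z a].
Proof.
apply: RedTrans (red_catl [:: CN a t] (red_turn2 _ _ _ _ _)) _.
by apply: RedTrans (red_join2 _ _ _ _ _ _) _; apply: red_turn2.
Qed.

Lemma red_R2 b x y z t p q :
  red [:: XN b x z t y; XN (~~ b) z p q t] [:: CN x p; CN q y].
Proof. by apply: (@RedRule _ [:: _; _] [:: _; _] [::]); constructor. Qed.

Lemma red_perm P Q : perm_eq P Q -> @red T P Q.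
Proof. exact: RedPerm. Qed.

End Turns.

Section Family.
Variables (E : eqType) (inn out : E -> nat) (kind_of : E -> E * E + E).
Notation label := (label E).
Notation ch := (@chain_label E).
Notation gap := (@band_label E 0).
Notation leaf := (@band_label E 1).
Notation cup := (@band_label E 2).
Notation mid := (@band_label E 3).
Notation root := (@root E).
Notation bands_of := (bands_of kind_of).
Notation spine_bands := (spine_bands kind_of).

(** Describes one half of the circuit of left edges: T_+ is listed from its deepest caret up to the
    root, T_- from the root down. *)
Fixpoint chain (z : nat) (l : seq E) (y : nat) : Prop :=
  if l is e :: l' then inn e = z /\ chain (out e) l' y else z = y.

Lemma chain_cat z l1 l2 y : chain z (l1 ++ l2) y <-> exists2 x, chain z l1 x & chain x l2 y.
Proof.
elim: l1 z => [|e l1 IH] z /=; first by split=> [h|[x ->]]; first by exists z.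
split=> [[h /IH [x h1 h2]]|[x [h h1] h2]]; first by exists x.
by split=> //; apply/IH; exists x.
Qed.

Definition comb_node (e : E) : pdnode label :=
  XN true (ch (inn e)) (gap e) (leaf e) (ch (out e)).

Lemma red_comb z l y : chain z l y ->
  red (comb_nodes inn (ch y) (rev l)) (map comb_node l).
Proof.
elim/last_ind: l y => [|l e IH] y; first by move=> _; apply: red_refl.
rewrite -cats1 => /chain_cat [x h1 [h2 h3]]; rewrite cats1 rev_rcons map_rcons /= h2.
apply: RedTrans (red_catr _ (red_join1 true (ch x) (cup e) (gap e) (leaf e) (ch y))) _.
rewrite -cats1; apply: RedTrans (red_catl _ (IH _ h1)) _; apply: red_perm.
by rewrite perm_catC /comb_node h2 h3.
Qed.

Lemma red_spine y l z : chain y l z ->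
  red (spine_nodes inn kind_of (ch z) l)
      (flatten [seq spine_node inn kind_of e (ch (out e)) | e <- l]).
Proof.
elim: l y => [|e l IH] y; first by move=> _; apply: red_refl.
case=> _ h; have ht : spine_top inn (ch z) l = ch (out e).
  by case: (l) h => [|f l'] /= => [-> //|[-> _]].
have {}IH := IH _ h; rewrite [flatten _]/= /= /spine_node; case: (kind_of e) => [[a k]|r].
  rewrite -cat1s; apply: RedTrans (red_catl _ (red_catr _ IH)) _; rewrite ht /=.
  by apply: red_perm; rewrite perm_cons perm_catC.
by apply: RedTrans (red_catr _ IH) _; rewrite ht; apply: red_perm; rewrite perm_catC.
Qed.

(** The labels [x] and [y] are the two places where the circuit passes between the trees, at the
    leaves 0 and at the roots; the maximum above the root of T_+ is absorbed by a join. *)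
Lemma red_family x al y be : al != [::] -> be != [::] ->
  chain x al y -> chain y be x ->
  red (family_nodes inn kind_of al be)
      (map comb_node al ++ flatten [seq spine_node inn kind_of e (ch (out e)) | e <- be]).
Proof.
move=> na nb h1 h2; rewrite /family_nodes.
have -> : spine_top inn root be = ch y by case: (be) nb h2 => //= f l _ [->].
have -> : last root [seq ch (inn e) | e <- rev al] = ch x.
  by case: (al) na h1 => //= e l _ [<- _]; rewrite rev_cons map_rcons last_rcons.
rewrite -cat_cons; apply: red_cat (red_spine h2); apply: RedTrans (red_comb h1).
case/lastP: al na {h1} => // l e _; rewrite rev_rcons /=.
set R := comb_nodes _ _ _.
apply: (RedTrans (Q := [:: CN (ch (inn e)) (cup e)] ++ ([:: CN (ch y) root; XN true (cup e) (gap e) (leaf e) root] ++ R))).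
  by apply: red_perm; rewrite -cat1s -[CN _ _ :: XN _ _ _ _ _ :: R]cat1s perm_catCA.
exact: (red_catl [:: CN (ch (inn e)) (cup e)] (red_catr R (red_join4 true (ch y) (cup e) (gap e) (leaf e) root))).
Qed.

Definition hub_bands (l : seq E) : seq E :=
  flatten [seq if kind_of e is inl (a, _) then [:: a] else [::] | e <- l].

Lemma count_comb (p : pred label) u l :
  count p (legs (comb_nodes inn u l)) + p (last u [seq ch (inn e) | e <- l]) =
  p u + (count p [seq ch (inn e) | e <- l]).*2 + (count p (map cup l)).*2 +
  count p (map gap l) + count p (map leaf l).
Proof.
elim: l u => [|e l IH] u; first by rewrite /=; lia.
by have := IH (ch (inn e)); rewrite /legs /= -/(legs _); lia.
Qed.

Lemma spine_bands_cons e l : spine_bands (e :: l) = spine_bands l ++ bands_of e.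
Proof. by rewrite /spine_bands rev_cons map_rcons -cats1 flatten_cat /= cats0. Qed.

Lemma count_spine (p : pred label) z l :
  count p (legs (spine_nodes inn kind_of z l)) + p (spine_top inn z l) =
  p z + (count p [seq ch (inn e) | e <- l]).*2 + (count p (map mid (hub_bands l))).*2 +
  count p (map gap (spine_bands l)) + count p (map leaf (spine_bands l)).
Proof.
elim: l => [|e l IH]; first by rewrite /=; lia.
have lc n (P : seq (pdnode label)) : legs (n :: P) = legs1 n ++ legs P by [].
have lr (P : seq (pdnode label)) n : legs (P ++ [:: n]) = legs P ++ legs1 n.
  by rewrite legs_cat {2}/legs /= cats0.
have hh : hub_bands (e :: l) = (if kind_of e is inl (a, _) then [:: a] else [::]) ++ hub_bands l by [].
have ht : spine_top inn z (e :: l) = ch (inn e) by [].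
case hk : (kind_of e) => [[a k]|r].
  have -> : spine_nodes inn kind_of z (e :: l) = XN false (gap k) (leaf a) (mid a) (leaf k) ::
     (spine_nodes inn kind_of z l ++ [:: XN false (gap a) (spine_top inn z l) (ch (inn e)) (mid a)]).
    by rewrite /= hk.
  move: IH; rewrite lc lr ht hh spine_bands_cons /bands_of hk !map_cat !count_cat /=; lia.
have -> : spine_nodes inn kind_of z (e :: l) = spine_nodes inn kind_of z l ++
    [:: XN false (gap r) (spine_top inn z l) (ch (inn e)) (leaf r)].
  by rewrite /= hk.
move: IH; rewrite lr ht hh spine_bands_cons /bands_of hk !map_cat !count_cat /=; lia.
Qed.

Lemma family_valid al be : be != [::] -> uniq (map inn (al ++ be)) -> uniq al ->
  perm_eq al (spine_bands be) -> valid (family_nodes inn kind_of al be).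
Proof.
move=> nb ui ual hp.
(* A list of all labels, each once; adding the counts of the two trees gives two ends to each. *)
pose t : seq label := root :: [seq ch (inn e) | e <- al ++ be] ++ map gap al ++ map leaf al ++
  map cup al ++ map mid (hub_bands be).
have hc p : count p (legs (family_nodes inn kind_of al be)) = (count p t).*2.
  have h1 := count_comb p root (rev al).
  have h2 := count_spine p (last root [seq ch (inn e) | e <- rev al]) be.
  have e1 : spine_top inn (last root [seq ch (inn e) | e <- rev al]) be = spine_top inn root be.
    by case: (be) nb.
  have e2 (f : E -> label) : count p (map f (rev al)) = count p (map f al).
    by apply/seq.permP/perm_map; rewrite perm_rev.
  have e3 (f : E -> label) : count p (map f (spine_bands be)) = count p (map f al).
    by apply/esym/seq.permP/perm_map.
  rewrite e1 in h2; rewrite !e2 in h1; rewrite !e3 in h2.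
  move: h1 h2; rewrite /family_nodes -cat1s !legs_cat !count_cat /t /= !map_cat !count_cat /=; lia.
have ut : uniq t.
  have ub : uniq (hub_bands be).
    have hle x : count_mem x (hub_bands be) <= count_mem x (spine_bands be).
      elim: (be) => // e l IH; rewrite spine_bands_cons /hub_bands /= !count_cat /bands_of.
      by rewrite -/(hub_bands l); case: (kind_of e) => [[a k]|r] /=; lia.
    apply: count_mem_uniq => x; have := hle x.
    have us : uniq (spine_bands be) by rewrite -(perm_uniq hp).
    rewrite (count_uniq_mem x us).
    case: (boolP (x \in hub_bands be)) => [hx|/count_memPn ->] //=.
    by have : 0 < count_mem x (hub_bands be) by [rewrite -has_count has_pred1]; case: (x \in _); lia.
  have mu k l : uniq l -> uniq (map (@band_label E k) l).
    by move=> ul; rewrite map_inj_uniq // => ? ? [].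
  (* The parts of [t] consist of labels of different sorts, told apart by an increasing rank. *)
  pose rank (x : label) := match x with None => 0 | Some (inl _) => 1 | Some (inr (_, k)) => k.+2 end.
  have cat_rank r s1 s2 : uniq s1 -> uniq s2 -> all (fun x => rank x == r) s1 ->
      all (fun x => r < rank x) s2 -> uniq (s1 ++ s2).
    move=> u1 u2 /allP a1 /allP a2; rewrite cat_uniq u1 u2 andbT /=.
    by apply/hasPn => x /a2 hx; apply/negP => /a1 /eqP e; rewrite e ltnn in hx.
  have um : uniq [seq ch (inn e) | e <- al ++ be].
    by rewrite (map_comp ch inn) map_inj_uniq // => ? ? [].
  rewrite /t -cat1s; apply: (cat_rank 0) => //; last first.
    by rewrite !all_cat; do ?(apply/andP; split); apply/allP => _ /mapP[? _ ->].
  apply: (cat_rank 1) => //; [|by apply/allP => _ /mapP[? _ ->]|]; last first.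
    by rewrite !all_cat; do ?(apply/andP; split); apply/allP => _ /mapP[? _ ->].
  apply: (cat_rank 2); rewrite ?mu //; [|by apply/allP => _ /mapP[? _ ->]|]; last first.
    by rewrite !all_cat; do ?(apply/andP; split); apply/allP => _ /mapP[? _ ->].
  apply: (cat_rank 3); rewrite ?mu //; [|by apply/allP => _ /mapP[? _ ->]|]; last first.
    by rewrite !all_cat; do ?(apply/andP; split); apply/allP => _ /mapP[? _ ->].
  by apply: (cat_rank 4); rewrite ?mu //; apply/allP => _ /mapP[? _ ->].
by apply/validE => x; rewrite hc (count_uniq_mem x ut); case: (x \in t); [right|left].
Qed.

End Family.

(** * A universal family of triples *)

Section Configurations.
Variable N : nat.

(* The [j]-th hub gives two carets [pa j] and [pk j] of T_+ and one caret [pb j] on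
   the spine of T_-.  A connector is a caret [recA i] of T_+ sharing a band with
   the caret [recB i] of T_-. *)
Definition port : finType := ('I_N * bool + 'I_N)%type.
Definition pa (j : 'I_N) : port := inl (j, true).
Definition pk (j : 'I_N) : port := inl (j, false).
Definition pb (j : 'I_N) : port := inr j.

Definition sym : eqType := (port + bool * nat)%type.
Definition item (p : port) : sym := inl p.
Definition recA (i : nat) : sym := inr (true, i).
Definition recB (i : nat) : sym := inr (false, i).

(** The last case is a default value: the vertices on the spine of T_- are the hubs [pb j] and the
    connectors [recB i]. *)
Definition kind_of (e : sym) : sym * sym + sym :=
  match e with
  | inl (inr j) => inl (item (pa j), item (pk j))
  | inr (false, i) => inr (recA i)
  | _ => inr e
  end.

Notation label := (label sym).
Notation ch := (@chain_label sym).
Notation gap := (@band_label sym 0).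

(* What is left of a hub once the caret of T_- hanging below the spine has been
   cancelled by R2: three strands with incoming labels [f] and outgoing labels [g]. *)
Definition dnode (f g : port -> nat) (j : 'I_N) : seq (pdnode label) :=
  [:: XN true (ch (f (pa j))) (gap (item (pa j))) (ch (f (pk j))) (ch (g (pa j)));
      XN false (gap (item (pa j))) (ch (g (pb j))) (ch (f (pb j))) (ch (g (pk j)))].

Definition dcode (f g : port -> nat) (cs : seq (pdnode label)) : seq (pdnode label) :=
  flatten [seq dnode f g j | j <- enum 'I_N] ++ cs.

Definition rnode (inn out : sym -> nat) (i : nat) : seq (pdnode label) :=
  [:: CN (ch (inn (recA i))) (ch (out (recB i)));
      CN (ch (inn (recB i))) (ch (out (recA i)))].

Definition rcode (inn out : sym -> nat) (R : nat) :=
  flatten [seq rnode inn out i | i <- iota 0 R].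

Definition itemsA : seq sym := flatten [seq [:: item (pk j); item (pa j)] | j <- enum 'I_N].
Definition itemsB : seq sym := [seq item (pb j) | j <- enum 'I_N].

(** [conf_head] is kept for reducedness: the first caret of [al] is the deepest one of the comb,
    with the leaves 0 and 1. *)
Record conf (R : nat) (al be : seq sym) (inn out : sym -> nat) : Prop := Conf {
  conf_al : perm_eq al (itemsA ++ map recA (iota 0 R));
  conf_be : perm_eq be (itemsB ++ map recB (iota 0 R));
  conf_head : exists j al', al = item (pk j) :: al';
  conf_chain : exists x y, chain inn out x al y /\ chain inn out y be x;
  conf_uniq : uniq (map inn (al ++ be)) }.

Lemma itemsA_uniq : uniq itemsA.
Proof.
have -> : itemsA = [seq item (inl p) | p <- flatten [seq [:: (j, false); (j, true)] | j <- enum 'I_N]].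
  rewrite map_flatten -map_comp; congr flatten; apply: eq_map => j //.
rewrite map_inj_uniq; last by move=> p q [].
apply: count_mem_uniq => -[j b].
have -> : count_mem (j, b) (flatten [seq [:: (i, false); (i, true)] | i <- enum 'I_N]) = count_mem j (enum 'I_N).
  elim: (enum 'I_N) => //= i l ->; rewrite !xpair_eqE; case: (i == j) => //=; by case: b.
rewrite count_uniq_mem ?enum_uniq // mem_enum inE; congr nat_of_bool; apply/esym.
apply/flatten_mapP; exists j; first by rewrite mem_enum.
by rewrite !inE !xpair_eqE eqxx; case: b.
Qed.

Lemma conf_uniqA R al be inn out : conf R al be inn out -> uniq al.
Proof.
move=> h; rewrite (perm_uniq (conf_al h)) cat_uniq itemsA_uniq map_inj_uniq ?iota_uniq ?andbT; last by move=> ? ? [].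
apply/hasPn => x /mapP [i _ ->]; apply/negP => /flatten_mapP [j _].
by rewrite !inE.
Qed.

Lemma conf_bands R al be inn out : conf R al be inn out -> perm_eq al (spine_bands kind_of be).
Proof.
move=> h; apply: (perm_trans (conf_al h)); rewrite perm_sym.
apply: (@perm_trans _ (flatten [seq bands_of kind_of e | e <- itemsB ++ map recB (iota 0 R)])).
  rewrite /spine_bands; apply: perm_flatten; apply: perm_map.
  by rewrite perm_rev; apply: (conf_be h).
rewrite map_cat flatten_cat; apply: perm_cat.
  rewrite /itemsB /itemsA -map_comp; apply/seq.permP => p.
  by elim: (enum 'I_N) => //= j l; lia.
by rewrite -map_comp; apply/seq.permP => p; elim: (iota 0 R) => //= i l; lia.
Qed.

Lemma perm_flatten_cat (I : Type) (T : eqType) (F G : I -> seq T) l :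
  perm_eq (flatten (map F l) ++ flatten (map G l)) (flatten [seq F i ++ G i | i <- l]).
Proof.
apply/seq.permP => p; elim: l => //= i l; rewrite !count_cat; lia.
Qed.

Lemma red_R1l (T : eqType) (x y z : T) : red [:: XN false z x x y] [:: CN y z].
Proof.
apply: RedTrans (red_turn _ _ _ _ _) _.
by apply: (@RedRule _ [:: _] [:: _] [::]); constructor.
Qed.

Lemma red_R1r (T : eqType) (x y z : T) : red [:: XN true x z y x] [:: CN z y].
Proof.
apply: RedTrans (red_turn2 _ _ _ _ _) _; apply: RedTrans (red_turn _ _ _ _ _) _.
by apply: (@RedRule _ [:: _] [:: _] [::]); constructor.
Qed.

(** The caret [pk j] of T_+ and the hanging caret of T_- share both strands of a band and cancel by
    R2. Of the two arcs left, one joins the leaf of [pa j] to the strand entering [pk j], the other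
    joins the edge above the hanging caret to the strand leaving [pk j]. *)
Lemma red_hub inn out j :
  red ([:: comb_node inn out (item (pk j)); comb_node inn out (item (pa j))] ++
       spine_node inn kind_of (item (pb j)) (ch (out (item (pb j)))))
      (dnode (inn \o item) (out \o item) j).
Proof.
rewrite /spine_node /comb_node /=.
set A := XN true _ _ _ (ch (out (item (pa j)))).
set B := XN false _ _ _ (band_label 3 _).
set K := XN false _ _ _ _; set Ak := XN true _ _ _ (ch (out (item (pk j)))).
apply: (@RedTrans _ ([:: Ak; K] ++ [:: A; B])).
  by apply: red_perm; apply/seq.permP => p /=; lia.
apply: RedTrans (red_catr _ (red_R2 true _ _ _ _ _ _)) _ => /=.
set C1 := CN _ _; set C2 := CN _ _.
apply: (@RedTrans _ ([:: C1; A] ++ [:: C2; B])).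
  by apply: red_perm; apply/seq.permP => p /=; lia.
apply: (@red_cat _ _ [:: _] _ [:: _]); first exact: red_join3.
apply: RedTrans (red_catr [:: B] (red_swap _ _)) _; exact: red_join4.
Qed.

(** R2 on the shared band: the strand running along T_+ now leaves along T_-, and conversely. *)
Lemma red_rec inn out i :
  red ([:: comb_node inn out (recA i)] ++ spine_node inn kind_of (recB i) (ch (out (recB i))))
      (rnode inn out i).
Proof. exact: red_R2. Qed.

Lemma red_conf R al be inn out : conf R al be inn out ->
  red (map (comb_node inn out) al ++
       flatten [seq spine_node inn kind_of e (ch (out e)) | e <- be])
      (dcode (inn \o item) (out \o item) (rcode inn out R)).
Proof.
move=> h.
have hA : perm_eq (map (comb_node inn out) al) (map (comb_node inn out) (itemsA ++ map recA (iota 0 R))).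
  exact/perm_map/(conf_al h).
have hB : perm_eq (flatten [seq spine_node inn kind_of e (ch (out e)) | e <- be])
   (flatten [seq spine_node inn kind_of e (ch (out e)) | e <- itemsB ++ map recB (iota 0 R)]).
  exact/perm_flatten/perm_map/(conf_be h).
apply: RedTrans (red_perm (perm_cat hA hB)) _.
rewrite !map_cat flatten_cat.
set I1 := map _ itemsA; set I2 := map _ (map recA _); set I3 := flatten (map _ itemsB); set I4 := flatten _.
apply: (@RedTrans _ ((I1 ++ I3) ++ (I2 ++ I4))).
  by apply: red_perm; apply/seq.permP => p; rewrite !count_cat; lia.
apply: red_cat.
  apply: (@RedTrans _ (flatten [seq [:: comb_node inn out (item (pk j)); comb_node inn out (item (pa j))] ++
       spine_node inn kind_of (item (pb j)) (ch (out (item (pb j)))) | j <- enum 'I_N])); last first.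
    by apply: red_flatten => j; apply: red_hub.
  apply: red_perm; apply: perm_trans (perm_flatten_cat _ _ _); apply: perm_cat.
    by rewrite /I1 /itemsA map_flatten -map_comp.
  by rewrite /I3 /itemsB -map_comp.
apply: (@RedTrans _ (flatten [seq [:: comb_node inn out (recA i)] ++
       spine_node inn kind_of (recB i) (ch (out (recB i))) | i <- iota 0 R])); last first.
  by apply: red_flatten => i; apply: red_rec.
apply: red_perm; apply: perm_trans (perm_flatten_cat _ _ _); apply: perm_cat.
  by rewrite /I2 -map_comp; apply/seq.permP => p; elim: (iota 0 R) => //= i l; lia.
by rewrite /I4 -map_comp.
Qed.

Definition upd (g : port -> nat) (p : port) (v : nat) : port -> nat :=
  fun q => if q == p then v else g q.

Lemma eq_dcode f g g' cs : g =1 g' -> dcode f g cs = dcode f g' cs.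
Proof. by move=> e; rewrite /dcode /dnode; congr (flatten _ ++ _); apply: eq_map => j; rewrite !e. Qed.

Lemma upd_same g p v : upd g p v p = v. Proof. by rewrite /upd eqxx. Qed.

Lemma upd_other g p v q : q <> p -> upd g p v q = g q.
Proof. by move=> /eqP n; rewrite /upd (negbTE n). Qed.

(** Absorbs the joining points created by a connector: each one renames a single outgoing leg of one
    hub. *)
Lemma red_join_port f g p v cs :
  red (dcode f g (CN (ch (g p)) (ch v) :: cs)) (dcode f (upd g p v) cs).
Proof.
pose j := match p with inl (j, _) => j | inr j => j end.
have hj : j \in enum 'I_N by rewrite mem_enum.
have [l1 [l2 el]] : exists l1 l2, enum 'I_N = l1 ++ j :: l2.
  by case/splitPr: hj => l1 l2; exists l1, l2.
have hn l : j \notin l -> [seq dnode f (upd g p v) i | i <- l] = [seq dnode f g i | i <- l].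
  move=> hl; apply/eq_in_map => i hi; have nij : i != j by apply: contraNneq hl => <-.
  have h q : (match q with inl (j, _) => j | inr j => j end) = i -> upd g p v q = g q.
    move=> hq; rewrite /upd; case: eqP => // e; move: nij; rewrite -hq e /j; by rewrite eqxx.
  by rewrite /dnode !h.
have [n1 n2] : j \notin l1 /\ j \notin l2.
  have := enum_uniq 'I_N; rewrite el cat_uniq /= => /and3P[_ h1 /andP[h2 _]]; split=> //.
  by apply: contra h1 => h; rewrite /= h.
rewrite /dcode el !map_cat !flatten_cat /= (hn _ n1) (hn _ n2).
set F1 := flatten _; set F2 := flatten _.
apply: (@RedTrans _ (([:: CN (ch v) (ch (g p))] ++ dnode f g j) ++ (F1 ++ F2 ++ cs))).
  apply: (@RedTrans _ ([:: CN (ch (g p)) (ch v)] ++ (dnode f g j ++ (F1 ++ F2 ++ cs)))).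
    by apply: red_perm; apply/seq.permP => q; rewrite /dnode /= !count_cat /= ?count_cat; lia.
  by rewrite -!catA; apply: red_catr; apply: red_swap.
apply: (@RedTrans _ (dnode f (upd g p v) j ++ (F1 ++ F2 ++ cs))); last first.
  by apply: red_perm; apply/seq.permP => q; rewrite /dnode /= !count_cat /= ?count_cat; lia.
apply: red_catr; rewrite /j /dnode; case: p {hn n1 n2 hj el F1 F2 l1 l2 j} => [[j []]|j].
- rewrite upd_same !upd_other //.
  exact: (red_catr [:: _] (red_join4 _ _ _ _ _ _)).
- rewrite upd_same !upd_other //.
  set A := XN true _ _ _ _; set B := XN false _ _ _ _; set C := CN _ _.
  apply: (@RedTrans _ ([:: A] ++ [:: C; B])); first by apply: red_perm; apply/seq.permP => q /=; lia.
  exact: (red_catl [:: A] (red_join4 _ _ _ _ _ _)).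
- rewrite upd_same !upd_other //.
  set A := XN true _ _ _ _; set B := XN false _ _ _ _; set C := CN _ _.
  apply: (@RedTrans _ ([:: A] ++ [:: C; B])); first by apply: red_perm; apply/seq.permP => q /=; lia.
  exact: (red_catl [:: A] (red_join2 _ _ _ _ _ _)).
Qed.

Lemma chain_ext inn out inn' out' x (l : seq sym) y : {in l, inn =1 inn'} -> {in l, out =1 out'} ->
  chain inn out x l y -> chain inn' out' x l y.
Proof.
elim: l x => //= e l IH x hi ho [h1 h2]; rewrite -hi ?mem_head //; split=> //.
rewrite -ho ?mem_head //; apply: IH h2 => i hl; [apply: hi | apply: ho]; by rewrite inE hl orbT.
Qed.

Lemma perm_insert (T : eqType) (l l1 l2 : seq T) x y : l = l1 ++ x :: l2 ->
  perm_eq (l1 ++ [:: x, y & l2]) (y :: l).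
Proof. by move=> ->; apply/seq.permP => p; rewrite /= !count_cat /=; lia. Qed.

(* Inserting a connector just after a strand of T_+ and just after a strand of T_-
   exchanges the arcs leaving them. *)
Lemma conf_insert R al be inn out i b t : let s : port := inl (i, b) in
  conf R al be inn out -> exists al' be' inn' out' x' y',
  [/\ conf R.+1 al' be' inn' out',
      forall p, inn' (item p) = inn (item p),
      forall p, out' (item p) = if p == s then x' else if p == pb t then y' else out (item p)
    & perm_eq (rcode inn' out' R.+1)
        ([:: CN (ch x') (ch (out (item (pb t)))); CN (ch y') (ch (out (item s)))] ++
         rcode inn out R)].
Proof.
move=> s hc; have [hal hbe [j0 [al0 hd]] [x [y [ch1 ch2]]] hu] := hc.
have [x' [y' [hx hy nxy]]] := fresh_pair (map inn (al ++ be)).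
pose inn' (e : sym) := if e == recA R then x' else if e == recB R then y' else inn e.
pose out' (e : sym) := if e == item s then x' else if e == item (pb t) then y' else
  if e == recA R then out (item s) else if e == recB R then out (item (pb t)) else out e.
have mA e : e \in al -> [/\ e != recA R, e != recB R & e != item (pb t)].
  rewrite (perm_mem hal) mem_cat => /orP[/flatten_mapP[j _]|/mapP[k hk ->]].
    by rewrite !inE => /orP[] /eqP ->.
  split=> //; apply: contraTneq hk => -[->]; by rewrite mem_iota add0n ltnn.
have mB e : e \in be -> [/\ e != recA R, e != recB R & e != item s].
  rewrite (perm_mem hbe) mem_cat => /orP[/mapP[j _ ->]//|/mapP[k hk ->]].
  split=> //; apply: contraTneq hk => -[->]; by rewrite mem_iota add0n ltnn.
have sal : item s \in al.
  rewrite (perm_mem hal) mem_cat; apply/orP; left; apply/flatten_mapP; exists i; first by rewrite mem_enum.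
  by rewrite /s; case: b {s inn' out' mA mB}; rewrite !inE eqxx ?orbT.
have tbe : item (pb t) \in be.
  by rewrite (perm_mem hbe) mem_cat; apply/orP; left; apply/map_f; rewrite mem_enum.
have ual := conf_uniqA hc.
have ube : uniq be.
  by move: hu; rewrite map_cat cat_uniq => /and3P[_ _ /map_uniq].
have [a1 [a2 ea]] : exists a1 a2, al = a1 ++ item s :: a2.
  by case/splitPr: sal => a1 a2; exists a1, a2.
have [b1 [b2 eb]] : exists b1 b2, be = b1 ++ item (pb t) :: b2.
  by case/splitPr: tbe => b1 b2; exists b1, b2.
have sa e : e \in a1 ++ a2 -> e != item s.
  move=> he; apply/eqP => ee; move: ual; rewrite ea -cat1s uniq_catCA /= -ee he //.
have sb e : e \in b1 ++ b2 -> e != item (pb t).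
  move=> he; apply/eqP => ee; move: ube; rewrite eb -cat1s uniq_catCA /= -ee he //.
have ina e : e \in a1 ++ a2 -> e \in al.
  by rewrite ea !mem_cat inE; case: (e \in a1) => //= ->; rewrite orbT.
have inb e : e \in b1 ++ b2 -> e \in be.
  by rewrite eb !mem_cat inE; case: (e \in b1) => //= ->; rewrite orbT.
have i1 e : e \in al ++ be -> inn e = inn' e.
  by rewrite mem_cat /inn' => /orP[/mA[n1 n2 _]|/mB[n1 n2 _]]; rewrite (negbTE n1) (negbTE n2).
have o1 e : e \in a1 ++ a2 -> out e = out' e.
  move=> he; have [n1 n2 n3] := mA _ (ina _ he); have n4 := sa _ he.
  by rewrite /out' (negbTE n1) (negbTE n2) (negbTE n3) (negbTE n4).
have o2 e : e \in b1 ++ b2 -> out e = out' e.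
  move=> he; have [n1 n2 n3] := mB _ (inb _ he); have n4 := sb _ he.
  by rewrite /out' (negbTE n1) (negbTE n2) (negbTE n3) (negbTE n4).
have os : out' (item s) = x' by rewrite /out' eqxx.
have ot : out' (item (pb t)) = y' by rewrite /out' (_ : (item (pb t) == item s) = false) // eqxx.
have oA : out' (recA R) = out (item s).
  by rewrite /out' (_ : (recA R == item s) = false) // (_ : (recA R == item (pb t)) = false) // eqxx.
have oB : out' (recB R) = out (item (pb t)).
  rewrite /out' (_ : (recB R == item s) = false) // (_ : (recB R == item (pb t)) = false) //.
  by rewrite (_ : (recB R == recA R) = false) // eqxx.
have iA : inn' (recA R) = x' by rewrite /inn' eqxx.
have iB : inn' (recB R) = y' by rewrite /inn' (_ : (recB R == recA R) = false) // eqxx.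
have cl l1 e l2 v f z w : chain inn out v (l1 ++ e :: l2) w -> {in l1 ++ e :: l2, inn =1 inn'} ->
    {in l1 ++ l2, out =1 out'} -> inn' f = out' e -> out' f = out e -> z = w ->
    chain inn' out' v (l1 ++ [:: e, f & l2]) z.
  move=> /chain_cat[u h1 [h2 h3]] hi ho hf hf' ->; apply/chain_cat; exists u.
    by apply: chain_ext h1 => k hk; [apply: hi|apply: ho]; rewrite mem_cat hk.
  split; first by rewrite -hi // mem_cat mem_head orbT.
  split=> //; rewrite hf'; apply: chain_ext h3 => k hk; [apply: hi|apply: ho];
    by rewrite mem_cat ?inE hk !orbT.
have h' : conf R.+1 (a1 ++ [:: item s, recA R & a2]) (b1 ++ [:: item (pb t), recB R & b2]) inn' out'.
  split.
  - rewrite (perm_trans (perm_insert (recA R) ea)) // -(addn1 R) iotaD map_cat catA /= add0n.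
    by rewrite cats1 perm_sym perm_rcons perm_cons perm_sym.
  - rewrite (perm_trans (perm_insert (recB R) eb)) // -(addn1 R) iotaD map_cat catA /= add0n.
    by rewrite cats1 perm_sym perm_rcons perm_cons perm_sym.
  (* The connector comes after [item s], so the first caret of T_+ stays the same. *)
  - move: hd; rewrite ea; case: (a1) => [|e a1'] /(congr1 (head (item s))) /= ->.
      by exists j0, (recA R :: a2).
    by exists j0, (a1' ++ [:: item s, recA R & a2]).
  - exists x, y; split.
      rewrite ea in ch1; apply: (cl _ _ _ _ _ _ _ ch1) => //; [|by rewrite iA os].
      by move=> e he; apply: i1; rewrite mem_cat ea he.
    rewrite eb in ch2; apply: (cl _ _ _ _ _ _ _ ch2) => //; [|by rewrite iB ot].
    by move=> e he; apply: i1; rewrite mem_cat eb he orbT.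
  - have e1 : perm_eq (map inn' ((a1 ++ [:: item s, recA R & a2]) ++ (b1 ++ [:: item (pb t), recB R & b2])))
        (x' :: y' :: map inn (al ++ be)).
      have -> : map inn (al ++ be) = map inn' (al ++ be) by apply/eq_in_map.
      rewrite -iA -iB -!map_cons; apply: perm_map.
      apply: perm_trans (perm_cat (perm_insert (recA R) ea) (perm_insert (recB R) eb)) _.
      by rewrite /= perm_cons -cat1s perm_catCA.
    by rewrite (perm_uniq e1) /= inE negb_or nxy hx hy.
exists (a1 ++ [:: item s, recA R & a2]), (b1 ++ [:: item (pb t), recB R & b2]), inn', out', x', y'.
split=> //.
rewrite /rcode -addn1 iotaD map_cat flatten_cat /= add0n perm_catC.
have -> : [seq rnode inn' out' k | k <- iota 0 R] = [seq rnode inn out k | k <- iota 0 R].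
  apply/eq_in_map => k; rewrite mem_iota add0n => /= hk.
  have nk : (k == R) = false by apply/negbTE; rewrite neq_ltn hk.
  have nA : (recA k == recA R) = false by rewrite -nk; apply/eqP/eqP => [[]|->].
  have nB : (recB k == recB R) = false by rewrite -nk; apply/eqP/eqP => [[]|->].
  by rewrite /rnode /inn' /out' nA nB.
by rewrite /rnode iA iB oA oB perm_refl.
Qed.

(** Yields the transpositions within one tree from those between the two, [b] being a strand of the
    other tree. *)
Lemma tperm_conj (s s' b : port) : s != s' -> s' != b -> s != b ->
  (tperm s s' = tperm s b * tperm s' b * tperm s b)%g.
Proof.
move=> n1 n2 n3; rewrite -{1}(tpermV s b) -mulgA -conjgE tpermJ.
rewrite tpermR tpermD //; first exact: tpermC.
by rewrite eq_sym.
Qed.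

(** Quantified over all configurations, because an insertion changes the lists and labels and the
    next one must apply to the result. *)
Definition realizable_permutation (tau : {perm port}) := forall R al be inn out,
  conf R al be inn out -> exists R' al' be' inn' out', conf R' al' be' inn' out' /\
  red (dcode (inn' \o item) (out' \o item) (rcode inn' out' R'))
      (dcode (inn \o item) (out \o item \o tau) (rcode inn out R)).

Lemma red_insert R al be inn out i b t (tau : {perm port}) : let s : port := inl (i, b) in
  conf R al be inn out -> exists al' be' inn' out', conf R.+1 al' be' inn' out' /\
  red (dcode (inn' \o item) (out' \o item \o tau) (rcode inn' out' R.+1))
      (dcode (inn \o item) (out \o item \o (tau * tperm s (pb t))%g) (rcode inn out R)).
Proof.
move=> s hc; have [al' [be' [inn' [out' [x' [y' [hc' hi ho hr]]]]]]] := conf_insert i b t hc.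
exists al', be', inn', out'; split=> //.
(* The outgoing labels are already permuted by [tau], so those of [s] and [pb t] are found at the
   preimages of these ports. *)
pose p1 := (tau^-1)%g s; pose p2 := (tau^-1)%g (pb t).
have e1 : tau p1 = s by rewrite permKV.
have e2 : tau p2 = pb t by rewrite permKV.
pose g := out' \o item \o tau.
have g1 : g p1 = x' by rewrite /g /= e1 ho eqxx.
have n12 : p2 <> p1 by move=> e; have : s = pb t by rewrite -e1 -e2 e.
have g2 : upd g p1 (out (item (pb t))) p2 = y'.
  by rewrite upd_other // /g /= e2 ho eqxx.
apply: (@RedTrans _ (dcode (inn' \o item) g (CN (ch (g p1)) (ch (out (item (pb t)))) ::
     CN (ch y') (ch (out (item s))) :: rcode inn out R))).
  by rewrite g1; apply: red_perm; apply: perm_cat.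
apply: RedTrans (red_join_port _ _ _ _ _) _; rewrite -{1}g2.
apply: RedTrans (red_join_port _ _ _ _ _) _.
have -> : dcode (inn \o item) (out \o item \o (tau * tperm s (pb t))%g) (rcode inn out R) =
   dcode (inn' \o item) (out \o item \o (tau * tperm s (pb t))%g) (rcode inn out R).
  by rewrite /dcode /dnode; congr (flatten _ ++ _); apply: eq_map => j; rewrite /= !hi.
rewrite (@eq_dcode _ _ (out \o item \o (tau * tperm s (pb t))%g)); first exact: red_refl.
move=> p; rewrite /= permM.
have [->|/eqP m2] := eqVneq p p2; first by rewrite upd_same e2 tpermR.
rewrite upd_other //; have [->|/eqP m1] := eqVneq p p1; first by rewrite upd_same e1 tpermL.
rewrite upd_other // /g /= ho.
have q1 : s != tau p by apply/eqP => e; apply: m1; rewrite /p1 e permK.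
have q2 : pb t != tau p by apply/eqP => e; apply: m2; rewrite /p2 e permK.
by rewrite tpermD // ![tau p == _]eq_sym (negbTE q1) (negbTE q2).
Qed.

Lemma realizable_all (tau : {perm port}) : 0 < N -> realizable_permutation tau.
Proof.
move=> N0; pose j0 : 'I_N := Ordinal N0.
have step i b t tau0 : realizable_permutation tau0 -> realizable_permutation (tau0 * tperm (inl (i, b) : port) (pb t))%g.
  move=> h R al be inn out hc; have [al' [be' [inn' [out' [hc' hr]]]]] := red_insert i b t tau0 hc.
  have [R2 [al2 [be2 [inn2 [out2 [hc2 hr2]]]]]] := h _ _ _ _ _ hc'.
  by exists R2, al2, be2, inn2, out2; split=> //; apply: RedTrans hr2 hr.
have step2 (s s' : port) tau0 : s != s' -> realizable_permutation tau0 -> realizable_permutation (tau0 * tperm s s')%g.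
  case: s => [[i b]|t]; case: s' => [[i' b']|t'] n h.
  (* Both strands belong to T_+: conjugation by a strand of T_-, which exists because [N] is
     positive. *)
  - by rewrite (@tperm_conj _ _ (pb j0)) // !mulgA; do 3 apply: (step).
  - exact: step.
  - by rewrite tpermC; apply: step.
  - rewrite (@tperm_conj _ _ (pa j0)) // !mulgA ![tperm (inr _) _]tpermC.
    by do 3 apply: (step).
have [ts -> /allP hts] := prod_tpermP tau.
elim/last_ind: ts hts => [|ts [s s'] IH] hts.
  rewrite big_nil => R al be inn out hc; exists R, al, be, inn, out; split=> //.
  rewrite (@eq_dcode _ (out \o item \o _) (out \o item)); first exact: red_refl.
  by move=> p /=; rewrite perm1.
rewrite big_rcons /=; apply: step2; first by apply: (hts (s, s')); rewrite mem_rcons mem_head.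
by apply: IH => x hx; apply: hts; rewrite mem_rcons inE hx orbT.
Qed.

End Configurations.

(** * Configurations without connectors, and arbitrary labels of the hubs *)

Section Base.
Variable N : nat.
Hypothesis N0 : 0 < N.
Variables f g : port N -> nat.

Definition ports : seq (port N) :=
  flatten [seq [:: pk j; pa j] | j <- enum 'I_N] ++ [seq pb j | j <- enum 'I_N].

Lemma mem_ports p : p \in ports.
Proof.
rewrite mem_cat; case: p => [[j b]|j]; last first.
  by apply/orP; right; apply/map_f; rewrite mem_enum.
apply/orP; left; apply/flatten_mapP; exists j; first by rewrite mem_enum.
by case: b; rewrite !inE eqxx ?orbT.
Qed.

Hypotheses (uf : uniq (map f ports)) (fg : perm_eq (map g ports) (map f ports)).

Let syms : seq (sym N) := map (@item N) ports.
Let inn (e : sym N) : nat := if e is inl p then f p else 0.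
Let z : nat := inn (head (item (pb (Ordinal N0))) syms).
(** The cyclic successor: after the last symbol [nth] returns its default [z], the first label,
    which closes the circuit. *)
Let out (e : sym N) : nat := nth z (map inn syms) (index e syms).+1.

Lemma base_inn : map inn syms = map f ports.
Proof. by rewrite -map_comp; apply: eq_map. Qed.

Lemma base_uniq : uniq syms.
Proof. by apply: (map_uniq (f := inn)); rewrite base_inn. Qed.

Lemma base_chain l1 l2 : syms = l1 ++ l2 ->
  chain inn out (nth z (map inn syms) (size l1)) l2 z.
Proof.
elim: l2 l1 => [|e l2 IH] l1 hs /=.
  by rewrite nth_default // hs cats0 size_map.
have hi : index e syms = size l1.
  have := base_uniq; rewrite hs cat_uniq /= negb_or => /and3P[_ /andP[h _] _].
  by rewrite index_cat (negbTE h) /= eqxx addn0.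
split; first by rewrite hs map_cat nth_cat size_map ltnn subnn.
have -> : out e = nth z (map inn syms) (size l1).+1 by rewrite /out hi.
by have := IH (rcons l1 e); rewrite size_rcons cat_rcons; apply.
Qed.

Lemma base_nonnil : syms != [::].
Proof.
by apply/eqP => h; have := map_f (@item N) (mem_ports (pb (Ordinal N0))); rewrite -/syms h.
Qed.

Lemma base_conf : exists al be, conf 0 al be inn out.
Proof.
exists (map (@item N) (flatten [seq [:: pk j; pa j] | j <- enum 'I_N])), (map (@item N) [seq pb j | j <- enum 'I_N]).
split.
- rewrite cats0 /itemsA map_flatten -map_comp; exact: perm_refl.
- by rewrite cats0 /itemsB -map_comp.
- have : Ordinal N0 \in enum 'I_N by rewrite mem_enum.
  case: (enum 'I_N) => // j l _; exists j; eexists; reflexivity.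
- have e0 : nth z (map inn syms) 0 = z by rewrite /z; case: (syms) base_nonnil.
  have c : chain inn out z syms z by have := @base_chain [::] syms erefl; rewrite e0.
  rewrite /syms /ports map_cat in c; case/chain_cat: c => y h1 h2.
  by exists z, y.
- by rewrite -map_cat -/syms base_inn.
Qed.

Lemma base_out p : exists q, out (item q) = g p.
Proof.
have : g p \in map inn syms by rewrite base_inn -(perm_mem fg); apply: map_f; apply: mem_ports.
have H i : i < size syms -> exists q, out (item q) = nth z (map inn syms) i.+1.
  move=> hi; pose q0 := pb (Ordinal N0).
  exists (nth q0 ports i); rewrite /out; congr (nth _ _ _.+1).
  have hi' : i < size ports by rewrite /syms size_map in hi.
  by rewrite -(nth_map _ (item q0)) // index_uniq ?base_uniq.
move/(nthP z) => [[|k] hk <-]; rewrite size_map in hk; last by apply: H; lia.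
(* The first label is the one leaving the last symbol. *)
have [|q hq] := H (size syms).-1; first by lia.
exists q; rewrite hq prednK // nth_default ?size_map //.
by rewrite /z; case: (syms) hk.
Qed.

Lemma base_perm : exists tau : {perm port N}, forall p, out (item (tau p)) = g p.
Proof.
pose t p := odflt p [pick q | out (item q) == g p].
have ht p : out (item (t p)) = g p.
  rewrite /t; case: pickP => [q /eqP //|h]; have [q hq] := base_out p.
  by have := h q; rewrite hq eqxx.
have ug : uniq (map g ports) by rewrite (perm_uniq fg).
have it : injective t.
  move=> p q e; have egpq : g p = g q by rewrite -!ht e.
  have hi : index p ports = index q ports.
    apply/eqP; rewrite -(nth_uniq 0 _ _ ug) ?size_map ?index_mem ?mem_ports //.
    by rewrite !(nth_map p) ?index_mem ?mem_ports // !nth_index ?mem_ports // egpq.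
  by rewrite -(nth_index p (mem_ports p)) hi nth_index ?mem_ports.
by exists (perm it) => p; rewrite permE.
Qed.

(** The labels [g] are a rearrangement of [f], so they differ from the cyclic successor labels [out]
    by a permutation of the ports, and every permutation is realizable. *)
Lemma labels_realized : exists R al be inn out, @conf N R al be inn out /\
  red (dcode (inn \o @item N) (out \o @item N) (rcode inn out R)) (dcode f g [::]).
Proof.
have [al [be hc]] := base_conf; have [tau ht] := base_perm.
have [R [al' [be' [inn' [out' [hc' hr]]]]]] := realizable_all tau N0 hc.
exists R, al', be', inn', out'; split=> //; apply: RedTrans hr _.
by rewrite (@eq_dcode _ _ _ g) //; apply: red_refl.
Qed.

End Base.

(** * Closing strands of the hubs to obtain a given oriented code *)

Section Target.
Variable P : seq (pdnode nat).
Notation N := (size P).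
Hypotheses (N0 : 0 < N) (uP : uniq (outs P)) (pP : perm_eq (ins P) (outs P)).

Definition node_at (j : nat) : pdnode nat := nth (CN 0 0) P j.

(* A hub becomes any given node when one of its strands (for a crossing) or two of
   them (for a joining point) are closed up to kinks.  The labels of the code are
   multiplied by 3, the other residues being used for the kinks. *)
Definition target_in (p : port N) : nat :=
  match p with
  | inl (j, true) => if node_at j is inl (true, x, _, _, _) then 3 * x else 3 * j + 1
  | inl (j, false) => match node_at j with
      | inl (true, _, _, z, _) => 3 * z
      | inl (false, x, _, _, _) => 3 * x
      | inr (x, _) => 3 * x
      end
  | inr j => match node_at j with
      | inl (true, _, _, _, _) => 3 * j + 1
      | inl (false, _, _, z, _) => 3 * z
      | inr _ => 3 * j + 2
      end
  end.

Definition target_out (p : port N) : nat :=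
  match p with
  | inl (j, true) => if node_at j is inl (true, _, _, _, t) then 3 * t else 3 * j + 1
  | inl (j, false) => match node_at j with
      | inl (true, _, y, _, _) => 3 * y
      | inl (false, _, _, _, t) => 3 * t
      | inr (_, y) => 3 * y
      end
  | inr j => match node_at j with
      | inl (true, _, _, _, _) => 3 * j + 1
      | inl (false, _, y, _, _) => 3 * y
      | inr _ => 3 * j + 2
      end
  end.

(** Labels of the kinks: one for each node, and a second one for each joining point. *)
Definition extra : seq nat := [seq 3 * j + 1 | j <- iota 0 N] ++
  [seq 3 * j + 2 | j <- iota 0 N & if node_at j is inr _ then true else false].

Lemma seq_node_at : P = [seq node_at (nat_of_ord j) | j <- enum 'I_N].
Proof. by rewrite (map_comp node_at (@nat_of_ord N)) val_enum_ord; apply/esym/mkseq_nth. Qed.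

Lemma count_target (p : pred nat) :
  count p (map target_in (ports N)) = count p (map (muln 3) (ins P) ++ extra) /\
  count p (map target_out (ports N)) = count p (map (muln 3) (outs P) ++ extra).
Proof.
have -> : extra = [seq 3 * nat_of_ord j + 1 | j <- enum 'I_N] ++
    [seq 3 * nat_of_ord j + 2 | j <- enum 'I_N & if node_at (nat_of_ord j) is inr _ then true else false].
  rewrite /extra -val_enum_ord; move: (enum 'I_N) => l; congr (_ ++ _).
    by rewrite -map_comp.
  by rewrite filter_map -map_comp.
have -> : ins P = flatten [seq ins1 (node_at (nat_of_ord j)) | j <- enum 'I_N].
  by rewrite /ins {1}seq_node_at -map_comp.
have -> : outs P = flatten [seq outs1 (node_at (nat_of_ord j)) | j <- enum 'I_N].
  by rewrite /outs {1}seq_node_at -map_comp.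
rewrite /ports !map_cat !count_cat; elim: (enum 'I_N) => [|j l IH] //.
move: IH; rewrite /= ?map_cat ?count_cat; cbn [target_in target_out pk pa pb].
by case: (node_at j) => [[[[[[] x] y] w] t]|[x y]] /= [h1 h2]; split; lia.
Qed.

Lemma extra_uniq (s : seq nat) : uniq s -> uniq (map (muln 3) s ++ extra).
Proof.
move=> us; rewrite /extra !cat_uniq !map_inj_uniq ?filter_uniq ?iota_uniq ?us //=; try by move=> ? ? /=; lia.
rewrite andbT has_cat negb_or; apply/andP; split; last first.
  by apply/hasPn => _ /mapP[j _ ->]; apply/mapP => -[k _]; lia.
by apply/andP; split; apply/hasPn => _ /mapP[j _ ->]; apply/mapP => -[k _]; lia.
Qed.

(** The two crossings of a hub have opposite types. Closing [pb j] turns the second into a kink and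
    leaves a crossing [true]; closing [pa j] turns the first into a kink and leaves a crossing
    [false]; closing both leaves the arc through [pk j]. *)
Lemma red_target : red (dcode target_in target_out [::]) (map (map_pdnode (fun x => chain_label (sym N) (3 * x))) P).
Proof.
have H (U : Type) (F : pdnode nat -> U) :
    map F P = flatten [seq [:: F (node_at (nat_of_ord j))] | j <- enum 'I_N].
  by rewrite {1}seq_node_at -map_comp; elim: (enum 'I_N) => //= j l ->.
rewrite /dcode cats0 H.
apply: red_flatten => j; rewrite /dnode /=.
case: (node_at j) => [[[[[[] x] y] w] t]|[x y]] /=.
- apply: RedTrans (red_catl [:: _] (red_R1l _ _ _)) _.
  apply: (@RedTrans _ ([:: _] ++ [:: _])); first by apply: red_perm; rewrite perm_catC.
  exact: red_join2.
- apply: RedTrans (red_catr [:: _] (red_R1r _ _ _)) _.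
  apply: RedTrans (red_catr [:: _] (red_swap _ _)) _; exact: red_join1.
- apply: RedTrans (red_cat (P := [:: _]) (red_R1r _ _ _) (red_R1l _ _ _)) _.
  apply: (@RedTrans _ ([:: _] ++ [:: _])); first by apply: red_perm; rewrite perm_catC.
  apply: RedTrans (red_swap _ _).
  by apply: (@RedRule _ [:: _; _] [:: _] [::]); constructor.
Qed.

Lemma target_realized : exists R al be inn out, @conf N R al be inn out /\
  red (dcode (inn \o @item N) (out \o @item N) (rcode inn out R))
      (map (map_pdnode (fun x => chain_label (sym N) (3 * x))) P).
Proof.
have ui : uniq (ins P) by rewrite (perm_uniq pP).
have hi : perm_eq (map target_in (ports N)) (map (muln 3) (ins P) ++ extra).
  by apply/seq.permP => p; case: (count_target p).
have ho : perm_eq (map target_out (ports N)) (map (muln 3) (outs P) ++ extra).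
  by apply/seq.permP => p; case: (count_target p).
have [||R [al [be [inn [out [hc hr]]]]]] := @labels_realized N N0 target_in target_out.
- by rewrite (perm_uniq hi) extra_uniq.
- apply: (perm_trans ho); rewrite perm_sym; apply: (perm_trans hi).
  by rewrite perm_cat2r; apply: perm_map.
by exists R, al, be, inn, out; split=> //; apply: RedTrans hr red_target.
Qed.

End Target.

(** * Realization in V *)

Lemma attach_neq_leaf T i : attach T i <> Leaf.
Proof. by case: T => //= T1 T2; case: ifP. Qed.

(** The attached caret has two leaves as children, and in a left comb this happens only at the
    deepest caret. *)
Lemma attach_comb T i n : i < leaves T -> attach T i = comb n -> i = 0.
Proof.
elim: T i n => [|T1 IH1 T2 IH2] i n /=; first by lia.
move=> hi; case: ifP => h1; case: n => //= n [].
  by move=> h _; apply: IH1 h.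
by move=> _ /attach_neq_leaf.
Qed.

Lemma index_cons0 (T : eqType) (x y : T) s : index x (y :: s) = 0 -> y = x.
Proof. by rewrite /=; case: (eqVneq y x). Qed.

Section Triple.
Variables (N R : nat) (al be : seq (sym N)) (inn out : sym N -> nat).
Hypotheses (N0 : 0 < N) (hc : conf R al be inn out).
Notation sb := (spine_bands (@kind_of N) be).

Lemma conf_al_neq : al != [::].
Proof. by have [j [a ->]] := conf_head hc. Qed.

Lemma conf_be_neq : be != [::].
Proof.
apply/eqP => h; have := perm_size (conf_be hc).
by rewrite h size_cat /itemsB size_map size_enum_ord /=; lia.
Qed.

Lemma conf_leaves : leaves (spine (map (is_hub (@kind_of N)) be)) = leaves (comb (size al)).
Proof. by rewrite leaves_spine leaves_comb (perm_size (conf_bands hc)). Qed.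

Definition conf_perm : seq nat := 0 :: [seq (index e sb).+1 | e <- al].

Lemma conf_permP : perm_eq conf_perm (iota 0 (leaves (comb (size al)))).
Proof.
rewrite leaves_comb /= perm_cons (map_comp S (index^~ sb)).
rewrite -[1]/(1 + 0) iotaDl; apply: (perm_map S).
have hp := conf_bands hc; have us : uniq sb by rewrite -(perm_uniq hp) (conf_uniqA hc).
apply: (perm_trans (perm_map _ hp)); rewrite (perm_size hp).
suff -> : [seq index p sb | p <- sb] = iota 0 (size sb) by exact: perm_refl.
case e : sb us => [|x0 s] // us.
apply: (@eq_from_nth _ 0); rewrite ?size_map ?size_iota // => i hi.
by rewrite (nth_map x0) // nth_iota // index_uniq.
Qed.

(** The list of bands starts with the bands of the deepest vertex of the spine, that is with some
    [recA i] or [pa i]; in a hub [pk] comes second. *)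
Lemma index_pk j : index (item (pk j)) sb <> 0.
Proof.
rewrite /spine_bands; have : {subset rev be <= be} by move=> x; rewrite mem_rev.
case: (rev be) (size_rev be) => [|e l].
  by move=> h; have := conf_be_neq; rewrite -size_eq0 -h.
move=> _ /(_ e (mem_head _ _)); rewrite (perm_mem (conf_be hc)) mem_cat.
by case/orP => /mapP[i _ ->] /index_cons0 [].
Qed.

Lemma triple_exists : exists t : triple, reduced t /\
  reads (LV t) [::] (family_nodes inn (@kind_of N) al be) [::].
Proof.
have [s hs] := perm_of_seq conf_permP.
pose t := Triple conf_leaves s; exists t; split; last first.
  exact: (@reads_family _ inn (@kind_of N) al be t conf_al_neq conf_be_neq (conf_uniqA hc) (conf_bands hc)).
have sE (k : 'I_(leaves (comb (size al)))) : nat_of_ord (s k) = nth 0 conf_perm k.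
  by rewrite -hs (nth_map k) ?size_enum_ord // nth_ord_enum.
(* A canceling caret of T_+ must hold the leaves 0 and 1. As leaf 0 goes to leaf 0, leaf 1 would
   have to go to leaf 1, against [index_pk]. *)
move=> [t0 [i [h1 _ h3 h4]]]; have i0 : nat_of_ord i = 0 by apply: attach_comb (ltn_ord i) (esym h1).
have lt1 : 1 < leaves (comb (size al)).
  by rewrite leaves_comb ltnS lt0n size_eq0 conf_al_neq.
pose k0 : 'I_(leaves (Tplus t)) := Ordinal (ltnW lt1 : 0 < leaves (Tplus t)).
pose k1 : 'I_(leaves (Tplus t)) := Ordinal (lt1 : 1 < leaves (Tplus t)).
have := h3 i k0; rewrite i0 /shift !leqnn => /(_ erefl); rewrite sE /= => e0.
have := h4 k1; rewrite i0 => /(_ erefl); rewrite sE /= -e0.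
have [j [a ->]] := conf_head hc => -[]; exact: index_pk.
Qed.

End Triple.

(** * Existence of the map represented by a triple *)

Section Intervals.
Local Open Scope ring_scope.
Import Order.TTheory GRing.Theory Num.Theory.
Variable R : realType.

Definition in_interval (I : R * R) (x : R) := (I.1 <= x < I.1 + I.2).

Lemma size_intervals T (a l : R) : size (intervals T a l) = leaves T.
Proof. by elim: T a l => //= T1 IH1 T2 IH2 a l; rewrite size_cat IH1 IH2. Qed.

Lemma nth_intervals T (a l : R) i : 0 < l -> (i < leaves T)%N ->
  let I := nth (0, 1) (intervals T a l) i in
  [/\ 0 < I.2, a <= I.1 & I.1 + I.2 <= a + l].
Proof.
elim: T a l i => [|T1 IH1 T2 IH2] a l i l0 /=; first by case: i => //= _; split.
move=> hi; rewrite nth_cat size_intervals; case: ltnP => h.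
  have [|h1 h2 h3] := IH1 a (l / 2) i _ h; first by lra.
  by split=> //; apply: le_trans h3 _; lra.
have [| |h1 h2 h3] := IH2 (a + l / 2) (l / 2) (i - leaves T1)%N; first by lra.
  lia.
by split=> //; [apply: le_trans h2; lra | apply: le_trans h3 _; lra].
Qed.

Lemma intervals_inj T (a l : R) i j x : 0 < l -> (i < leaves T)%N -> (j < leaves T)%N ->
  in_interval (nth (0, 1) (intervals T a l) i) x ->
  in_interval (nth (0, 1) (intervals T a l) j) x -> i = j.
Proof.
elim: T a l i j => [|T1 IH1 T2 IH2] a l i j l0 /=; first by case: i; case: j.
have l2 : 0 < l / 2 by lra.
move=> hi hj; rewrite !nth_cat !size_intervals; case: ltnP => hi1; case: ltnP => hj1.
- exact: IH1.
- have [_ _ h1] := nth_intervals a l2 hi1.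
  have [|_ h2 _] := @nth_intervals T2 (a + l / 2) (l / 2) (j - leaves T1)%N l2; first by lia.
  rewrite /in_interval => /andP[_ h3] /andP[h4 _].
  by have := lt_le_trans h3 h1; have := le_trans h2 h4; rewrite leNgt => /negbTE ->.
- have [_ _ h1] := nth_intervals a l2 hj1.
  have [|_ h2 _] := @nth_intervals T2 (a + l / 2) (l / 2) (i - leaves T1)%N l2; first by lia.
  rewrite /in_interval => /andP[h4 _] /andP[_ h3].
  by have := lt_le_trans h3 h1; have := le_trans h2 h4; rewrite leNgt => /negbTE ->.
- move=> h1 h2; have := IH2 _ _ (i - leaves T1)%N (j - leaves T1)%N l2 _ _ h1 h2.
  by move=> H; have := H _ _; lia.
Qed.

Lemma represents_exists (t : triple) : exists v : unit_interval R -> unit_interval R, represents t v.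
Proof.
pose I (i : 'I_(leaves (Tplus t))) := nth (0, 1) (intervals (Tplus t) 0 1) i : R * R.
pose J (i : 'I_(leaves (Tplus t))) := nth (0, 1) (intervals (Tminus t) 0 1) (sigma t i) : R * R.
have H (x : unit_interval R) : exists y : unit_interval R,
    forall i, in_interval (I i) (val x) -> val y = (J i).1 + (val x - (I i).1) * ((J i).2 / (I i).2).
  (* If [x] lies in no interval, the formula imposes nothing on its image and [x] itself is taken;
     otherwise [intervals_inj] makes the choice of [i] unambiguous. *)
  have [[i hi]|no] := pselect (exists i, in_interval (I i) (val x)); last first.
    by exists x => i hi; case: no; exists i.
  have [i1 i2 i3] := @nth_intervals (Tplus t) 0 1 i ltr01 (ltn_ord i).
  have hs : (sigma t i < leaves (Tminus t))%N by rewrite same_leaves.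
  have [j1 j2 j3] := @nth_intervals (Tminus t) 0 1 (sigma t i) ltr01 hs.
  have hy : 0 <= (J i).1 + (val x - (I i).1) * ((J i).2 / (I i).2) < 1.
    case/andP: hi => h1 h2.
    have q0 : 0 < (J i).2 / (I i).2 by apply: divr_gt0.
    apply/andP; split.
      by apply: addr_ge0 => //; apply: mulr_ge0; [rewrite subr_ge0 | apply: ltW].
    apply: lt_le_trans (_ : (J i).1 + (I i).2 * ((J i).2 / (I i).2) <= _).
      by rewrite ltrD2l ltr_pM2r // ltrBlDl.
    by rewrite mulrC divfK ?gt_eqF // -[1]add0r.
  exists (exist (fun y : R => is_true (0 <= y < 1)) _ hy) => k hk; have -> // : k = i.
  apply: val_inj; exact: (intervals_inj ltr01 (ltn_ord k) (ltn_ord i) hk hi).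
have [v hv] := choice H; exists v => i x /=; exact: hv.
Qed.

End Intervals.

(** Words do not contain labels: blocks depend only on the kinds of the nodes, and renaming
    preserves readings. This compares a code with its copy whose labels are multiplied by 3. *)
Lemma real_map (T T' : eqType) (f : T -> T') P w : real P w -> real (map (map_pdnode f) P) w.
Proof.
move=> [u hu ->]; exists u; first by rewrite legs_map; apply: (reads_map f hu).
congr (_ ++ _); move: 0; elim: P {hu} => //= n P IH i; rewrite -IH.
by case: n => [[[[[b x] y] z] t]|[x y]].
Qed.

Lemma reads_real (T : eqType) w (P : seq (pdnode T)) : reads w [::] P [::] ->
  exists2 w', real P w' & teq 0 w w'.
Proof.
move=> /reads_blocks [u [hu ht]]; exists (blocks 0 P ++ u) => //; by exists u.
Qed.

Theorem theorem1 (R : realType) (L : word -> Prop)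
    (hL : virtual_link_type L) (hCC : checkerboard_colorable L) :
  exists v : unit_interval R -> unit_interval R,
    in_V v /\ exists t : triple, reduced_triple_of v t /\ L (LV t).
Proof.
have [S [hS [w [hw [Lw hp]]]]] := hCC.
have ha := immersion_alternating hS hw hp.
have [P [P' [hr hred vP pP uP]]] := alternating_oriented ha.
have [vP' tP] := red_sound hred vP.
(* Without nodes the given diagram would be equivalent to the empty word, which is not a diagram. *)
have N0 : 0 < size P'.
  rewrite lt0n; apply/eqP => /size0nil P0.
  have [w1 [u hu ew]] := real_ex vP'.
  have [w2 r2 t2] := reads_real hr.
  have t3 := tP _ _ r2 (ex_intro2 _ _ u hu ew).
  have [+ _] := teq_vequiv hw (teq_trans t2 t3).
  by rewrite ew P0 (reads_nil hu) // P0.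
have [Q [al [be [inn [out [hc hred2]]]]]] := target_realized N0 uP pP.
have [t [rt ht]] := triple_exists N0 hc.
have [v hv] := represents_exists R t.
exists v; split; first by exists t.
exists t; split=> //.
have [x [y [c1 c2]]] := conf_chain hc.
have vF := family_valid (conf_be_neq N0 hc) (conf_uniq hc) (conf_uniqA hc) (conf_bands hc).
have hred3 := RedTrans (red_family (@kind_of (size P')) (conf_al_neq hc) (conf_be_neq N0 hc) c1 c2) (RedTrans (red_conf hc) hred2).
have [_ tF] := red_sound hred3 vF.
have [w1 r1] := real_ex vP'.
have [w2 r2 t2] := reads_real hr.
have [w3 r3 t3] := reads_real ht.
have [_ hv1] : is_diagram (LV t) /\ vequiv w (LV t).
  (* The diagram [w] is led to a drawing [w1] of its oriented code [P'], and [LV t] to the same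
     word, seen as a drawing of the renamed code. *)
  apply: teq_vequiv hw _; apply: teq_trans t2 _; apply: teq_trans (tP _ _ r2 r1) _.
  apply: teq_trans (teq_sym t3); apply: teq_sym; apply: tF r3 (real_map _ r1).
have [w0 _ hLw] := hL.
by apply/hLw; apply: rst_trans hv1; apply/hLw.
Qed.
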